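(* Let $0<a\le\infty$, let $k(t)$ be in $\mathcal{K}_a$ and let $k(z)$ be its complex extension. Let $\rho_0$ be the distance from the origin of the singularity of $k(z)$ nearest to the origin. Then $$\int_0^a\frac{k(t)\ln^n t}{\omega+t}\,dt=\sum_{j=0}^{\infty}(-1)^j\omega^j\;\mathrm{f.p.}\!\int_0^a\frac{k(t)\ln^n t}{t^{j+1}}\,dt+k(-\omega)\,\Delta_n(\omega)$$ for all $\omega$ satisfying $|\omega|<\min(\rho_0,a)$ and $|\operatorname{Arg}\omega|<\pi$ and for all non-negative integers $n$, where $$\Delta_n(\omega)=-\frac{\operatorname{Log}^{n+1}\omega}{n+1}+2\cdot n!\sum_{j=1}^{\lceil n/2\rceil}\frac{(2^{2j-1}-1)(-1)^j\pi^{2j}B_{2j}}{(n-2j+1)!\,(2j)!}\,(\operatorname{Log}\omega)^{n-2j+1},$$ in which the $B_{2j}$ are the Bernoulli numbers. If the Stieltjes integral exists as $a\to\infty$, then the equality also holds for $a=\infty$, for all $|\omega|<\rho_0$ when $k(z)$ has at least one singularity, or for all $|\omega|<\infty$ when $k(z)$ is entire (with $|\operatorname{Arg}\omega|<\pi$ in both cases). Moreover, $$\int_0^a\frac{k(t)\ln^n t}{\omega+t}\,dt\sim k(0)\,\Delta_n(\omega),\qquad \omega\to0 .$$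
   Context: Class $\mathcal{K}_a$ ($0<a\le\infty$): functions $k(t)$ of a real variable such that (1) $k(0)\ne 0$; (2) $k(t)$ is the restriction to $[0,a)$ of a complex function $k(z)$ (the complex extension) that is analytic at every point of $[0,a)$; (3) the Mellin transform $\int_0^a k(t)t^{-\lambda}\,dt$ exists for $d<\operatorname{Re}(\lambda)<1$ for some $d<1$ ($d=-\infty$ if $a<\infty$, while $d$ may be finite or $-\infty$ if $a=\infty$). $k(-\omega)$ is the value of the complex extension, which is analytic in $|z|<\rho_0$; $\rho_0=\infty$ if $k(z)$ is entire. Finite-part integral: for finite $a$ write, for small $\epsilon>0$, $\int_\epsilon^a k(t)\ln^n t\;t^{-\lambda}\,dt=C_\epsilon+D_\epsilon$, where $C_\epsilon$ is the group of terms that converge as $\epsilon\to0^+$ and $D_\epsilon$ is the group of terms that have no finite limit, consisting only of such terms in powers of $\epsilon$ (possibly with complex exponents) and $\ln\epsilon$, with no constant term. Then $\mathrm{f.p.}\!\int_0^a k(t)\ln^n t\;t^{-\lambda}\,dt=\lim_{\epsilon\to0}C_\epsilon$. For $a=\infty$, $\mathrm{f.p.}\!\int_0^\infty=\lim_{a\to\infty}\mathrm{f.p.}\!\int_0^a$. $\operatorname{Log}\omega=\ln|\omega|+i\operatorname{Arg}\omega$, $-\pi<\operatorname{Arg}\omega\le\pi$, is the principal logarithm; $\operatorname{Log}^{m}\omega=(\operatorname{Log}\omega)^m$. Bernoulli numbers: $B_2=1/6$, $B_4=-1/30$, etc. Empty sums are $0$. *)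

(* Defs.v *)
From Stdlib Require Import Reals Arith Lra Lia List FunctionalExtensionality.
From Coquelicot Require Import Coquelicot.
Open Scope R_scope.

(** * Complex exponential and principal logarithm *)

Definition Cexp (z : C) : C :=
  (exp (Re z) * cos (Im z), exp (Re z) * sin (Im z)).

(** Junk value at [z = 0]. *)
Definition Arg (z : C) : R :=
  if Rle_dec 0 (Im z) then acos (Re z / Cmod z) else - acos (Re z / Cmod z).

Definition Log (z : C) : C := (ln (Cmod z), Arg z).

(** [t ^ s] for real [t > 0] and complex [s]. *)
Definition Rcpow (t : R) (s : C) : C := Cexp (s * RtoC (ln t))%C.

Lemma Cexp_plus (x y : C) : Cexp (x + y) = (Cexp x * Cexp y)%C.
Proof.
unfold Cexp, Re, Im; simpl; rewrite exp_plus, cos_plus, sin_plus.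
apply injective_projections; simpl; ring.
Qed.

Lemma Cexp_0 : Cexp 0 = 1.
Proof.
unfold Cexp, Re, Im; simpl; rewrite exp_0, cos_0, sin_0.
apply injective_projections; simpl; ring.
Qed.

Lemma Arg_bounds (z : C) : z <> 0 -> - PI < Arg z <= PI.
Proof.
intros Hz. pose proof PI_RGT_0 as HPI. unfold Arg.
pose proof (acos_bound (Re z / Cmod z)) as B.
destruct (Rle_dec 0 (Im z)) as [H|H]; [lra|].
split; [|lra]. apply Ropp_lt_contravar.
destruct (Rle_lt_or_eq_dec _ _ (proj2 B)) as [L|E]; [exact L|exfalso].
assert (M : 0 < Cmod z) by now apply Cmod_gt_0.
assert (Q : (Cmod z)² = (Re z)² + (Im z)²).
{ unfold Cmod, Re, Im. rewrite Rsqr_sqrt; [unfold Rsqr; ring|].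
  pose proof (pow2_ge_0 (fst z)); pose proof (pow2_ge_0 (snd z)); lra. }
assert (K : -1 < Re z / Cmod z).
{ apply (Rmult_lt_reg_r (Cmod z)); [exact M|].
  unfold Rdiv; rewrite Rmult_assoc, Rinv_l; [|lra]. unfold Rsqr in Q. nra. }
assert (K' : Re z / Cmod z <= 1).
{ apply (Rmult_le_reg_r (Cmod z)); [exact M|].
  unfold Rdiv; rewrite Rmult_assoc, Rinv_l; [|lra]. unfold Rsqr in Q. nra. }
assert (c : cos (acos (Re z / Cmod z)) = Re z / Cmod z) by (apply cos_acos; lra).
rewrite E, cos_PI in c. lra.
Qed.

Lemma Cexp_Log (z : C) : z <> 0 -> Cexp (Log z) = z.
Proof.
intros Hz.
assert (M : 0 < Cmod z) by now apply Cmod_gt_0.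
assert (Q : (Cmod z)² = (Re z)² + (Im z)²).
{ unfold Cmod, Re, Im. rewrite Rsqr_sqrt; [unfold Rsqr; ring|].
  pose proof (pow2_ge_0 (fst z)); pose proof (pow2_ge_0 (snd z)); lra. }
set (u := Re z / Cmod z).
assert (Hu : Re z = u * Cmod z) by (unfold u; field; lra).
assert (K : -1 <= u <= 1).
{ unfold Rsqr in Q. split; apply (Rmult_le_reg_r (Cmod z)); try exact M; rewrite <- Hu; nra. }
assert (Hs : Cmod z * sqrt (1 - u²) = Rabs (Im z)).
{ rewrite <- (sqrt_Rsqr (Cmod z)) at 1; [|lra].
  rewrite <- sqrt_mult_alt; [|apply Rle_0_sqr].
  rewrite <- sqrt_Rsqr_abs. f_equal. rewrite Hu in Q. unfold Rsqr in *. lra. }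
unfold Cexp, Log; simpl. rewrite exp_ln by exact M.
unfold Arg; fold u.
apply injective_projections; simpl.
- destruct (Rle_dec 0 (Im z)); rewrite ?cos_neg, cos_acos by exact K;
  change (fst z) with (Re z); lra.
- destruct (Rle_dec 0 (Im z)) as [H|H]; rewrite ?sin_neg, sin_acos by exact K;
  change (snd z) with (Im z).
  + rewrite Hs; now apply Rabs_pos_eq.
  + rewrite Ropp_mult_distr_r_reverse, Hs, Rabs_left; lra.
Qed.

(** * Bernoulli numbers: [B_0 = 1] and
      [sum_(i <= m) binom(m+1, i) B_i = 0] for [m >= 1] *)

(** [bernoulli_upto m i] is [B_i] for [i <= m]. *)
Fixpoint bernoulli_upto (m : nat) : nat -> R :=
  match m with
  | O => fun _ => 1
  | S p => fun i =>
      if (i <=? p)%nat then bernoulli_upto p i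
      else - / INR (p + 2) *
           sum_f_R0 (fun l => Binomial.C (p + 2) l * bernoulli_upto p l) p
  end.

Definition bernoulli (m : nat) : R := bernoulli_upto m m.

Example bernoulli_2 : bernoulli 2 = 1 / 6.
Proof. unfold bernoulli; simpl; unfold Binomial.C; simpl; field. Qed.

Example bernoulli_4 : bernoulli 4 = - 1 / 30.
Proof. unfold bernoulli; simpl; unfold Binomial.C; simpl; field. Qed.

(** * Analytic functions and the class K_a *)

Definition analytic_at (f : C -> C) (z0 : C) : Prop :=
  exists c : nat -> C,
    locally z0 (fun z : C =>
      is_pseries (K := C_AbsRing) (V := C_NormedModule) c (z - z0)%C (f z)).

(** [kc] is a total function; outside its domain of analyticity its values are
    junk. *)
Definition complex_extension (a : Rbar) (k : R -> C) (kc : C -> C) : Prop :=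
  forall t : R, 0 <= t -> Rbar_lt t a ->
    analytic_at kc (RtoC t) /\ kc (RtoC t) = k t.

Definition left_end (a : Rbar) : (R -> Prop) -> Prop :=
  match a with
  | Finite b => at_left b
  | _ => Rbar_locally a
  end.

Definition class_K (a : Rbar) (k : R -> C) : Prop :=
  k 0 <> 0 /\
  (exists kc : C -> C, complex_extension a k kc) /\
  (exists d : Rbar, Rbar_lt d 1 /\ (a <> p_infty -> d = m_infty) /\
    forall lambda : C, Rbar_lt d (Re lambda) -> Re lambda < 1 ->
      ex_RInt_gen (V := C_R_NormedModule)
        (fun t => k t * Rcpow t (- lambda))%C (at_right 0) (left_end a)).

(** [z0], on the circle of radius [r], is a singularity of the function that
    is analytic in [|z| < r] and equal to [f] there: no function analytic at
    [z0] continues it across [z0]. *)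
Definition singular_point (f : C -> C) (r : R) (z0 : C) : Prop :=
  ~ exists g : C -> C, analytic_at g z0 /\
      locally z0 (fun z : C => Cmod z < r -> g z = f z).

Definition nearest_singularity_distance (f : C -> C) (rho : Rbar) : Prop :=
  match rho with
  | Finite r =>
      0 < r /\ (forall z : C, Cmod z < r -> analytic_at f z) /\
      exists z0 : C, Cmod z0 = r /\ singular_point f r z0
  | p_infty => forall z : C, analytic_at f z
  | m_infty => False
  end.

(** * Finite-part integral *)

Definition monomial (mu : C) (q : nat) (eps : R) : C :=
  (Rcpow eps mu * RtoC (ln eps ^ q))%C.

Definition has_no_limit (mu : C) (q : nat) : Prop :=
  ~ exists l : C, filterlim (monomial mu q) (at_right 0) (locally l).

Fixpoint eval_terms (D : list (C * C * nat)) (eps : R) : C :=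
  match D with
  | nil => 0
  | (c, mu, q) :: D' => (c * monomial mu q eps + eval_terms D' eps)%C
  end.

Definition is_fp_finite (b : R) (f : R -> C) (v : C) : Prop :=
  exists (Cv : R -> C) (D : list (C * C * nat)),
    List.Forall (fun '(_, mu, q) => has_no_limit mu q) D /\
    at_right 0 (fun eps =>
      is_RInt_gen (V := C_R_NormedModule) f (at_point eps) (at_left b)
        (Cv eps + eval_terms D eps)%C) /\
    filterlim Cv (at_right 0) (locally v).

Definition is_fp (a : Rbar) (f : R -> C) (v : C) : Prop :=
  match a with
  | Finite b => is_fp_finite b f v
  | p_infty =>
      exists g : R -> C,
        (forall b : R, 0 < b -> is_fp_finite b f (g b)) /\
        filterlim g (Rbar_locally p_infty) (locally v)
  | m_infty => False
  end.

Definition ex_fp (a : Rbar) (f : R -> C) : Prop := exists v : C, is_fp a f v.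

Definition fp (a : Rbar) (f : R -> C) : C :=
  iota (T := C_CompleteNormedModule) (is_fp a f).

(** ** Well-definedness of the finite part *)

Lemma filterlim_C_lin {T} {F : (T -> Prop) -> Prop} {FF : Filter F}
  (f g : T -> C) (w x y : C) :
  filterlim f F (locally x) -> filterlim g F (locally y) ->
  filterlim (fun t => f t + w * g t)%C F (locally (x + w * y)%C).
Proof.
intros Hf Hg.
apply (filterlim_comp_2 (G := locally x) (H := locally (w * y)%C)
  f (fun t => w * g t)%C Cplus Hf); [|exact (filterlim_plus (V := C_NormedModule) _ _)].
apply (filterlim_comp _ _ _ g (fun z => w * z)%C _ _ _ Hg).
exact (filterlim_scal_r (V := C_NormedModule) w y).
Qed.

(** [diff_poly d P]: all [d]-fold finite differences of [P] vanish. *)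
Fixpoint diff_poly (d : nat) (P : R -> C) : Prop :=
  match d with
  | O => forall t, P t = 0
  | S d' => forall s, diff_poly d' (fun t => P (t + s)%R - P t)%C
  end.

Lemma diff_poly_ext d : forall P Q,
  (forall t, P t = Q t) -> diff_poly d P -> diff_poly d Q.
Proof.
intros P Q H. now replace Q with P by now apply functional_extensionality.
Qed.

Lemma diff_poly_lin d : forall P Q w,
  diff_poly d P -> diff_poly d Q -> diff_poly d (fun t => P t + w * Q t)%C.
Proof.
induction d as [|d IH]; simpl; intros P Q w HP HQ.
- intros t; rewrite HP, HQ; ring.
- intros s. eapply diff_poly_ext; [|exact (IH _ _ w (HP s) (HQ s))].
  intros t; simpl; ring.
Qed.

Lemma diff_poly_zero d : diff_poly d (fun _ => 0).
Proof.
induction d as [|d IH]; simpl; intros; [reflexivity|].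
eapply diff_poly_ext; [|exact IH]. intros t; simpl; ring.
Qed.

Lemma diff_poly_scal d P w : diff_poly d P -> diff_poly d (fun t => w * P t)%C.
Proof.
intros H. eapply diff_poly_ext; [|exact (diff_poly_lin d _ _ w (diff_poly_zero d) H)].
intros t; simpl; ring.
Qed.

Lemma diff_poly_S d : forall P, diff_poly d P -> diff_poly (S d) P.
Proof.
induction d as [|d IH]; intros P H.
- simpl in *. intros s t; rewrite !H; ring.
- intros s. apply IH, H.
Qed.

Lemma diff_poly_le d e P : (d <= e)%nat -> diff_poly d P -> diff_poly e P.
Proof. induction 1; auto using diff_poly_S. Qed.

Lemma diff_poly_shift d : forall P s, diff_poly d P -> diff_poly d (fun t => P (t + s)%R).
Proof.
induction d as [|d IH]; simpl; intros P s H; [intros; apply H|].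
intros u. eapply diff_poly_ext; [|exact (IH _ s (H u))].
intros t; simpl. now replace (t + u + s) with (t + s + u) by ring.
Qed.

Lemma diff_poly_mul d : forall P, diff_poly d P -> diff_poly (S d) (fun t => RtoC t * P t)%C.
Proof.
induction d as [|d IH]; intros P H s.
- intros t. simpl in H. rewrite !H; ring.
- eapply diff_poly_ext;
    [|exact (diff_poly_lin _ _ _ s (IH _ (H s)) (diff_poly_shift _ _ s H))].
  intros t; simpl. rewrite RtoC_plus; ring.
Qed.

Lemma diff_poly_pow q : diff_poly (S q) (fun t => RtoC (t ^ q)).
Proof.
induction q as [|q IH].
- intros s t; simpl; ring.
- eapply diff_poly_ext; [|exact (diff_poly_mul _ _ IH)].
  intros t; simpl; now rewrite RtoC_mult.
Qed.

Lemma filterlim_shift {U} (F : R -> U) (G : (U -> Prop) -> Prop) s :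
  filterlim F (Rbar_locally p_infty) G ->
  filterlim (fun t => F (t + s)%R) (Rbar_locally p_infty) G.
Proof.
intros H P HP. destruct (H P HP) as [M HM].
exists (M - s). intros x Hx. apply HM. lra.
Qed.

Lemma diff_poly_lim d : forall P (l : C),
  diff_poly d P -> filterlim P (Rbar_locally p_infty) (locally l) ->
  forall t, P t = l.
Proof.
assert (uniq : forall (P : R -> C) (x y : C), filterlim P (Rbar_locally p_infty) (locally x) ->
  filterlim P (Rbar_locally p_infty) (locally y) -> x = y).
{ intros P x y. exact (filterlim_locally_unique (V := C_NormedModule) P x y). }
assert (cst : forall (P : R -> C), (forall t s, P (t + s)%R = P t) ->
  forall l : C, filterlim P (Rbar_locally p_infty) (locally l) -> forall t, P t = l).
{ intros P HP l Hl t. apply (uniq P); [|exact Hl].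
  replace P with (fun _ : R => P t); [apply filterlim_const|].
  apply functional_extensionality; intros u.
  rewrite <- (HP t (u - t)). f_equal; ring. }
induction d as [|d IH]; intros P l HP Hl.
- apply cst; [|exact Hl]. intros; now rewrite !HP.
- apply cst; [|exact Hl]. intros t s.
  assert (E := IH _ (l + (-1) * l)%C (HP s)).
  assert (E' : forall t, (P (t + s)%R - P t)%C = (l + (-1) * l)%C).
  { apply E. eapply filterlim_ext;
      [|exact (filterlim_C_lin _ _ (-1) _ _ (filterlim_shift P _ s Hl) Hl)].
    intros u; simpl; ring. }
  specialize (E' t).
  replace (P (t + s)%R) with (P t + (P (t + s)%R - P t))%C by ring.
  rewrite E'; ring.
Qed.

(** [F] is [P0] plus a sum of [Q(t) e^(nu t)] with [(nu, d)] in [l] and [Q] a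
    polynomial function with vanishing [d]-fold differences. *)
Fixpoint exp_poly (l : list (C * nat)) (F P0 : R -> C) : Prop :=
  match l with
  | nil => forall t, F t = P0 t
  | (nu, d) :: l' => exists Q, diff_poly d Q /\
      exp_poly l' (fun t => F t - Cexp (nu * RtoC t) * Q t)%C P0
  end.

Lemma exp_poly_ext l F G P0 P1 : (forall t, F t = G t) -> (forall t, P0 t = P1 t) ->
  exp_poly l F P0 -> exp_poly l G P1.
Proof.
intros H H'. replace G with F by now apply functional_extensionality.
now replace P1 with P0 by now apply functional_extensionality.
Qed.

Lemma exp_poly_diff s w l : forall F P0, exp_poly l F P0 ->
  exp_poly l (fun t => F (t + s)%R - w * F t)%C (fun t => P0 (t + s)%R - w * P0 t)%C.
Proof.
induction l as [|[nu d] l IH]; simpl; intros F P0.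
- intros H t. now rewrite !H.
- intros [Q [HQ H]].
  exists (fun t => Cexp (nu * RtoC s) * Q (t + s)%R + (- w) * Q t)%C. split.
  + apply diff_poly_lin; [|exact HQ].
    apply diff_poly_scal. now apply diff_poly_shift.
  + eapply exp_poly_ext; [| |exact (IH _ _ H)]; intros t; simpl; [|reflexivity].
    rewrite RtoC_plus, Cmult_plus_distr_l, Cexp_plus. ring.
Qed.

Lemma Cexp_neq_1 (nu : C) : nu <> 0 -> exists s, Cexp (nu * RtoC s) <> 1.
Proof.
intros Hnu. destruct nu as [x y].
destruct (Req_dec y 0) as [Hy|Hy].
- assert (Hx : x <> 0) by (intros ->; subst; now apply Hnu).
  exists (/ x). intros E. apply (f_equal fst) in E. unfold Cexp, Re, Im in E; simpl in E.
  replace (x * / x - y * 0) with 1 in E by (field; auto).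
  replace (x * 0 + y * / x) with 0 in E by (subst; ring).
  rewrite cos_0 in E. pose proof (exp_ineq1 1). lra.
- exists (PI / y). intros E. apply (f_equal fst) in E. unfold Cexp, Re, Im in E; simpl in E.
  replace (x * 0 + y * (PI / y)) with PI in E by (field; auto).
  rewrite cos_PI in E. pose proof (exp_pos (x * (PI / y) - y * 0)). lra.
Qed.

Lemma poly_fixed d : forall (P : R -> C) (s : R) (w : C), w <> 1 -> diff_poly d P ->
  (forall t, P (t + s)%R = w * P t)%C -> forall t, P t = 0.
Proof.
induction d as [|d IH]; intros P s w Hw HP E t; [apply HP|].
assert (Hw' : (w - 1)%C <> 0).
{ intros H. apply Hw. replace w with (w - 1 + 1)%C by ring. rewrite H; ring. }
assert (H : forall t, (P (t + s)%R - P t)%C = 0).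
{ apply (IH _ s w Hw (HP s)). intros u. rewrite !E; ring. }
specialize (H t). rewrite E in H.
replace (P t) with (/ (w - 1) * (w * P t - P t))%C by (field; exact Hw').
rewrite H; ring.
Qed.

Lemma exp_poly_lim l : List.Forall (fun '(nu, _) => nu <> RtoC 0) l ->
  forall d F P0 (L : C), diff_poly d P0 -> exp_poly l F P0 ->
  filterlim F (Rbar_locally p_infty) (locally L) -> forall t, P0 t = L.
Proof.
induction l as [|[nu e] l IHl]; intros Hl d F P0 L HP0 HF HL.
- apply (diff_poly_lim d); [exact HP0|].
  now replace P0 with F by now apply functional_extensionality.
- inversion Hl as [|? ? Hnu Hl']; subst. specialize (IHl Hl'). clear Hl Hl'.
  revert d F P0 L HP0 HF HL. induction e as [|e IHe]; intros d F P0 L HP0 [Q [HQ HF]] HL.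
  + apply (IHl d F P0 L HP0); [|exact HL].
    eapply exp_poly_ext; [| |exact HF]; [|reflexivity].
    intros t; simpl in *; rewrite HQ; ring.
  + destruct (Cexp_neq_1 nu Hnu) as [s Hs]. set (w := Cexp (nu * RtoC s)) in *.
    assert (E : forall t, (P0 (t + s)%R - w * P0 t)%C = (L + (- w) * L)%C).
    { apply (IHe d (fun t => F (t + s)%R - w * F t)%C).
      - eapply diff_poly_ext;
          [|exact (diff_poly_lin _ _ _ (- w)%C (diff_poly_shift _ _ s HP0) HP0)].
        intros t; simpl; ring.
      - exists (fun t => w * (Q (t + s)%R - Q t))%C. split.
        + apply diff_poly_scal, HQ.
        + eapply exp_poly_ext; [| |exact (exp_poly_diff s w _ _ _ HF)];
            intros t; simpl; [|reflexivity].
          rewrite RtoC_plus, Cmult_plus_distr_l, Cexp_plus. fold w. ring.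
      - eapply filterlim_ext;
          [|exact (filterlim_C_lin _ _ (- w)%C _ _ (filterlim_shift F _ s HL) HL)].
        intros t; simpl; ring. }
    intros t.
    assert (H : (P0 t + (-1) * L)%C = 0).
    { apply (poly_fixed (S d) (fun t => P0 t + (-1) * L)%C s w Hs).
      - apply diff_poly_lin; [now apply diff_poly_S|].
        apply (diff_poly_le 1); [lia|]. intros u v; simpl; ring.
      - intros u. specialize (E u).
        replace (P0 (u + s)%R) with (P0 (u + s)%R - w * P0 u + w * P0 u)%C by ring.
        rewrite E; ring. }
    replace (P0 t) with (P0 t + (-1) * L + L)%C by ring. rewrite H; ring.
Qed.

Lemma monomial_exp mu q t :
  monomial mu q (exp (- t)) = (Cexp (- mu * RtoC t) * (RtoC ((-1) ^ q) * RtoC (t ^ q)))%C.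
Proof.
unfold monomial, Rcpow. rewrite ln_exp.
rewrite <- RtoC_mult, <- Rpow_mult_distr.
f_equal; [f_equal; rewrite RtoC_opp; ring|].
do 2 f_equal; ring.
Qed.

Lemma eval_terms_exp_poly D : List.Forall (fun '(_, mu, q) => has_no_limit mu q) D ->
  exists l d P0, List.Forall (fun '(nu, _) => nu <> RtoC 0) l /\ diff_poly d P0 /\
    P0 0 = 0 /\ exp_poly l (fun t => eval_terms D (exp (- t))) P0.
Proof.
induction D as [|[[c mu] q] D IH]; intros H.
- exists nil, O, (fun _ => 0). repeat split; simpl; auto.
- inversion H as [|? ? H1 H2]; subst.
  destruct (IH H2) as (l & d & P0 & Hl & HP & HP0 & HE). clear IH.
  assert (Hq : diff_poly (S q) (fun t => c * (RtoC ((-1) ^ q) * RtoC (t ^ q)))%C).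
  { apply diff_poly_scal, diff_poly_scal, diff_poly_pow. }
  destruct (Ceq_dec mu 0) as [Hmu|Hmu].
  + subst mu.
    assert (q0 : q <> O).
    { intros ->. apply H1. exists 1.
      eapply filterlim_ext; [|apply filterlim_const].
      intros eps; unfold monomial, Rcpow; simpl.
      rewrite Cmult_0_l, Cexp_0; ring. }
    exists l, (max d (S q)), (fun t => P0 t + 1 * (c * (RtoC ((-1) ^ q) * RtoC (t ^ q))))%C.
    split; [exact Hl|]. split; [|split].
    * apply diff_poly_lin; [apply (diff_poly_le d); [lia|exact HP]|].
      apply (diff_poly_le (S q)); [lia|exact Hq].
    * rewrite HP0, pow_i by lia. ring.
    * assert (G : forall l F P0 G, exp_poly l F P0 ->
        exp_poly l (fun t => F t + G t)%C (fun t => P0 t + G t)%C).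
      { clear. induction l as [|[nu d] l IH]; simpl; intros F P0 G.
        - intros E t; now rewrite E.
        - intros [Q [HQ E]]. exists Q; split; [exact HQ|].
          eapply exp_poly_ext; [| |exact (IH _ _ G E)]; intros t; simpl; [ring|reflexivity]. }
      eapply exp_poly_ext; [| |exact (G _ _ _
        (fun t => 1 * (c * (RtoC ((-1) ^ q) * RtoC (t ^ q))))%C HE)];
        intros t; cbn [eval_terms]; [|reflexivity].
      rewrite monomial_exp.
      replace (- 0 * RtoC t)%C with (RtoC 0) by ring. rewrite Cexp_0. ring.
  + exists ((- mu, S q) :: l)%C, d, P0.
    split; [|split; [exact HP|split; [exact HP0|]]].
    * constructor; [|exact Hl]. intros E. apply Hmu.
      replace mu with (- (- mu))%C by ring. rewrite E; ring.
    * exists (fun t => c * (RtoC ((-1) ^ q) * RtoC (t ^ q)))%C. split; [exact Hq|].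
      eapply exp_poly_ext; [| |exact HE]; intros t; cbn [eval_terms]; [|reflexivity].
      rewrite monomial_exp. ring.
Qed.

Lemma eval_terms_app D D' eps :
  eval_terms (D ++ D') eps = (eval_terms D eps + eval_terms D' eps)%C.
Proof.
induction D as [|[[c mu] q] D IH]; simpl; [ring|rewrite IH; ring].
Qed.

Lemma eval_terms_lim D (L : C) : List.Forall (fun '(_, mu, q) => has_no_limit mu q) D ->
  filterlim (eval_terms D) (at_right 0) (locally L) -> L = 0.
Proof.
intros H HL. destruct (eval_terms_exp_poly D H) as (l & d & P0 & Hl & HP & HP0 & HE).
rewrite <- HP0. symmetry. apply (exp_poly_lim l Hl d _ P0 L HP HE).
apply (filterlim_comp _ _ _ (fun t => exp (- t)) (eval_terms D) _ (at_right 0)); [|exact HL].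
intros P [e He]. exists (- ln e). intros x Hx. apply He; [|apply exp_pos].
pose proof (exp_pos (- x)).
assert (exp (- x) < e).
{ rewrite <- (exp_ln e (cond_pos e)). apply exp_increasing. lra. }
unfold ball; simpl; unfold AbsRing_ball, abs, minus, plus, opp; simpl.
rewrite Ropp_0, Rplus_0_r, Rabs_pos_eq; lra.
Qed.

Definition opp_term : C * C * nat -> C * C * nat :=
  fun '(c, mu, q) => ((- c)%C, mu, q).

Lemma is_RInt_gen_C_unique (f : R -> C) Fa Fb (x y : C) :
  ProperFilter' Fa -> ProperFilter' Fb ->
  is_RInt_gen (V := C_R_NormedModule) f Fa Fb x ->
  is_RInt_gen (V := C_R_NormedModule) f Fa Fb y -> x = y.
Proof.
intros FFa FFb Hx Hy.
apply (is_RInt_gen_unique (V := C_R_CompleteNormedModule)) in Hx.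
apply (is_RInt_gen_unique (V := C_R_CompleteNormedModule)) in Hy.
congruence.
Qed.

Lemma is_fp_finite_unique b f v v' :
  is_fp_finite b f v -> is_fp_finite b f v' -> v = v'.
Proof.
intros (C1 & D1 & HD1 & H1 & L1) (C2 & D2 & HD2 & H2 & L2).
assert (E : (v + (-1) * v')%C = 0).
{ apply (eval_terms_lim (D2 ++ map opp_term D1)).
  - apply Forall_app; split; [exact HD2|].
    apply Forall_map. eapply Forall_impl; [|exact HD1]. now intros [[c mu] q].
  - eapply filterlim_ext_loc; [|exact (filterlim_C_lin _ _ (-1) _ _ L1 L2)].
    eapply filter_imp; [|exact (filter_and _ _ H1 H2)].
    intros eps [I1 I2].
    assert (E := is_RInt_gen_C_unique _ _ _ _ _ _ _ I1 I2).
    rewrite eval_terms_app.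
    assert (O : eval_terms (map opp_term D1) eps = (- eval_terms D1 eps)%C).
    { clear. induction D1 as [|[[c mu] q] D IH]; simpl; [ring|rewrite IH; ring]. }
    rewrite O.
    replace (C1 eps) with (C1 eps + eval_terms D1 eps - eval_terms D1 eps)%C by ring.
    rewrite E. ring. }
replace v with (v + (-1) * v' + v')%C by ring. rewrite E; ring.
Qed.

Lemma is_fp_unique a f v v' : is_fp a f v -> is_fp a f v' -> v = v'.
Proof.
destruct a as [b| |]; [apply is_fp_finite_unique| |now intros []].
intros (g & Hg & Lg) (h & Hh & Lh).
apply (filterlim_locally_unique (V := C_NormedModule) (F := Rbar_locally p_infty) g); [exact Lg|].
eapply filterlim_ext_loc; [|exact Lh].
exists 0. intros b Hb. symmetry. now apply (is_fp_finite_unique b f); [apply Hg|apply Hh].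
Qed.

Lemma fp_eq a f v : is_fp a f v -> fp a f = v.
Proof.
intros H. apply (iota_unique (V := C_CompleteNormedModule) (is_fp a f) v); [|exact H].
intros y Hy. exact (is_fp_unique _ _ _ _ Hy H).
Qed.

(** * The Stieltjes integral and its singular contribution *)

Definition stieltjes_integrand (k : R -> C) (n : nat) (w : C) (t : R) : C :=
  (k t * RtoC (ln t ^ n) / (w + RtoC t))%C.

Definition is_stieltjes (a : Rbar) (k : R -> C) (n : nat) (w v : C) : Prop :=
  is_RInt_gen (V := C_R_NormedModule)
    (stieltjes_integrand k n w) (at_right 0) (left_end a) v.

Definition ex_stieltjes (a : Rbar) (k : R -> C) (n : nat) (w : C) : Prop :=
  exists v : C, is_stieltjes a k n w v.

Definition stieltjes (a : Rbar) (k : R -> C) (n : nat) (w : C) : C :=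
  RInt_gen (V := C_R_CompleteNormedModule)
    (stieltjes_integrand k n w) (at_right 0) (left_end a).

Definition moment_integrand (k : R -> C) (n j : nat) (t : R) : C :=
  (k t * RtoC (ln t ^ n) / RtoC (t ^ (j + 1)))%C.

(** [(n + 1) / 2] is the ceiling of [n/2]. The exponent is written
    [n + 1 - 2 * j] because [n - 2 * j] would truncate at [j = (n + 1) / 2],
    [n] odd. *)
Definition Delta_log (n : nat) (w : C) : C :=
  (- (Log w ^ (n + 1) / RtoC (INR (n + 1)))
   + RtoC (2 * INR (fact n)) *
     sum_n_m (G := C_AbelianMonoid) (fun j =>
       RtoC ((2 ^ (2 * j - 1) - 1) * (-1) ^ j * PI ^ (2 * j) * bernoulli (2 * j)
             / (INR (fact (n + 1 - 2 * j)) * INR (fact (2 * j))))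
       * Log w ^ (n + 1 - 2 * j))
     1 ((n + 1) / 2)%nat)%C.

Definition slit_plane (w : C) : Prop := w <> 0 /\ Rabs (Arg w) < PI.

(* Main.v *)
Require Import Defs.
From Stdlib Require Import Reals Lra Lia List Arith Classical IndefiniteDescription FunctionalExtensionality.
From Coquelicot Require Import Coquelicot.
Open Scope R_scope.

(** Fix [w] off the cut with [|w| < r], where [r] is smaller than both [rho0]
    and [a], and split all the integrals at [r].

    Beyond [r] the kernel is expanded by the finite geometric sum
    [1/(w+t) = sum_(j<N) (-w)^j/t^(j+1) + (-w/t)^N/(w+t)].  The integrals
    converge only conditionally at the end point [a], so the remainder is
    estimated by Abel's test [tail_abel]: the Mellin integrand [k(t) t^(-lambda)]
    is integrated first, and the bound is linear in the size of the other
    factor.  It gives a remainder of order [N (|w|/r)^N].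

    On [(0, r]] the function [k] is the sum of its Taylor series.  Local
    analyticity in the disc gives one series on the whole disc ([taylor_disc])
    by Cauchy's formula, which is proved by contracting the circle to a point.
    In the [j]-th moment the Taylor polynomial of degree [j] is separated from
    [k].  The polynomial contributes the finite parts [fp_log] of powers of
    the logarithm; the rest, divided by [t^(j+1)], is bounded, and its integral
    converges.  Summed over [j] with weights [(-w)^j], the convergent parts
    telescope to the integral of [(k(t) - k(-w)) ln^n t / (w+t)]
    ([taylor_quot_telescope]), and the finite parts form a Cauchy product
    whose sum is [k(-w)] times the series [fp_log_series].

    What is left is therefore [k(-w)] times the same question for the constant
    function [1]: the difference [J_n(w)] between the integral of
    [ln^n t/(w+t)] over [(0, r]] and its finite-part series is [Delta_n(w)]
    ([log_identity]).  An integration by parts gives [w J_n' = n J_(n-1)], and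
    [w J_0' = -1].  So [J_n] is a polynomial in [Log w], known up to one
    constant at each stage.  The substitution [t -> t^2] gives
    [J_n(i) + J_n(-i) = 2^(-n) J_n(1)]; as [Delta_n] satisfies the same
    differential equation and the same duplication formula, the difference of
    the two is a constant [c] with [2 c = 2^(-n) c], hence zero.  The formula
    for [Delta_n] comes from the duplication formula for the Appell
    polynomials with coefficients [(2 - 2^i) B_i] ([delta_coef_dup]).

    As [w -> 0] the series, a power series in [w], stays bounded, [k(-w)]
    tends to [k(0)], and [Delta_n(w)] tends to infinity because its leading term
    is a multiple of [Log^(n+1) w].  This gives the asymptotic equivalence. *)

(** * Elementary estimates *)

Lemma Rlt_min x a b : x < Rmin a b -> x < a /\ x < b.
Proof. pose proof (Rmin_l a b). pose proof (Rmin_r a b). lra. Qed.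

Lemma Rlt_div_inv x e k : 0 < k -> x < e / k -> x * k < e.
Proof. intros Hk H. now apply Rlt_div_r. Qed.

Lemma Rle_div_inv x e k : 0 < k -> x <= e / k -> x * k <= e.
Proof. intros Hk H. now apply Rle_div_r. Qed.

Lemma ratio_lt_1 x r : x < r -> 0 < r -> x / r < 1.
Proof. intros H Hr. apply Rlt_div_l; lra. Qed.

Lemma ball_R (x e y : R) : ball x e y -> Rabs (y - x) < e.
Proof. intros H. exact H. Qed.

Lemma at_right_intro (P : R -> Prop) d : 0 < d -> (forall e, 0 < e < d -> P e) -> at_right 0 P.
Proof.
intros Hd H. exists (mkposreal d Hd). intros e He He0. apply ball_R, Rabs_def2 in He.
apply H. simpl in He. lra.
Qed.

Lemma at_right_elim (P : R -> Prop) : at_right 0 P -> exists d, 0 < d /\ forall e, 0 < e < d -> P e.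
Proof.
intros [d Hd]. exists d. split; [apply cond_pos|]. intros e He. apply Hd; [|lra].
change (Rabs (e - 0) < d). rewrite Rabs_pos_eq; lra.
Qed.

(** * Derivatives and continuity of complex functions of a real variable *)

Definition Cder (f : R -> C) (t : R) (l : C) : Prop :=
  is_derive (K := R_AbsRing) (V := C_R_NormedModule) f t l.
Definition CInt (f : R -> C) (a b : R) (v : C) : Prop :=
  is_RInt (V := C_R_NormedModule) f a b v.
Definition Ccont (f : R -> C) (t : R) : Prop :=
  continuous (T := R_UniformSpace) (U := C_UniformSpace) f t.

Lemma norm_C_R (z : C) : @norm R_AbsRing C_R_NormedModule z = Cmod z.
Proof.
unfold norm; simpl; unfold prod_norm, Cmod; unfold norm; simpl.
f_equal. unfold abs; simpl. rewrite !Rmult_1_r.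
rewrite <- !Rabs_mult, !Rabs_pos_eq; nra.
Qed.

Lemma Clim_iff {T} (F : (T -> Prop) -> Prop) {FF : Filter F} (f : T -> C) (l : C) :
  filterlim f F (locally l) <-> forall eps, 0 < eps -> F (fun x => Cmod (f x - l) < eps).
Proof.
rewrite (filterlim_locally_ball_norm (K := C_AbsRing) (U := C_NormedModule) f l).
split; intros H.
- intros eps He. exact (H (mkposreal eps He)).
- intros eps. exact (H eps (cond_pos eps)).
Qed.

Lemma Cder_fst f t l : Cder f t l -> is_derive (fun t => fst (f t)) t (fst l).
Proof.
intros H.
exact (filterdiff_comp' f _ t _ _ H (filterdiff_linear _ is_linear_fst)).
Qed.

Lemma Cder_snd f t l : Cder f t l -> is_derive (fun t => snd (f t)) t (snd l).
Proof.
intros H.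
exact (filterdiff_comp' f _ t _ _ H (filterdiff_linear _ is_linear_snd)).
Qed.

Lemma Cder_intro f t l : is_derive (fun t => fst (f t)) t (fst l) ->
  is_derive (fun t => snd (f t)) t (snd l) -> Cder f t l.
Proof.
intros H1 H2.
pose (e1 := ((1, 0) : C_R_NormedModule)). pose (e2 := ((0, 1) : C_R_NormedModule)).
assert (E : forall z : C, z = @plus C_R_NormedModule (scal (fst z) e1) (scal (snd z) e2)).
{ intros z. unfold plus, scal; simpl. unfold prod_plus, prod_scal; simpl.
  unfold scal, plus; simpl; unfold mult; simpl.
  apply injective_projections; simpl; ring. }
apply (is_derive_ext (V := C_R_NormedModule) (fun t => @plus C_R_NormedModule
  (scal (fst (f t)) e1) (scal (snd (f t)) e2))).
{ intros u. symmetry. apply E. }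
rewrite (E l).
apply (is_derive_plus (V := C_R_NormedModule)).
- exact (is_derive_scal_l (V := C_R_NormedModule) _ t _ e1 H1).
- exact (is_derive_scal_l (V := C_R_NormedModule) _ t _ e2 H2).
Qed.

Lemma Cder_eq f t l l' : Cder f t l -> l = l' -> Cder f t l'.
Proof. now intros H <-. Qed.

Lemma Cder_const (c : C) t : Cder (fun _ => c) t 0.
Proof. apply (is_derive_const (K := R_AbsRing) (V := C_R_NormedModule)). Qed.

Lemma Cder_RtoC (f : R -> R) t l : is_derive f t l -> Cder (fun t => RtoC (f t)) t (RtoC l).
Proof. intros H. apply Cder_intro; simpl; [exact H|]. auto_derive; auto. Qed.

Lemma Cder_id t : Cder (fun t => RtoC t) t 1.
Proof. apply Cder_RtoC. auto_derive; auto. Qed.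

Lemma Cder_plus f g t l m : Cder f t l -> Cder g t m -> Cder (fun t => f t + g t)%C t (l + m)%C.
Proof. apply (is_derive_plus (V := C_R_NormedModule)). Qed.

Lemma Cder_minus f g t l m : Cder f t l -> Cder g t m -> Cder (fun t => f t - g t)%C t (l - m)%C.
Proof. apply (is_derive_minus (V := C_R_NormedModule)). Qed.

Lemma Rder_mult (f g : R -> R) t l m : is_derive f t l -> is_derive g t m ->
  is_derive (fun t => f t * g t) t (l * g t + f t * m).
Proof.
intros H1 H2. apply (is_derive_mult f g t l m H1 H2).
intros; apply Rmult_comm.
Qed.

Lemma Cder_mult f g t l m : Cder f t l -> Cder g t m ->
  Cder (fun t => f t * g t)%C t (l * g t + f t * m)%C.
Proof.
intros Hf Hg. apply Cder_intro; simpl.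
- assert (H := is_derive_minus _ _ t _ _ (Rder_mult _ _ t _ _ (Cder_fst _ _ _ Hf) (Cder_fst _ _ _ Hg))
    (Rder_mult _ _ t _ _ (Cder_snd _ _ _ Hf) (Cder_snd _ _ _ Hg))).
  evar_last; [exact H|]. unfold minus, plus, opp; simpl. ring.
- assert (H := is_derive_plus _ _ t _ _ (Rder_mult _ _ t _ _ (Cder_fst _ _ _ Hf) (Cder_snd _ _ _ Hg))
    (Rder_mult _ _ t _ _ (Cder_snd _ _ _ Hf) (Cder_fst _ _ _ Hg))).
  evar_last; [exact H|]. unfold minus, plus, opp; simpl. ring.
Qed.

Lemma Cder_scal f t l (c : C) : Cder f t l -> Cder (fun t => c * f t)%C t (c * l)%C.
Proof.
intros H. eapply Cder_eq; [exact (Cder_mult _ _ _ _ _ (Cder_const c t) H)|]. cbv beta. ring.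
Qed.

Lemma Cder_eps f t (l : C) :
  (forall eps, 0 < eps -> exists d, 0 < d /\ forall t', Rabs (t' - t) < d ->
     Cmod (f t' - f t - RtoC (t' - t) * l) <= eps * Rabs (t' - t)) -> Cder f t l.
Proof.
intros H. split; [apply is_linear_scal_l|].
intros x Hx. apply (is_filter_lim_locally_unique (V := AbsRing_NormedModule R_AbsRing)) in Hx. subst x.
intros eps. destruct (H eps (cond_pos eps)) as (d & Hd & K).
exists (mkposreal d Hd). intros t' Ht'. rewrite norm_C_R.
refine (Rle_trans _ _ _ _ (K t' Ht')).
right. f_equal. apply injective_projections; simpl; unfold plus, opp, scal; simpl;
  unfold prod_plus, prod_opp, plus, opp, scal, mult; simpl; unfold mult, minus, plus, opp; simpl; ring.
Qed.

Lemma Cder_eps_inv f t (l : C) : Cder f t l ->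
  forall eps, 0 < eps -> exists d, 0 < d /\ forall t', Rabs (t' - t) < d ->
     Cmod (f t' - f t - RtoC (t' - t) * l) <= eps * Rabs (t' - t).
Proof.
intros [_ H] eps He. destruct (H t (fun P HP => HP) (mkposreal eps He)) as [d Hd].
exists d. split; [apply cond_pos|]. intros t' Ht'. specialize (Hd t' Ht').
rewrite norm_C_R in Hd.
refine (Rle_trans _ _ _ _ Hd).
right. f_equal. apply injective_projections; simpl; unfold plus, opp, scal; simpl;
  unfold prod_plus, prod_opp, plus, opp, scal, mult; simpl; unfold mult, minus, plus, opp; simpl; ring.
Qed.

Lemma Cder_cont f t l : Cder f t l -> Ccont f t.
Proof.
intros H. apply (ex_derive_continuous (K := R_AbsRing) (V := C_R_NormedModule)).
now exists l.
Qed.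

Lemma Cder_inv f t l : Cder f t l -> f t <> 0 -> Cder (fun t => / f t)%C t (- l / (f t * f t))%C.
Proof.
intros H H0.
assert (D : fst (f t) ^ 2 + snd (f t) ^ 2 <> 0).
{ intros E. apply H0. apply injective_projections; simpl; nra. }
assert (Q := is_derive_plus _ _ t _ _ (Rder_mult _ _ t _ _ (Cder_fst _ _ _ H) (Cder_fst _ _ _ H))
    (Rder_mult _ _ t _ _ (Cder_snd _ _ _ H) (Cder_snd _ _ _ H))).
assert (I := is_derive_inv _ t _ Q). cbv beta in I.
assert (D' : plus (fst (f t) * fst (f t)) (snd (f t) * snd (f t)) <> 0).
{ unfold plus; simpl. intros E; apply D; rewrite <- E; ring. }
specialize (I D').
assert (D2 : fst (f t) * fst (f t) + snd (f t) * snd (f t) <> 0) by exact D'.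
assert (N : (f t * f t)%C <> 0).
{ apply Cmult_neq_0; exact H0. }
apply Cder_intro.
- apply (is_derive_ext (fun t => fst (f t) * / plus (fst (f t) * fst (f t)) (snd (f t) * snd (f t)))).
  { intros u. simpl. unfold plus; simpl. unfold Rdiv. do 2 f_equal. ring. }
  evar_last; [exact (Rder_mult _ _ t _ _ (Cder_fst _ _ _ H) I)|].
  unfold plus, opp; simpl. revert D2. clear. destruct (f t) as [x y]; destruct l as [lx ly]; simpl.
  intros D2. field. split; [|nra]. intros E.
  destruct (Rmult_integral (x * x + y * y) (x * x + y * y)); auto.
  rewrite <- E. ring.
- apply (is_derive_ext (fun t => - snd (f t) * / plus (fst (f t) * fst (f t)) (snd (f t) * snd (f t)))).
  { intros u. simpl. unfold plus; simpl. unfold Rdiv. do 2 f_equal. ring. }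
  evar_last; [exact (Rder_mult _ _ t _ _ (is_derive_opp _ _ _ (Cder_snd _ _ _ H)) I)|].
  unfold plus, opp; simpl. revert D2. clear. destruct (f t) as [x y]; destruct l as [lx ly]; simpl.
  intros D2. field. split; [|nra]. intros E.
  destruct (Rmult_integral (x * x + y * y) (x * x + y * y)); auto.
  rewrite <- E. ring.
Qed.

Lemma Cder_div f g t l m : Cder f t l -> Cder g t m -> g t <> 0 ->
  Cder (fun t => f t / g t)%C t ((l * g t - f t * m) / (g t * g t))%C.
Proof.
intros Hf Hg H0. eapply Cder_eq; [exact (Cder_mult _ _ _ _ _ Hf (Cder_inv _ _ _ Hg H0))|].
cbv beta. field. auto.
Qed.

Lemma Cder_ext_loc (f g : R -> C) t l : locally t (fun u => f u = g u) -> Cder f t l -> Cder g t l.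
Proof. apply (is_derive_ext_loc (V := C_R_NormedModule)). Qed.

Lemma Cder_ext (f g : R -> C) t l : (forall u, f u = g u) -> Cder f t l -> Cder g t l.
Proof. apply (is_derive_ext (V := C_R_NormedModule)). Qed.

Lemma Cder_Cexp f t l : Cder f t l -> Cder (fun t => Cexp (f t)) t (Cexp (f t) * l)%C.
Proof.
intros H. assert (H1 := Cder_fst _ _ _ H). assert (H2 := Cder_snd _ _ _ H).
assert (E := is_derive_comp exp _ t _ _ (is_derive_exp _) H1).
assert (c := is_derive_comp cos _ t _ _ (is_derive_cos _) H2).
assert (s := is_derive_comp sin _ t _ _ (is_derive_sin _) H2).
apply Cder_intro; unfold Cexp, Re, Im; simpl.
- evar_last; [exact (Rder_mult _ _ t _ _ E c)|]. unfold scal; simpl; unfold mult; simpl. ring.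
- evar_last; [exact (Rder_mult _ _ t _ _ E s)|]. unfold scal; simpl; unfold mult; simpl. ring.
Qed.

Lemma Cder_zero_const (f : R -> C) a b : a <= b ->
  (forall t, a <= t <= b -> Cder f t 0) -> f b = f a.
Proof.
intros Hab H.
apply injective_projections.
- destruct (MVT_gen (fun t => fst (f t)) a b (fun _ => 0)) as (c & _ & E).
  + intros x Hx. rewrite Rmin_left, Rmax_right in Hx by lra. exact (Cder_fst _ _ _ (H x ltac:(lra))).
  + intros x Hx. rewrite Rmin_left, Rmax_right in Hx by lra.
    apply continuity_pt_filterlim, (ex_derive_continuous (fun t => fst (f t))).
    eexists; exact (Cder_fst _ _ _ (H x ltac:(lra))).
  + lra.
- destruct (MVT_gen (fun t => snd (f t)) a b (fun _ => 0)) as (c & _ & E).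
  + intros x Hx. rewrite Rmin_left, Rmax_right in Hx by lra. exact (Cder_snd _ _ _ (H x ltac:(lra))).
  + intros x Hx. rewrite Rmin_left, Rmax_right in Hx by lra.
    apply continuity_pt_filterlim, (ex_derive_continuous (fun t => snd (f t))).
    eexists; exact (Cder_snd _ _ _ (H x ltac:(lra))).
  + lra.
Qed.

(** * Integrals of complex functions of a real variable *)

Lemma CInt_derive (f df : R -> C) a b :
  (forall x, Rmin a b <= x <= Rmax a b -> Cder f x (df x)) ->
  (forall x, Rmin a b <= x <= Rmax a b -> Ccont df x) ->
  CInt df a b (f b - f a)%C.
Proof. apply (is_RInt_derive (V := C_R_CompleteNormedModule)). Qed.

Definition CRInt (f : R -> C) (a b : R) : C := RInt (V := C_R_CompleteNormedModule) f a b.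

Lemma ex_CInt f a b : (forall x, Rmin a b <= x <= Rmax a b -> Ccont f x) ->
  exists v : C, CInt f a b v.
Proof. apply (ex_RInt_continuous (V := C_R_CompleteNormedModule)). Qed.

Lemma CRInt_correct f a b : (forall x, Rmin a b <= x <= Rmax a b -> Ccont f x) ->
  CInt f a b (CRInt f a b).
Proof. intros H. apply (RInt_correct (V := C_R_CompleteNormedModule)). now apply ex_CInt. Qed.

Lemma CRInt_unique f a b v : CInt f a b v -> CRInt f a b = v.
Proof. apply (is_RInt_unique (V := C_R_CompleteNormedModule)). Qed.

Lemma CInt_unique f a b (v v' : C) : CInt f a b v -> CInt f a b v' -> v = v'.
Proof.
intros H H'. apply (is_RInt_unique (V := C_R_CompleteNormedModule)) in H.
apply (is_RInt_unique (V := C_R_CompleteNormedModule)) in H'. congruence.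
Qed.

Lemma CInt_pair f a b (v : C) : is_RInt (fun t => fst (f t)) a b (fst v) ->
  is_RInt (fun t => snd (f t)) a b (snd v) -> CInt f a b v.
Proof.
intros H1 H2. destruct v as [v1 v2].
exact (is_RInt_fct_extend_pair (U := R_NormedModule) (V := R_NormedModule) f a b v1 v2 H1 H2).
Qed.

Lemma CInt_scal f a b v (c : C) : CInt f a b v -> CInt (fun t => c * f t)%C a b (c * v)%C.
Proof.
intros H.
assert (H1 := is_RInt_fct_extend_fst (U := R_NormedModule) (V := R_NormedModule) f a b v H).
assert (H2 := is_RInt_fct_extend_snd (U := R_NormedModule) (V := R_NormedModule) f a b v H).
apply CInt_pair; simpl.
- exact (is_RInt_minus _ _ _ _ _ _ (is_RInt_scal _ _ _ (fst c) _ H1) (is_RInt_scal _ _ _ (snd c) _ H2)).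
- exact (is_RInt_plus _ _ _ _ _ _ (is_RInt_scal _ _ _ (fst c) _ H2) (is_RInt_scal _ _ _ (snd c) _ H1)).
Qed.

Lemma CInt_plus f g a b v u : CInt f a b v -> CInt g a b u -> CInt (fun t => f t + g t)%C a b (v + u)%C.
Proof. apply (is_RInt_plus (V := C_R_NormedModule)). Qed.

Lemma CInt_minus f g a b v u : CInt f a b v -> CInt g a b u -> CInt (fun t => f t - g t)%C a b (v - u)%C.
Proof. apply (is_RInt_minus (V := C_R_NormedModule)). Qed.

Lemma CInt_const c a b : CInt (fun _ => c) a b (RtoC (b - a) * c)%C.
Proof.
assert (I := is_RInt_const (V := C_R_NormedModule) a b c).
unfold CInt. replace (RtoC (b - a) * c)%C with (@scal _ C_R_NormedModule (b - a) c); [exact I|].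
unfold scal; simpl; unfold prod_scal, scal; simpl; unfold mult; simpl.
apply injective_projections; simpl; ring.
Qed.

Lemma CInt_ext f g a b v : (forall x, Rmin a b < x < Rmax a b -> f x = g x) ->
  CInt f a b v -> CInt g a b v.
Proof. apply (is_RInt_ext (V := C_R_NormedModule)). Qed.

Lemma CInt_swap f a b v : CInt f a b v -> CInt f b a (- v)%C.
Proof. apply (is_RInt_swap (V := C_R_NormedModule)). Qed.

Lemma CInt_Chasles f a b c v u : CInt f a b v -> CInt f b c u -> CInt f a c (v + u)%C.
Proof. apply (is_RInt_Chasles (V := C_R_NormedModule)). Qed.

Lemma CInt_bound f (g : R -> R) a b (v : C) l : a <= b ->
  (forall x, a <= x <= b -> Cmod (f x) <= g x) ->
  CInt f a b v -> is_RInt g a b l -> Cmod v <= l.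
Proof.
intros Hab H Hf Hg. rewrite <- norm_C_R.
apply (norm_RInt_le f g a b v l Hab); [|exact Hf|exact Hg].
intros x Hx. rewrite norm_C_R. auto.
Qed.

Lemma CInt_bound_const f B a b (v : C) : a <= b ->
  (forall x, a <= x <= b -> Cmod (f x) <= B) -> CInt f a b v -> Cmod v <= B * (b - a).
Proof.
intros Hab H Hf. rewrite Rmult_comm. apply (CInt_bound f (fun _ => B) a b); auto.
exact (is_RInt_const a b B).
Qed.

(** * Sequences and partial sums of complex numbers *)

Definition Cconv (u : nat -> C) (l : C) : Prop := is_lim_seq (fun N => Cmod (u N - l)) 0.

Lemma Cconv_bound (u : nat -> C) l (b : nat -> R) :
  (forall N, Cmod (u N - l) <= b N) -> is_lim_seq b 0 -> Cconv u l.
Proof.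
intros H Hb. apply (is_lim_seq_le_le (fun _ => 0) _ b); [|apply is_lim_seq_const|exact Hb].
intros N; split; [apply Cmod_ge_0|apply H].
Qed.

Lemma Cconv_ext u v l : (forall N, u N = v N) -> Cconv u l -> Cconv v l.
Proof.
intros H. unfold Cconv. apply is_lim_seq_ext. intros N; now rewrite H.
Qed.

Lemma Cconv_const c : Cconv (fun _ => c) c.
Proof.
unfold Cconv. apply (is_lim_seq_ext (fun _ => 0)); [|apply is_lim_seq_const].
intros _. replace (c - c)%C with (RtoC 0) by ring. now rewrite Cmod_0.
Qed.

Lemma Cconv_plus u v l m : Cconv u l -> Cconv v m -> Cconv (fun N => u N + v N)%C (l + m)%C.
Proof.
intros Hu Hv. apply (Cconv_bound _ _ (fun N => Cmod (u N - l) + Cmod (v N - m))).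
- intros N. replace (u N + v N - (l + m))%C with ((u N - l) + (v N - m))%C by ring.
  apply Cmod_triangle.
- replace (Finite 0) with (Rbar_plus 0 0) by (simpl; f_equal; ring).
  now apply is_lim_seq_plus'.
Qed.

Lemma Cconv_scal u l c : Cconv u l -> Cconv (fun N => c * u N)%C (c * l)%C.
Proof.
intros Hu. apply (Cconv_bound _ _ (fun N => Cmod c * Cmod (u N - l))).
- intros N. rewrite <- Cmod_mult. right; f_equal; ring.
- replace (Finite 0) with (Rbar_mult (Cmod c) 0) by (simpl; f_equal; ring).
  now apply is_lim_seq_scal_l.
Qed.

Lemma Cconv_minus u v l m : Cconv u l -> Cconv v m -> Cconv (fun N => u N - v N)%C (l - m)%C.
Proof.
intros Hu Hv. apply (Cconv_ext (fun N => u N + (-1) * v N)%C); [intros; ring|].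
replace (l - m)%C with (l + (-1) * m)%C by ring.
apply Cconv_plus; [exact Hu|]. now apply Cconv_scal.
Qed.

Lemma Cconv_le u l B : Cconv u l -> (forall N, Cmod (u N) <= B) -> Cmod l <= B.
Proof.
intros Hu H.
assert (E : Rbar_le (Cmod l) (B + 0)).
{ apply (is_lim_seq_le (fun _ => Cmod l) (fun N => B + Cmod (u N - l))).
  - intros N. replace l with (u N + - (u N - l))%C at 1 by ring.
    refine (Rle_trans _ _ _ (Cmod_triangle _ _) _). rewrite Cmod_opp. specialize (H N); lra.
  - apply is_lim_seq_const.
  - apply is_lim_seq_plus'; [apply is_lim_seq_const|exact Hu]. }
simpl in E. lra.
Qed.

Lemma Cmod_eq0_le z : Cmod z <= 0 -> z = 0.
Proof. intros H. apply Cmod_eq_0. pose proof (Cmod_ge_0 z); lra. Qed.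

Lemma Csub_0 (x y : C) : (x - y)%C = 0 -> x = y.
Proof. intros H. replace x with (x - y + y)%C by ring. rewrite H; ring. Qed.

Lemma Cconv_unique u l m : Cconv u l -> Cconv u m -> l = m.
Proof.
intros H1 H2. apply Csub_0, Cmod_eq0_le.
apply (Cconv_le (fun N => u N - u N)%C); [now apply Cconv_minus|].
intros N. replace (u N - u N)%C with (RtoC 0) by ring. rewrite Cmod_0; lra.
Qed.

Lemma Cconv_shift u l : Cconv (fun N => u (S N)) l -> Cconv u l.
Proof. intros H. now apply (is_lim_seq_incr_1 (fun N => Cmod (u N - l))). Qed.

Lemma Cconv_incr u l : Cconv u l -> Cconv (fun N => u (S N)) l.
Proof. intros H. now apply -> (is_lim_seq_incr_1 (fun N => Cmod (u N - l))). Qed.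

Fixpoint csum (a : nat -> C) (N : nat) : C :=
  match N with O => 0 | S p => (csum a p + a p)%C end.

Lemma csum_S a N : csum a (S N) = (csum a N + a N)%C.
Proof. reflexivity. Qed.

Lemma csum_ext a b N : (forall m, (m < N)%nat -> a m = b m) -> csum a N = csum b N.
Proof.
induction N as [|N IH]; intros H; simpl; [reflexivity|].
rewrite IH, H; auto with arith.
Qed.

Lemma csum_plus a b N : csum (fun m => a m + b m)%C N = (csum a N + csum b N)%C.
Proof. induction N as [|N IH]; simpl; [ring|rewrite IH; ring]. Qed.

Lemma csum_scal c a N : csum (fun m => c * a m)%C N = (c * csum a N)%C.
Proof. induction N as [|N IH]; simpl; [ring|rewrite IH; ring]. Qed.

Lemma csum_minus a b N : csum (fun m => a m - b m)%C N = (csum a N - csum b N)%C.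
Proof. induction N as [|N IH]; simpl; [ring|rewrite IH; ring]. Qed.

Lemma csum_first a N : csum a (S N) = (a O + csum (fun m => a (S m)) N)%C.
Proof. induction N as [|N IH]; [simpl; ring|]. simpl in *. rewrite IH. ring. Qed.

Lemma csum_geo_bound a K q : 0 <= q < 1 -> (forall m, Cmod (a m) <= K * q ^ m) ->
  forall N d, Cmod (csum a (N + d) - csum a N) <= K / (1 - q) * q ^ N.
Proof.
intros Hq H N d.
assert (K0 : 0 <= K).
{ specialize (H O). simpl in H. pose proof (Cmod_ge_0 (a O)); lra. }
assert (G : Cmod (csum a (N + d) - csum a N) <= K / (1 - q) * (q ^ N - q ^ (N + d))).
{ induction d as [|d IH].
  - rewrite Nat.add_0_r. replace (csum a N - csum a N)%C with (RtoC 0) by ring.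
    rewrite Cmod_0. right; ring.
  - rewrite Nat.add_succ_r. simpl csum.
    replace (csum a (N + d) + a (N + d)%nat - csum a N)%C
      with (csum a (N + d) - csum a N + a (N + d)%nat)%C by ring.
    refine (Rle_trans _ _ _ (Cmod_triangle _ _) _).
    specialize (H (N + d)%nat).
    replace (K / (1 - q) * (q ^ N - q ^ S (N + d)))
      with (K / (1 - q) * (q ^ N - q ^ (N + d)) + K * q ^ (N + d)).
    + lra.
    + simpl. field. lra. }
refine (Rle_trans _ _ _ G _). apply Rmult_le_compat_l.
- apply Rmult_le_pos; [exact K0|]. left; apply Rinv_0_lt_compat; lra.
- pose proof (pow_le q (N + d) (proj1 Hq)). lra.
Qed.

Lemma csum_sum_n a N : csum a (S N) = sum_n (G := C_AbelianMonoid) a N.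
Proof.
induction N as [|N IH].
- rewrite sum_O. simpl. ring.
- rewrite sum_Sn, <- IH. reflexivity.
Qed.

Lemma is_series_csum a l :
  is_series (K := C_AbsRing) (V := C_NormedModule) a l <-> Cconv (csum a) l.
Proof.
unfold is_series. rewrite (Clim_iff _ (sum_n (G := C_AbelianMonoid) a)).
split; intros H.
- apply Cconv_shift. apply is_lim_seq_spec. intros eps.
  destruct (H eps (cond_pos eps)) as [N HN]. exists N. intros m Hm.
  rewrite csum_sum_n, Rminus_0_r, Rabs_pos_eq; [|apply Cmod_ge_0]. now apply HN.
- intros eps He. apply Cconv_incr in H. apply is_lim_seq_spec in H.
  destruct (H (mkposreal eps He)) as [N HN]. exists N. intros m Hm.
  specialize (HN m Hm). rewrite csum_sum_n, Rminus_0_r, Rabs_pos_eq in HN; [exact HN|].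
  apply Cmod_ge_0.
Qed.

Lemma geo_lim K q : 0 <= q < 1 -> is_lim_seq (fun N => K * q ^ N) 0.
Proof.
intros Hq. replace (Finite 0) with (Rbar_mult K 0) by (simpl; f_equal; ring).
apply is_lim_seq_scal_l. apply is_lim_seq_geom. rewrite Rabs_pos_eq; lra.
Qed.

(** Besides convergence, the geometric rate is recorded: products of series and
    remainders are estimated with it later. *)
Lemma geo_sum a K q : 0 <= q < 1 -> (forall m, Cmod (a m) <= K * q ^ m) ->
  exists S : C, forall N, Cmod (csum a N - S) <= K / (1 - q) * q ^ N.
Proof.
intros Hq H.
destruct (ex_series_le (K := C_AbsRing) (V := C_CompleteNormedModule) a (fun m => K * q ^ m)) as [S HS].
- exact H.
- apply (ex_series_scal (K := R_AbsRing) (V := R_NormedModule) K (fun m => q ^ m)).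
  apply ex_series_geom. rewrite Rabs_pos_eq; lra.
- exists S. intros N. apply is_series_csum in HS.
  rewrite <- Cmod_opp. replace (- (csum a N - S))%C with (S - csum a N)%C by ring.
  apply (Cconv_le (fun d => csum a (N + d) - csum a N)%C).
  + apply Cconv_minus; [|apply Cconv_const].
    unfold Cconv in *. apply (is_lim_seq_incr_n _ N) in HS.
    eapply is_lim_seq_ext; [|exact HS]. intros m; simpl. now rewrite Nat.add_comm.
  + intros d. now apply csum_geo_bound.
Qed.

Lemma geo_sum_conv a S K q : 0 <= q < 1 ->
  (forall N, Cmod (csum a N - S) <= K * q ^ N) -> Cconv (csum a) S.
Proof. intros Hq H. apply (Cconv_bound _ _ _ H). now apply geo_lim. Qed.

(** Bernoulli's inequality absorbs a linear factor into a slightly larger ratio. *)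
Lemma lin_geo q q' : 0 <= q < q' -> exists K, 0 < K /\ forall m, INR m * q ^ m <= K * q' ^ m.
Proof.
intros Hq. destruct (Req_dec q 0) as [->|Hq0].
- exists 1. split; [lra|]. intros [|m]; simpl; [lra|].
  rewrite Rmult_0_l, Rmult_0_r, Rmult_1_l. apply (pow_le q' (S m)); lra.
- set (x := q' / q - 1).
  assert (Hx : 0 < x).
  { unfold x. enough (1 < q' / q) by lra. apply (Rmult_lt_reg_r q); [lra|]. unfold Rdiv. rewrite Rmult_assoc, Rinv_l; lra. }
  exists (/ x). split; [now apply Rinv_0_lt_compat|]. intros m.
  replace q' with (q * (1 + x)) by (unfold x; field; exact Hq0).
  rewrite Rpow_mult_distr.
  pose proof (poly m x Hx) as B. pose proof (pow_lt q m ltac:(lra)).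
  apply (Rmult_le_reg_l x); [exact Hx|].
  rewrite <- (Rmult_assoc x (/ x)), Rinv_r, Rmult_1_l by lra.
  replace (x * (INR m * q ^ m)) with (q ^ m * (INR m * x)) by ring.
  apply Rmult_le_compat_l; lra.
Qed.

Lemma CInt_csum (a : nat -> R -> C) (b : nat -> C) x y :
  (forall m, CInt (a m) x y (b m)) -> forall N, CInt (fun t => csum (fun m => a m t) N) x y (csum b N).
Proof.
intros H. induction N as [|N IH]; simpl.
- assert (I := CInt_const 0 x y). replace (RtoC (y - x) * 0)%C with (RtoC 0) in I by ring. exact I.
- now apply CInt_plus.
Qed.

(** * Complex differentiability of analytic functions *)

(** Complex differentiability with a quadratic error.  Analytic functions
    satisfy it, and an explicit error term passes under an integral sign by
    a mere bound. *)
Definition cdiff (f : C -> C) (z l : C) : Prop :=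
  exists K d, 0 <= K /\ 0 < d /\ forall z', Cmod (z' - z) < d ->
    Cmod (f z' - f z - (z' - z) * l) <= K * Cmod (z' - z) ^ 2.

Lemma cdiff_unique f z l l' : cdiff f z l -> cdiff f z l' -> l = l'.
Proof.
intros (K & d & HK & Hd & H) (K' & d' & HK' & Hd' & H').
apply Csub_0, Cmod_eq0_le. apply Rnot_lt_le. intros L.
set (e := Rmin (Rmin d d' / 2) (Cmod (l - l') / (2 * (K + K' + 1)))).
assert (He : 0 < e).
{ unfold e. apply Rmin_glb_lt; [apply Rdiv_lt_0_compat; [now apply Rmin_glb_lt|lra]|].
  apply Rdiv_lt_0_compat; lra. }
assert (e1 : e <= Rmin d d' / 2) by apply Rmin_l.
assert (e2 : e <= Cmod (l - l') / (2 * (K + K' + 1))) by apply Rmin_r.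
pose proof (Rmin_l d d'). pose proof (Rmin_r d d').
assert (E : Cmod (z + RtoC e - z) = e).
{ replace (z + RtoC e - z)%C with (RtoC e) by ring. rewrite Cmod_R. apply Rabs_pos_eq; lra. }
specialize (H (z + RtoC e)%C ltac:(lra)). specialize (H' (z + RtoC e)%C ltac:(lra)).
rewrite E in H, H'.
assert (T : Cmod (RtoC e * (l - l')) <= (K + K') * e ^ 2).
{ replace (RtoC e * (l - l'))%C with
    ((f (z + RtoC e)%C - f z - (z + RtoC e - z) * l') +
      - (f (z + RtoC e)%C - f z - (z + RtoC e - z) * l))%C by ring.
  refine (Rle_trans _ _ _ (Cmod_triangle _ _) _). rewrite Cmod_opp. lra. }
rewrite Cmod_mult, Cmod_R, Rabs_pos_eq in T by lra.
assert (T' : Cmod (l - l') <= (K + K') * e).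
{ apply (Rmult_le_reg_l e); [exact He|]. lra. }
assert (e3 : e * (2 * (K + K' + 1)) <= Cmod (l - l')).
{ apply Rle_div_inv in e2; lra. }
nra.
Qed.

Lemma cdiff_chain f (g : R -> C) t l m :
  cdiff f (g t) l -> Cder g t m -> Cder (fun t => f (g t)) t (m * l)%C.
Proof.
intros (K & d & HK & Hd & H) Hg.
apply Cder_eps. intros eps Heps.
pose proof (Cmod_ge_0 l) as L0. pose proof (Cmod_ge_0 m) as M0.
set (e1 := Rmin 1 (eps / (2 * (Cmod l + 1)))).
assert (He1 : 0 < e1).
{ apply Rmin_glb_lt; [lra|]. apply Rdiv_lt_0_compat; lra. }
destruct (Cder_eps_inv _ _ _ Hg e1 He1) as (d1 & Hd1 & H1).
set (A := Cmod m + 1).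
set (d2 := Rmin d1 (Rmin (d / (2 * A)) (eps / (2 * (K * A ^ 2 + 1))))).
assert (A0 : 1 <= A) by (unfold A; lra).
assert (KA : 0 <= K * A ^ 2) by (apply Rmult_le_pos; [lra|apply pow2_ge_0]).
assert (Q1 : 0 < d / (2 * A)) by (apply Rdiv_lt_0_compat; lra).
assert (Q2 : 0 < eps / (2 * (K * A ^ 2 + 1))) by (apply Rdiv_lt_0_compat; lra).
exists d2. split; [unfold d2; repeat apply Rmin_glb_lt; assumption|].
intros t' Ht'.
apply Rlt_min in Ht'. destruct Ht' as [B1 Ht']. apply Rlt_min in Ht'. destruct Ht' as [B2 B3].
specialize (H1 t' B1). pose proof (Rabs_pos (t' - t)) as P.
assert (e11 : e1 <= 1) by apply Rmin_l.
assert (G : Cmod (g t' - g t) <= A * Rabs (t' - t)).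
{ replace (g t' - g t)%C with ((g t' - g t - RtoC (t' - t) * m) + RtoC (t' - t) * m)%C by ring.
  refine (Rle_trans _ _ _ (Cmod_triangle _ _) _). rewrite Cmod_mult, Cmod_R. unfold A. nra. }
assert (Gd : Cmod (g t' - g t) < d).
{ apply Rlt_div_inv in B2; nra. }
specialize (H (g t') Gd).
replace (f (g t') - f (g t) - RtoC (t' - t) * (m * l))%C with
  ((f (g t') - f (g t) - (g t' - g t) * l) + (g t' - g t - RtoC (t' - t) * m) * l)%C by ring.
refine (Rle_trans _ _ _ (Cmod_triangle _ _) _). rewrite Cmod_mult.
assert (I1 : K * Cmod (g t' - g t) ^ 2 <= eps / 2 * Rabs (t' - t)).
{ apply Rlt_div_inv in B3; [|lra].
  pose proof (Cmod_ge_0 (g t' - g t)).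
  assert (Cmod (g t' - g t) ^ 2 <= (A * Rabs (t' - t)) ^ 2) by (apply pow_incr; lra).
  assert (K * Cmod (g t' - g t) ^ 2 <= K * (A * Rabs (t' - t)) ^ 2)
    by (apply Rmult_le_compat_l; lra).
  replace (K * (A * Rabs (t' - t)) ^ 2) with ((K * A ^ 2 * Rabs (t' - t)) * Rabs (t' - t)) in * by ring.
  assert (K * A ^ 2 * Rabs (t' - t) <= eps / 2) by nra.
  nra. }
assert (I2 : Cmod (g t' - g t - RtoC (t' - t) * m) * Cmod l <= eps / 2 * Rabs (t' - t)).
{ assert (e12 : e1 <= eps / (2 * (Cmod l + 1))) by apply Rmin_r.
  apply Rle_div_inv in e12; [|lra].
  assert (e1 * Cmod l <= eps / 2) by nra.
  refine (Rle_trans _ _ _ (Rmult_le_compat_r _ _ _ L0 H1) _). nra. }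
lra.
Qed.

(** Multiplying the error at exponent [m] by [z + h] produces one new error
    term, [m h^2 z^(m-1)]. *)
Lemma pow_quad (z h : C) R : 0 <= R -> Cmod z <= R -> Cmod (z + h) <= R -> forall m,
  R * Cmod ((z + h) ^ S m - z ^ S m - RtoC (INR (S m)) * h * z ^ m)
    <= INR (S m) ^ 2 * R ^ m * Cmod h ^ 2.
Proof.
intros R0 Hz Hz'. induction m as [|m IH].
- simpl. replace ((z + h) * 1 - z * 1 - 1 * h * 1)%C with (RtoC 0) by ring.
  rewrite Cmod_0. pose proof (Cmod_ge_0 h). nra.
- replace ((z + h) ^ S (S m) - z ^ S (S m) - RtoC (INR (S (S m))) * h * z ^ S m)%C
    with ((z + h) * ((z + h) ^ S m - z ^ S m - RtoC (INR (S m)) * h * z ^ m)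
           + RtoC (INR (S m)) * (h * h) * z ^ m)%C.
  2:{ rewrite (S_INR (S m)), RtoC_plus. rewrite !Cpow_S. ring. }
  set (e := ((z + h) ^ S m - z ^ S m - RtoC (INR (S m)) * h * z ^ m)%C) in *.
  pose proof (Cmod_ge_0 e) as e0. pose proof (Cmod_ge_0 h) as h0.
  pose proof (pos_INR (S m)) as I0.
  pose proof (pow_le R m R0) as P0.
  assert (T1 : Cmod ((z + h) * e) <= R * Cmod e).
  { rewrite Cmod_mult. apply Rmult_le_compat_r; assumption. }
  assert (T2 : Cmod (RtoC (INR (S m)) * (h * h) * z ^ m) <= INR (S m) * Cmod h ^ 2 * R ^ m).
  { rewrite !Cmod_mult, Cmod_R, Cmod_pow, Rabs_pos_eq by assumption.
    replace (Cmod h * Cmod h) with (Cmod h ^ 2) by ring.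
    apply Rmult_le_compat_l; [apply Rmult_le_pos; [assumption|apply pow2_ge_0]|].
    apply pow_incr. split; [apply Cmod_ge_0|assumption]. }
  assert (T := Cmod_triangle ((z + h) * e) (RtoC (INR (S m)) * (h * h) * z ^ m)).
  set (X := Cmod ((z + h) * e + RtoC (INR (S m)) * (h * h) * z ^ m)) in *.
  assert (S1 : R * X <= R * (R * Cmod e) + R * (INR (S m) * Cmod h ^ 2 * R ^ m)).
  { rewrite <- Rmult_plus_distr_l. apply Rmult_le_compat_l; lra. }
  assert (S2 : R * (R * Cmod e) <= R * (INR (S m) ^ 2 * R ^ m * Cmod h ^ 2))
    by (apply Rmult_le_compat_l; lra).
  rewrite (S_INR (S m)).
  assert (h2 : 0 <= R ^ S m * Cmod h ^ 2) by (apply Rmult_le_pos; [apply pow_le; lra|apply pow2_ge_0]).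
  simpl (R ^ S m) in *.
  refine (Rle_trans _ _ _ S1 _).
  refine (Rle_trans _ _ _ (Rplus_le_compat_r _ _ _ S2) _).
  replace (R * (INR (S m) ^ 2 * R ^ m * Cmod h ^ 2) + R * (INR (S m) * Cmod h ^ 2 * R ^ m))
    with ((INR (S m) ^ 2 + INR (S m)) * (R * R ^ m * Cmod h ^ 2)) by ring.
  rewrite (Rmult_assoc _ (R * R ^ m)).
  apply Rmult_le_compat_r; [exact h2|]. nra.
Qed.

Lemma quad_geo q q' : 0 <= q < q' -> exists K, 0 < K /\ forall m, INR m ^ 2 * q ^ m <= K * q' ^ m.
Proof.
intros Hq. set (p := (q + q') / 2).
destruct (lin_geo q p) as (K1 & HK1 & H1); [unfold p; lra|].
destruct (lin_geo p q') as (K2 & HK2 & H2); [unfold p; lra|].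
exists (K1 * K2). split; [now apply Rmult_lt_0_compat|]. intros m.
replace (INR m ^ 2 * q ^ m) with (INR m * (INR m * q ^ m)) by ring.
refine (Rle_trans _ _ _ (Rmult_le_compat_l _ _ _ (pos_INR m) (H1 m)) _).
replace (INR m * (K1 * p ^ m)) with (K1 * (INR m * p ^ m)) by ring.
rewrite Rmult_assoc. apply Rmult_le_compat_l; [lra|apply H2].
Qed.

(** By [pow_quad] the error of the monomial of degree [m] is of order
    [m^2 q^m] with [q = R/rho], and these errors are summable by [quad_geo]. *)
Lemma pseries_diff (c : nat -> C) (f : C -> C) K rho R : 0 < R < rho ->
  (forall m, Cmod (c m) * rho ^ m <= K) ->
  (forall z, Cmod z <= R -> Cconv (csum (fun m => c m * z ^ m)%C) (f z)) ->
  exists M, forall z, Cmod z <= R -> exists D : C,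
    Cconv (csum (fun m => RtoC (INR (S m)) * c (S m) * z ^ m)%C) D /\
    forall z', Cmod z' <= R -> Cmod (f z' - f z - (z' - z) * D) <= M * Cmod (z' - z) ^ 2.
Proof.
intros HR Hc Hf.
set (q := R / rho). assert (Hq : 0 < q < 1).
{ unfold q. split; [apply Rdiv_lt_0_compat|apply ratio_lt_1]; lra. }
set (p := (q + 1) / 2). assert (Hp : q < p < 1) by (unfold p; lra).
destruct (quad_geo q p) as (K1 & HK1 & H1); [lra|].
assert (K0 : 0 <= K).
{ specialize (Hc O). simpl in Hc. pose proof (Cmod_ge_0 (c O)). lra. }
assert (B : forall m, Cmod (c (S m)) * (INR (S m) ^ 2 * R ^ m) <= K * K1 / R * p ^ S m).
{ intros m. apply (Rmult_le_reg_l R); [lra|].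
  replace (R * (K * K1 / R * p ^ S m)) with (K * (K1 * p ^ S m)) by (field; lra).
  replace (R * (Cmod (c (S m)) * (INR (S m) ^ 2 * R ^ m)))
    with ((Cmod (c (S m)) * rho ^ S m) * (INR (S m) ^ 2 * q ^ S m)).
  - apply Rmult_le_compat.
    + apply Rmult_le_pos; [apply Cmod_ge_0|apply pow_le; lra].
    + apply Rmult_le_pos; [apply pow2_ge_0|apply pow_le; lra].
    + apply Hc.
    + apply H1.
  - unfold q, Rdiv. rewrite Rpow_mult_distr, pow_inv. simpl (R ^ S m).
    field. apply pow_nonzero; lra. }
set (K2 := K * K1 / R * p).
assert (K20 : 0 <= K2).
{ unfold K2. repeat apply Rmult_le_pos; try lra. left; apply Rinv_0_lt_compat; lra. }
assert (B' : forall m, Cmod (c (S m)) * (INR (S m) ^ 2 * R ^ m) <= K2 * p ^ m).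
{ intros m. refine (Rle_trans _ _ _ (B m) _). unfold K2. simpl. right; ring. }
exists (K2 / R / (1 - p)). intros z Hz.
destruct (geo_sum (fun m => RtoC (INR (S m)) * c (S m) * z ^ m)%C K2 p) as [D HD]; [lra| |].
{ intros m. refine (Rle_trans _ _ _ _ (B' m)).
  rewrite !Cmod_mult, Cmod_R, Cmod_pow, Rabs_pos_eq by apply pos_INR.
  rewrite (Rmult_comm (INR (S m))), Rmult_assoc.
  apply Rmult_le_compat_l; [apply Cmod_ge_0|].
  apply Rmult_le_compat; [apply pos_INR|apply pow_le, Cmod_ge_0| |].
  - rewrite S_INR. pose proof (pos_INR m). nra.
  - apply pow_incr. split; [apply Cmod_ge_0|exact Hz]. }
exists D. assert (HD' : Cconv (csum (fun m => RtoC (INR (S m)) * c (S m) * z ^ m)%C) D).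
{ apply (geo_sum_conv _ _ (K2 / (1 - p)) p); [lra|exact HD]. }
split; [exact HD'|]. intros z' Hz'.
set (h := (z' - z)%C). replace z' with (z + h)%C in * by (unfold h; ring).
replace (z + h - z)%C with h by ring.
apply (Cconv_le (fun N => csum (fun m => c m * (z + h) ^ m) (S N) - csum (fun m => c m * z ^ m) (S N)
   - h * csum (fun m => RtoC (INR (S m)) * c (S m) * z ^ m) N)%C).
{ apply Cconv_minus; [apply Cconv_minus|].
  - apply (Cconv_incr (csum (fun m => c m * (z + h) ^ m)%C)). now apply Hf.
  - apply (Cconv_incr (csum (fun m => c m * z ^ m)%C)). now apply Hf.
  - now apply Cconv_scal. }
intros N. rewrite !csum_first, <- csum_scal. simpl (_ ^ 0)%C.
set (e := fun m => (c (S m) * ((z + h) ^ S m - z ^ S m - RtoC (INR (S m)) * h * z ^ m))%C).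
match goal with |- Cmod ?X <= _ => replace X with (csum e (0 + N) - csum e 0)%C end.
2:{ simpl (csum e 0). simpl (0 + N)%nat.
  rewrite (csum_ext e (fun m => (c (S m) * (z + h) ^ S m - c (S m) * z ^ S m)
     - h * (RtoC (INR (S m)) * c (S m) * z ^ m))%C).
  - rewrite !csum_minus. ring.
  - intros m _. unfold e. ring. }
replace (K2 / R / (1 - p) * Cmod h ^ 2) with (K2 / R * Cmod h ^ 2 / (1 - p) * p ^ 0)
  by (simpl; field; lra).
apply csum_geo_bound; [lra|]. intros m. unfold e. rewrite Cmod_mult.
apply (Rmult_le_reg_l R); [lra|].
replace (R * (K2 / R * Cmod h ^ 2 * p ^ m)) with ((K2 * p ^ m) * Cmod h ^ 2) by (field; lra).
refine (Rle_trans _ _ _ _ (Rmult_le_compat_r _ _ _ (pow2_ge_0 _) (B' m))).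
replace (R * (Cmod (c (S m)) * Cmod ((z + h) ^ S m - z ^ S m - RtoC (INR (S m)) * h * z ^ m)))
  with (Cmod (c (S m)) * (R * Cmod ((z + h) ^ S m - z ^ S m - RtoC (INR (S m)) * h * z ^ m))) by ring.
rewrite (Rmult_assoc (Cmod (c (S m)))). apply Rmult_le_compat_l; [apply Cmod_ge_0|].
apply pow_quad; [lra|exact Hz|exact Hz'].
Qed.

Lemma locally_Cmod (z : C) (P : C -> Prop) : locally z P ->
  exists d, 0 < d /\ forall z', Cmod (z' - z) < d -> P z'.
Proof.
intros [d Hd]. exists d. split; [apply cond_pos|].
intros z' H. apply Hd. now apply C_NormedModule_mixin_compat1.
Qed.

Lemma is_pseries_csum c x l : is_pseries (K := C_AbsRing) (V := C_NormedModule) c x l ->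
  Cconv (csum (fun m => c m * x ^ m)%C) l.
Proof.
intros H. apply is_series_csum in H.
eapply Cconv_ext; [|exact H]. intros N. apply csum_ext. intros m _.
assert (E : forall m, pow_n (K := C_AbsRing) x m = (x ^ m)%C).
{ clear. induction m as [|m IH]; simpl; [reflexivity|]. now rewrite IH. }
rewrite E. unfold scal; simpl; unfold mult; simpl. ring.
Qed.

Lemma Cconv_bounded u l : Cconv u l -> exists B, forall N, Cmod (u N) <= B.
Proof.
intros H.
destruct (filterlim_bounded (K := C_AbsRing) (V := C_NormedModule) u) as [B HB].
- exists l. apply (Clim_iff eventually u l). intros eps He.
  apply is_lim_seq_spec in H. destruct (H (mkposreal eps He)) as [N HN].
  exists N. intros n Hn. specialize (HN n Hn).
  rewrite Rminus_0_r, Rabs_pos_eq in HN; [exact HN|apply Cmod_ge_0].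
- now exists B.
Qed.

(** The terms of the local series at a single real point are bounded, and this
    already bounds the coefficients geometrically. *)
Lemma analytic_diff f z0 : analytic_at f z0 -> exists d M, 0 < d /\ 0 <= M /\
  forall z, Cmod (z - z0) < d -> exists D : C, forall z', Cmod (z' - z0) < d ->
    Cmod (f z' - f z - (z' - z) * D) <= M * Cmod (z' - z) ^ 2.
Proof.
intros [c Hc]. destruct (locally_Cmod _ _ Hc) as (d & Hd & H). clear Hc.
set (rho := d / 2). assert (Hrho : 0 < rho) by (unfold rho; lra).
assert (E : forall x, Cmod x < d -> Cconv (csum (fun m => c m * x ^ m)%C) (f (z0 + x)%C)).
{ intros x Hx. apply is_pseries_csum.
  replace x with (z0 + x - z0)%C at 1 by ring. apply H.
  now replace (z0 + x - z0)%C with x by ring. }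
assert (Hr : Cmod (RtoC rho) = rho) by (rewrite Cmod_R; apply Rabs_pos_eq; lra).
destruct (Cconv_bounded _ _ (E (RtoC rho) ltac:(unfold rho in *; lra))) as [B HB].
destruct (pseries_diff c (fun x => f (z0 + x)%C) (2 * B) rho (rho / 2)) as [M HM].
- lra.
- intros m. rewrite <- Hr at 1. rewrite <- Cmod_pow, <- Cmod_mult.
  set (u := csum (fun m => (c m * RtoC rho ^ m)%C)) in *.
  replace (c m * RtoC rho ^ m)%C with (u (S m) + - u m)%C by (unfold u; simpl; ring).
  refine (Rle_trans _ _ _ (Cmod_triangle _ _) _). rewrite Cmod_opp.
  pose proof (HB m); pose proof (HB (S m)). lra.
- intros z Hz. apply E. unfold rho in *; lra.
- exists (rho / 2), (Rmax M 0). split; [lra|]. split; [apply Rmax_r|]. intros z Hz.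
  destruct (HM (z - z0)%C ltac:(lra)) as (D & _ & HD). exists D. intros z' Hz'.
  specialize (HD (z' - z0)%C ltac:(lra)).
  replace (z0 + (z' - z0))%C with z' in HD by ring.
  replace (z0 + (z - z0))%C with z in HD by ring.
  replace (z' - z0 - (z - z0))%C with (z' - z)%C in HD by ring.
  refine (Rle_trans _ _ _ HD _). apply Rmult_le_compat_r; [apply pow2_ge_0|apply Rmax_l].
Qed.

Definition cderiv (f : C -> C) (z : C) : C :=
  iota (T := C_CompleteNormedModule) (fun l => cdiff f z l).

Lemma cderiv_eq f z l : cdiff f z l -> cderiv f z = l.
Proof.
intros H. apply (iota_unique (V := C_CompleteNormedModule) (fun l => cdiff f z l) l); [|exact H].
intros y Hy. exact (cdiff_unique _ _ _ _ Hy H).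
Qed.

Lemma analytic_C11 f z0 : analytic_at f z0 -> exists d M, 0 < d /\ 0 <= M /\
  forall z z', Cmod (z - z0) < d -> Cmod (z' - z0) < d ->
    Cmod (f z' - f z - (z' - z) * cderiv f z) <= M * Cmod (z' - z) ^ 2.
Proof.
intros H. destruct (analytic_diff f z0 H) as (d & M & Hd & HM & HD).
exists d, M. split; [exact Hd|split; [exact HM|]]. intros z z' Hz Hz'.
destruct (HD z Hz) as [D HDz].
rewrite (cderiv_eq f z D); [now apply HDz|].
exists M, (d - Cmod (z - z0)). split; [exact HM|split; [lra|]].
intros y Hy. apply HDz. replace (y - z0)%C with ((y - z) + (z - z0))%C by ring.
refine (Rle_lt_trans _ _ _ (Cmod_triangle _ _) _). lra.
Qed.

Lemma analytic_cdiff f z0 : analytic_at f z0 -> cdiff f z0 (cderiv f z0).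
Proof.
intros H. destruct (analytic_C11 f z0 H) as (d & M & Hd & HM & HD).
exists M, d. split; [exact HM|split; [exact Hd|]]. intros z' Hz'. apply HD; [|exact Hz'].
replace (z0 - z0)%C with (RtoC 0) by ring. now rewrite Cmod_0.
Qed.

(** Exchanging the two points in the quadratic estimate bounds the variation
    of the derivative. *)
Lemma analytic_cderiv_lip f z0 : analytic_at f z0 -> exists d M, 0 < d /\ 0 <= M /\
  forall z, Cmod (z - z0) < d -> Cmod (cderiv f z - cderiv f z0) <= M * Cmod (z - z0).
Proof.
intros H. destruct (analytic_C11 f z0 H) as (d & M & Hd & HM & HD).
exists d, (2 * M). split; [exact Hd|split; [lra|]]. intros z Hz.
assert (Z : Cmod (z0 - z0) < d).
{ replace (z0 - z0)%C with (RtoC 0) by ring. now rewrite Cmod_0. }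
assert (H1 := HD z z0 Hz Z). assert (H2 := HD z0 z Z Hz).
destruct (Req_dec (Cmod (z - z0)) 0) as [E|N].
- apply Cmod_eq_0, Csub_0 in E. subst z.
  replace (cderiv f z0 - cderiv f z0)%C with (RtoC 0) by ring.
  rewrite Cmod_0. replace (z0 - z0)%C with (RtoC 0) by ring. rewrite Cmod_0. lra.
- pose proof (Cmod_ge_0 (z - z0)).
  apply (Rmult_le_reg_l (Cmod (z - z0))); [lra|]. rewrite <- Cmod_mult.
  replace ((z - z0) * (cderiv f z - cderiv f z0))%C with
    ((f z0 - f z - (z0 - z) * cderiv f z) + (f z - f z0 - (z - z0) * cderiv f z0))%C by ring.
  refine (Rle_trans _ _ _ (Cmod_triangle _ _) _).
  rewrite <- (Cmod_opp (z0 - z)) in H1. replace (- (z0 - z))%C with (z - z0)%C in H1 by ring.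
  lra.
Qed.

Lemma Ccont_eps (f : R -> C) t :
  (forall eps, 0 < eps -> exists d, 0 < d /\ forall t', Rabs (t' - t) < d -> Cmod (f t' - f t) < eps)
  -> Ccont f t.
Proof.
intros H. unfold Ccont, continuous. apply Clim_iff; [apply locally_filter|].
intros eps He. destruct (H eps He) as (d & Hd & Q). exists (mkposreal d Hd). exact Q.
Qed.

Lemma Ccont_eps_inv (f : R -> C) t : Ccont f t ->
  forall eps, 0 < eps -> exists d, 0 < d /\ forall t', Rabs (t' - t) < d -> Cmod (f t' - f t) < eps.
Proof.
intros H eps He. unfold Ccont, continuous in H.
rewrite (Clim_iff (locally t) f (f t)) in H. destruct (H eps He) as [d Hd].
exists d. split; [apply cond_pos|exact Hd].
Qed.

Lemma Ccont_mult (f g : R -> C) t : Ccont f t -> Ccont g t -> Ccont (fun t => f t * g t)%C t.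
Proof.
intros Hf Hg. apply Ccont_eps. intros eps He.
set (K := Cmod (f t) + Cmod (g t) + 1).
pose proof (Cmod_ge_0 (f t)). pose proof (Cmod_ge_0 (g t)).
assert (HK : 0 < K) by (unfold K; lra).
set (e := Rmin 1 (eps / K)).
assert (Hpos : 0 < e) by (apply Rmin_glb_lt; [lra|now apply Rdiv_lt_0_compat]).
destruct (Ccont_eps_inv _ _ Hf e Hpos) as (d1 & Hd1 & H1).
destruct (Ccont_eps_inv _ _ Hg e Hpos) as (d2 & Hd2 & H2).
exists (Rmin d1 d2). split; [now apply Rmin_glb_lt|]. intros t' Ht'.
apply Rlt_min in Ht'. specialize (H1 t' (proj1 Ht')). specialize (H2 t' (proj2 Ht')).
replace (f t' * g t' - f t * g t)%C with
  ((f t' - f t) * (g t' - g t) + ((f t' - f t) * g t + f t * (g t' - g t)))%C by ring.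
refine (Rle_lt_trans _ _ _ (Cmod_triangle _ _) _).
refine (Rle_lt_trans _ _ _ (Rplus_le_compat_l _ _ _ (Cmod_triangle _ _)) _).
rewrite !Cmod_mult.
pose proof (Cmod_ge_0 (f t' - f t)). pose proof (Cmod_ge_0 (g t' - g t)).
assert (e1 : e <= 1) by apply Rmin_l.
assert (e2 : e * K <= eps).
{ apply Rle_div_inv; [exact HK|apply Rmin_r]. }
unfold K in e2. nra.
Qed.

Lemma Ccont_cderiv f (g : R -> C) t : analytic_at f (g t) -> Ccont g t ->
  Ccont (fun t => cderiv f (g t)) t.
Proof.
intros Ha Hg. apply Ccont_eps. intros eps He.
destruct (analytic_cderiv_lip _ _ Ha) as (d & M & Hd & HM & H).
set (e := Rmin d (eps / (M + 1))).
assert (Hpos : 0 < e) by (apply Rmin_glb_lt; [lra|apply Rdiv_lt_0_compat; lra]).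
destruct (Ccont_eps_inv _ _ Hg e Hpos) as (d1 & Hd1 & H1).
exists d1. split; [exact Hd1|]. intros t' Ht'. specialize (H1 t' Ht').
apply Rlt_min in H1. destruct H1 as [Q1 Q2].
refine (Rle_lt_trans _ _ _ (H _ Q1) _).
apply Rlt_div_inv in Q2; [|lra].
pose proof (Cmod_ge_0 (g t' - g t)). lra.
Qed.

(** By compactness of the parameter interval the quadratic estimate holds
    with one radius and one constant along a whole curve. *)
Lemma analytic_C11_curve f (g : R -> C) a b :
  (forall t, Ccont g t) -> (forall t, a <= t <= b -> analytic_at f (g t)) ->
  exists d M, 0 < d /\ 0 <= M /\ forall t, a <= t <= b -> forall z', Cmod (z' - g t) < d ->
    Cmod (f z' - f (g t) - (z' - g t) * cderiv f (g t)) <= M * Cmod (z' - g t) ^ 2.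
Proof.
intros Hg Ha.
assert (L : forall t0, exists d : posreal, a <= t0 <= b -> forall t, Rabs (t - t0) < d ->
  forall z', Cmod (z' - g t) < d ->
    Cmod (f z' - f (g t) - (z' - g t) * cderiv f (g t)) <= / d * Cmod (z' - g t) ^ 2).
{ intros t0. destruct (classic (a <= t0 <= b)) as [I|I].
  2:{ exists (mkposreal 1 Rlt_0_1). intros K; contradiction. }
  destruct (analytic_C11 _ _ (Ha t0 I)) as (d & M & Hd & HM & H).
  destruct (Ccont_eps_inv _ _ (Hg t0) (d / 2) ltac:(lra)) as (d1 & Hd1 & H1).
  set (e := Rmin (Rmin d1 (d / 2)) (/ (M + 1))).
  assert (He : 0 < e).
  { repeat apply Rmin_glb_lt; try lra. apply Rinv_0_lt_compat; lra. }
  exists (mkposreal e He). intros _ t Ht z' Hz'. simpl in Ht, Hz' |- *.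
  assert (e1 : e <= d1) by (eapply Rle_trans; apply Rmin_l).
  assert (e2 : e <= d / 2) by (eapply Rle_trans; [apply Rmin_l|apply Rmin_r]).
  assert (e3 : e <= / (M + 1)) by apply Rmin_r.
  specialize (H1 t ltac:(lra)).
  refine (Rle_trans _ _ _ (H (g t) z' ltac:(lra) _) _).
  - replace (z' - g t0)%C with ((z' - g t) + (g t - g t0))%C by ring.
    refine (Rle_lt_trans _ _ _ (Cmod_triangle _ _) _). lra.
  - apply Rmult_le_compat_r; [apply pow2_ge_0|].
    apply Rle_trans with (M + 1); [lra|]. rewrite <- (Rinv_inv (M + 1)).
    apply Rinv_le_contravar; assumption. }
destruct (functional_choice _ L) as [del Hdel]. clear L.
destruct (compactness_value_1d a b del) as [d Hd].
exists d, (/ d). split; [apply cond_pos|].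
split; [left; apply Rinv_0_lt_compat, cond_pos|].
intros t Ht z' Hz'.
destruct (NNPP _ (Hd t Ht)) as (t0 & I0 & H0 & H1).
refine (Rle_trans _ _ _ (Hdel t0 I0 t H0 z' ltac:(lra)) _).
apply Rmult_le_compat_r; [apply pow2_ge_0|].
apply Rinv_le_contravar; [apply cond_pos|exact H1].
Qed.

(** * Cauchy's formula and the Taylor series *)

Lemma Cmod_Cexp z : Cmod (Cexp z) = exp (Re z).
Proof.
unfold Cmod, Cexp; simpl.
replace (exp (Re z) * cos (Im z) * (exp (Re z) * cos (Im z) * 1) +
  exp (Re z) * sin (Im z) * (exp (Re z) * sin (Im z) * 1))
  with (exp (Re z) * exp (Re z) * ((sin (Im z))² + (cos (Im z))²)) by (unfold Rsqr; ring).
rewrite sin2_cos2, Rmult_1_r. apply sqrt_square. left; apply exp_pos.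
Qed.

Definition circ (r t : R) : C := (RtoC r * Cexp (Ci * RtoC t))%C.

Lemma Cmod_circ r t : 0 <= r -> Cmod (circ r t) = r.
Proof.
intros Hr. unfold circ. rewrite Cmod_mult, Cmod_R, Cmod_Cexp, Rabs_pos_eq by assumption.
unfold Ci; simpl. replace (0 * t - 1 * 0) with 0 by ring. rewrite exp_0. ring.
Qed.

Lemma Cder_circ r t : Cder (circ r) t (Ci * circ r t)%C.
Proof.
unfold circ. eapply Cder_eq.
- apply Cder_scal. apply Cder_Cexp. apply Cder_scal. apply Cder_id.
- cbv beta. ring.
Qed.

Lemma circ_period r : circ r (2 * PI) = circ r 0.
Proof.
unfold circ, Cexp, Ci, Re, Im; simpl.
replace (0 * 0 + 1 * (2 * PI)) with (2 * PI) by ring.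
replace (0 * 0 + 1 * 0) with 0 by ring.
replace (0 * (2 * PI) - 1 * 0) with 0 by ring.
replace (0 * 0 - 1 * 0) with 0 by ring.
now rewrite cos_2PI, sin_2PI, cos_0, sin_0.
Qed.

Lemma Cder_pow f t l m : Cder f t l ->
  Cder (fun t => f t ^ m)%C t (RtoC (INR m) * f t ^ (m - 1) * l)%C.
Proof.
intros H. induction m as [|m IH].
- eapply Cder_eq; [apply (Cder_const 1)|]. simpl. ring.
- simpl (_ ^ S m)%C. eapply Cder_eq; [exact (Cder_mult _ _ _ _ _ H IH)|]. cbv beta.
  rewrite S_INR, RtoC_plus. simpl (S m - 1)%nat. rewrite Nat.sub_0_r.
  destruct m as [|m]; [simpl; ring|].
  simpl (S m - 1)%nat. rewrite Nat.sub_0_r, !Cpow_S. ring.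
Qed.

Lemma RtoC_neq0 x : x <> 0 -> RtoC x <> 0.
Proof. intros H E. apply H. now apply (f_equal fst) in E. Qed.

Lemma Ci_neq0 : Ci <> 0.
Proof. intros E. apply (f_equal snd) in E. simpl in E. lra. Qed.

Section Cauchy.
Variables (f : C -> C) (R0 r : R) (z : C).
Hypotheses (Hf : forall z, Cmod z < R0 -> analytic_at f z)
  (Hr : 0 < r < R0) (Hz : Cmod z < r).

Let g := circ r.
Let q t := (g t / (g t - z))%C.
Let zeta (lam t : R) := (z + RtoC lam * (g t - z))%C.
Let Q := r / (r - Cmod z).

Lemma g_mod t : Cmod (g t) = r. Proof. apply Cmod_circ; lra. Qed.

Lemma gz_low t : r - Cmod z <= Cmod (g t - z).
Proof.
pose proof (Cmod_triangle (g t - z) z) as T.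
replace (g t - z + z)%C with (g t) in T by ring. rewrite g_mod in T. lra.
Qed.

Lemma gz_neq t : (g t - z)%C <> 0.
Proof. pose proof (gz_low t) as L. intros E. rewrite E, Cmod_0 in L. lra. Qed.

Lemma g_neq t : g t <> 0.
Proof. intros E. pose proof (g_mod t) as M. rewrite E, Cmod_0 in M. lra. Qed.

Lemma Q_pos : 0 < Q. Proof. apply Rdiv_lt_0_compat; lra. Qed.

Lemma q_mod t : Cmod (q t) <= Q.
Proof.
unfold q, Q. rewrite Cmod_div, g_mod by apply gz_neq.
apply Rmult_le_compat_l; [lra|]. apply Rinv_le_contravar; [lra|]. apply gz_low.
Qed.

Lemma Cder_q t : exists l, Cder q t l.
Proof.
eexists. apply Cder_div; [apply Cder_circ| |apply gz_neq].
apply Cder_minus; [apply Cder_circ|apply Cder_const].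
Qed.

Lemma Cder_zeta lam t : Cder (zeta lam) t (RtoC lam * (Ci * g t))%C.
Proof.
unfold zeta. eapply Cder_eq.
- apply Cder_plus; [apply Cder_const|]. apply Cder_scal.
  apply Cder_minus; [apply Cder_circ|apply Cder_const].
- unfold g. ring.
Qed.

Let del := (R0 / r - 1) / 2.

Lemma del_pos : 0 < del.
Proof.
unfold del. assert (1 < R0 / r) by (apply Rlt_div_r; lra). lra.
Qed.

Lemma zeta_mod lam t : - del < lam < 1 + del -> Cmod (zeta lam t) < R0.
Proof.
intros Hl. pose proof del_pos as D.
replace (zeta lam t) with (RtoC (1 - lam) * z + RtoC lam * g t)%C
  by (unfold zeta; rewrite RtoC_minus; ring).
refine (Rle_lt_trans _ _ _ (Cmod_triangle _ _) _).
rewrite !Cmod_mult, !Cmod_R, g_mod.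
assert (E : R0 = (1 + 2 * del) * r) by (unfold del; field; lra).
rewrite E. pose proof (Cmod_ge_0 z).
unfold Rabs; repeat destruct Rcase_abs; nra.
Qed.

Lemma Cder_fzeta lam t : - del < lam < 1 + del ->
  Cder (fun t => f (zeta lam t)) t (RtoC lam * (Ci * g t) * cderiv f (zeta lam t))%C.
Proof.
intros Hl. apply cdiff_chain; [|apply Cder_zeta].
apply analytic_cdiff, Hf. now apply zeta_mod.
Qed.

(** The curve [zeta lam] contracts the circle to the point [z] as [lam] goes from
    [1] to [0].  The margin [del] allows two-sided derivatives at both ends. *)
Definition cauchy_int (lam : R) : C :=
  CRInt (fun t => f (zeta lam t) * q t)%C 0 (2 * PI).

Lemma cauchy_int_correct lam : - del < lam < 1 + del ->
  CInt (fun t => f (zeta lam t) * q t)%C 0 (2 * PI) (cauchy_int lam).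
Proof.
intros Hl. apply CRInt_correct. intros t _. apply Ccont_mult.
- eapply Cder_cont. now apply Cder_fzeta.
- destruct (Cder_q t) as [l Hl']. eapply Cder_cont, Hl'.
Qed.

(** The integrand is a total derivative along the closed circle. *)
Lemma cauchy_total_deriv lam : - del < lam < 1 + del ->
  CInt (fun t => cderiv f (zeta lam t) * g t)%C 0 (2 * PI) 0.
Proof.
intros Hl. destruct (Req_dec lam 0) as [->|N].
- apply (CInt_ext (fun t => cderiv f z / Ci * (Ci * g t))%C).
  { intros t _. unfold zeta. replace (z + 0 * (g t - z))%C with z by ring.
    field. apply Ci_neq0. }
  replace (RtoC 0) with (cderiv f z / Ci * (g (2 * PI) - g 0))%C.
  2:{ unfold g. rewrite circ_period. field. apply Ci_neq0. }
  apply CInt_scal. apply CInt_derive.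
  + intros t _. apply Cder_circ.
  + intros t _. eapply Cder_cont. apply Cder_scal. apply Cder_circ.
- assert (L0 : RtoC lam <> 0) by now apply RtoC_neq0.
  apply (CInt_ext (fun t => / (RtoC lam * Ci) * (RtoC lam * (Ci * g t) * cderiv f (zeta lam t)))%C).
  { intros t _. field. split; [apply Ci_neq0|exact L0]. }
  replace (RtoC 0) with (/ (RtoC lam * Ci) * (f (zeta lam (2 * PI)) - f (zeta lam 0)))%C.
  2:{ unfold zeta, g. rewrite circ_period. field. split; [apply Ci_neq0|exact L0]. }
  apply CInt_scal. apply (CInt_derive (fun t => f (zeta lam t))).
  + intros t _. now apply Cder_fzeta.
  + intros t _. apply Ccont_mult.
    * eapply Cder_cont. apply Cder_scal, Cder_scal, Cder_circ.
    * apply Ccont_cderiv; [apply Hf; now apply zeta_mod|].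
      eapply Cder_cont, Cder_zeta.
Qed.

(** The [lam]-derivative of the integrand is [f'(zeta) g], and its integral
    vanishes by [cauchy_total_deriv].  The uniform quadratic estimate along the
    curve justifies the differentiation under the integral. *)
Lemma cauchy_int_der lam : 0 <= lam <= 1 -> Cder cauchy_int lam 0.
Proof.
intros Hl0. pose proof del_pos as D. assert (Hl : - del < lam < 1 + del) by lra.
pose proof PI_RGT_0 as Hpi.
destruct (analytic_C11_curve f (zeta lam) 0 (2 * PI)) as (d & M & Hd & HM & H).
{ intros t. eapply Cder_cont, Cder_zeta. }
{ intros t _. apply Hf. now apply zeta_mod. }
set (K := M * (2 * r) ^ 2 * Q * (2 * PI)).
assert (K0 : 0 <= K).
{ unfold K. pose proof Q_pos as Q0. apply Rmult_le_pos; [|lra]. apply Rmult_le_pos; [|lra].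
  apply Rmult_le_pos; [exact HM|apply pow2_ge_0]. }
apply Cder_eps. intros eps He.
exists (Rmin (del / 2) (Rmin (d / (2 * r)) (eps / (K + 1)))). split.
{ repeat apply Rmin_glb_lt; try lra; apply Rdiv_lt_0_compat; lra. }
intros lam' Hlam'.
apply Rlt_min in Hlam'. destruct Hlam' as [B1 B2].
apply Rlt_min in B2. destruct B2 as [B2 B3].
assert (Hl' : - del < lam' < 1 + del).
{ apply Rabs_def2 in B1. lra. }
apply Rlt_div_inv in B2; [|lra].
assert (I := CInt_minus _ _ _ _ _ _
  (CInt_minus _ _ _ _ _ _ (cauchy_int_correct lam' Hl') (cauchy_int_correct lam Hl))
  (CInt_scal _ _ _ _ (RtoC (lam' - lam)) (cauchy_total_deriv lam Hl))).
apply Rle_trans with (M * (Rabs (lam' - lam) * (2 * r)) ^ 2 * Q * (2 * PI - 0)).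
- refine (CInt_bound_const _ _ 0 (2 * PI) _ _ _ I); [lra|].
  intros t Ht. cbv beta.
  assert (Z : (zeta lam' t - zeta lam t)%C = (RtoC (lam' - lam) * (g t - z))%C)
    by (unfold zeta; rewrite RtoC_minus; ring).
  assert (Zm : Cmod (zeta lam' t - zeta lam t) <= Rabs (lam' - lam) * (2 * r)).
  { rewrite Z, Cmod_mult, Cmod_R. apply Rmult_le_compat_l; [apply Rabs_pos|].
    unfold Cminus. refine (Rle_trans _ _ _ (Cmod_triangle _ _) _). rewrite Cmod_opp, g_mod. lra. }
  replace (f (zeta lam' t) * q t - f (zeta lam t) * q t -
     RtoC (lam' - lam) * (cderiv f (zeta lam t) * g t))%C with
   ((f (zeta lam' t) - f (zeta lam t) - (zeta lam' t - zeta lam t) * cderiv f (zeta lam t)) * q t)%C.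
  2:{ rewrite Z. unfold q. field. apply gz_neq. }
  rewrite Cmod_mult.
  apply Rmult_le_compat; [apply Cmod_ge_0|apply Cmod_ge_0| |apply q_mod].
  refine (Rle_trans _ _ _ (H t Ht (zeta lam' t) ltac:(lra)) _).
  apply Rmult_le_compat_l; [exact HM|]. apply pow_incr. split; [apply Cmod_ge_0|exact Zm].
- replace (M * (Rabs (lam' - lam) * (2 * r)) ^ 2 * Q * (2 * PI - 0))
    with (K * Rabs (lam' - lam) * Rabs (lam' - lam)) by (unfold K; ring).
  apply Rmult_le_compat_r; [apply Rabs_pos|].
  apply Rlt_div_inv in B3; [|lra]. pose proof (Rabs_pos (lam' - lam)). lra.
Qed.

(** Homotopy between the circle and its centre [z]. *)
Lemma cauchy_formula (v : C) : CInt q 0 (2 * PI) v ->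
  CInt (fun t => f (g t) * q t)%C 0 (2 * PI) (f z * v)%C.
Proof.
intros Hv. pose proof del_pos as D.
assert (E : cauchy_int 1 = cauchy_int 0).
{ apply Cder_zero_const; [lra|]. intros t Ht. now apply cauchy_int_der. }
assert (I1 := cauchy_int_correct 1 ltac:(lra)).
assert (I0 := cauchy_int_correct 0 ltac:(lra)).
rewrite E in I1.
replace (f z * v)%C with (cauchy_int 0).
- apply (CInt_ext (fun t => f (zeta 1 t) * q t)%C); [|exact I1].
  intros t _. unfold zeta. do 2 f_equal. ring.
- apply (CInt_unique _ _ _ _ _ I0).
  apply (CInt_ext (fun t => f z * q t)%C); [|now apply CInt_scal].
  intros t _. unfold zeta. do 2 f_equal. ring.
Qed.

Lemma geo_kernel t N :
  q t = (csum (fun m => z ^ m * (/ g t) ^ m) N + (z * / g t) ^ N * q t)%C.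
Proof.
induction N as [|N IH]; simpl; [ring|].
rewrite IH at 1. rewrite <- Cplus_assoc. f_equal.
rewrite !Cpow_mult_l. unfold q. field. split; [apply gz_neq|apply g_neq].
Qed.

Lemma ratio_lt : 0 <= Cmod z / r < 1.
Proof.
split.
- apply Rmult_le_pos; [apply Cmod_ge_0|left; apply Rinv_0_lt_compat; lra].
- apply ratio_lt_1; lra.
Qed.

(** The Cauchy kernel is expanded by a finite geometric sum.  With [h = 1] this
    evaluates the integral of the kernel itself; with [h = f o g] it gives the
    Taylor series. *)
Lemma cauchy_expand (h : R -> C) (c : nat -> C) (I : C) B :
  (forall t, 0 <= t <= 2 * PI -> Cmod (h t) <= B) ->
  (forall m, CInt (fun t => h t * (/ g t) ^ m)%C 0 (2 * PI) (c m)) ->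
  CInt (fun t => h t * q t)%C 0 (2 * PI) I ->
  Cconv (csum (fun m => c m * z ^ m)%C) I.
Proof.
intros HB Hc HI. pose proof PI_RGT_0 as Hpi.
apply (Cconv_bound _ _ (fun N => B * Q * (2 * PI) * (Cmod z / r) ^ N)); [|apply geo_lim, ratio_lt].
intros N. rewrite <- Cmod_opp.
assert (S : CInt (fun t => csum (fun m => z ^ m * (h t * (/ g t) ^ m)) N)%C 0 (2 * PI)
  (csum (fun m => z ^ m * c m)%C N)).
{ apply (CInt_csum (fun m t => z ^ m * (h t * (/ g t) ^ m))%C).
  intros m. apply CInt_scal, Hc. }
assert (I1 := CInt_minus _ _ _ _ _ _ HI S).
rewrite (csum_ext (fun m => z ^ m * c m)%C (fun m => c m * z ^ m)%C) in I1 by (intros; ring).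
replace (- (csum (fun m => c m * z ^ m) N - I))%C with (I - csum (fun m => c m * z ^ m) N)%C by ring.
replace (B * Q * (2 * PI) * (Cmod z / r) ^ N) with (B * ((Cmod z / r) ^ N * Q) * (2 * PI - 0)) by ring.
refine (CInt_bound_const _ _ 0 (2 * PI) _ _ _ I1); [lra|].
intros t Ht. cbv beta.
replace (h t * q t - csum (fun m => z ^ m * (h t * (/ g t) ^ m)) N)%C
  with (h t * ((z * / g t) ^ N * q t))%C.
- rewrite !Cmod_mult, Cmod_pow.
  assert (E : Cmod (z * / g t) = Cmod z / r).
  { rewrite Cmod_mult, Cmod_inv, g_mod by apply g_neq. reflexivity. }
  rewrite E.
  apply Rmult_le_compat; [apply Cmod_ge_0| |now apply HB|].
  + apply Rmult_le_pos; [apply pow_le, ratio_lt|apply Cmod_ge_0].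
  + apply Rmult_le_compat_l; [apply pow_le, ratio_lt|apply q_mod].
- rewrite (csum_ext _ (fun m => h t * (z ^ m * (/ g t) ^ m))%C) by (intros; ring).
  rewrite csum_scal. rewrite (geo_kernel t N) at 2. ring.
Qed.

Lemma inv_g_int m : (1 <= m)%nat -> CInt (fun t => (/ g t) ^ m)%C 0 (2 * PI) 0.
Proof.
intros Hm. assert (N : RtoC (INR m) <> 0) by (apply RtoC_neq0, not_0_INR; lia).
assert (D : forall t, Cder (fun t => (/ g t) ^ m)%C t (- Ci * RtoC (INR m) * (/ g t) ^ m)%C).
{ intros t. eapply Cder_eq.
  - apply Cder_pow. apply Cder_inv; [apply Cder_circ|apply g_neq].
  - destruct m as [|m]; [lia|]. simpl (S m - 1)%nat. rewrite Nat.sub_0_r, Cpow_S.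
    fold g. field. apply g_neq. }
apply (CInt_ext (fun t => / (- Ci * RtoC (INR m)) * (- Ci * RtoC (INR m) * (/ g t) ^ m))%C).
{ intros t _. pose proof Ci_neq0. field. auto. }
replace (RtoC 0) with (/ (- Ci * RtoC (INR m)) * ((/ g (2 * PI)) ^ m - (/ g 0) ^ m))%C.
2:{ unfold g. rewrite circ_period. pose proof Ci_neq0. field. auto. }
apply CInt_scal. apply (CInt_derive (fun t => (/ g t) ^ m)%C).
- intros t _. apply D.
- intros t _. eapply Cder_cont, Cder_scal, D.
Qed.

Lemma cauchy_kernel_int : CInt q 0 (2 * PI) (RtoC (2 * PI)).
Proof.
pose proof PI_RGT_0 as Hpi.
destruct (ex_CInt q 0 (2 * PI)) as [v Hv].
{ intros t _. destruct (Cder_q t) as [l Hl]. eapply Cder_cont, Hl. }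
replace (RtoC (2 * PI)) with v; [exact Hv|].
set (c := fun m : nat => match m with O => RtoC (2 * PI) | S _ => RtoC 0 end).
assert (H : Cconv (csum (fun m => c m * z ^ m)%C) v).
{ apply (cauchy_expand (fun _ => 1) c v 1).
  - intros t _. rewrite Cmod_1. lra.
  - intros [|m]; unfold c.
    + apply (CInt_ext (fun _ => 1)); [intros t _; simpl; ring|].
      replace (RtoC (2 * PI)) with (RtoC (2 * PI - 0) * 1)%C; [apply CInt_const|].
      rewrite Rminus_0_r; ring.
    + apply (CInt_ext (fun t => (/ g t) ^ S m)%C); [intros t _; ring|].
      apply inv_g_int. lia.
  - apply (CInt_ext q); [intros t _; ring|exact Hv]. }
apply (Cconv_unique _ _ _ H).
apply Cconv_shift.
apply (Cconv_ext (fun _ => RtoC (2 * PI))); [|apply Cconv_const].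
intros N. induction N as [|N IH]; [simpl; ring|].
simpl csum in *. rewrite <- IH. simpl; ring.
Qed.

Lemma cauchy_taylor (c : nat -> C) B :
  (forall t, 0 <= t <= 2 * PI -> Cmod (f (g t)) <= B) ->
  (forall m, CInt (fun t => f (g t) * (/ g t) ^ m)%C 0 (2 * PI) (c m)) ->
  Cconv (csum (fun m => / RtoC (2 * PI) * c m * z ^ m)%C) (f z).
Proof.
intros HB Hc. pose proof PI_RGT_0 as Hpi.
assert (H := cauchy_expand (fun t => f (g t)) c _ B HB Hc (cauchy_formula _ cauchy_kernel_int)).
apply (Cconv_scal _ _ (/ RtoC (2 * PI))) in H.
replace (/ RtoC (2 * PI) * (f z * RtoC (2 * PI)))%C with (f z) in H.
- eapply Cconv_ext; [|exact H]. intros N. cbv beta. rewrite <- csum_scal.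
  apply csum_ext. intros; ring.
- field. apply RtoC_neq0. lra.
Qed.

End Cauchy.

Lemma Ccont_Cmod (h : R -> C) t : Ccont h t -> continuity_pt (fun t => Cmod (h t)) t.
Proof.
intros H eps He. destruct (Ccont_eps_inv _ _ H eps He) as (d & Hd & Q).
exists d. split; [exact Hd|]. intros t' [_ Ht']. specialize (Q t' Ht').
simpl. unfold Rdist. refine (Rle_lt_trans _ _ _ _ Q).
apply Rabs_le. split.
- pose proof (Cmod_triangle (h t') (- (h t' - h t))) as T.
  replace (h t' + - (h t' - h t))%C with (h t) in T by ring. rewrite Cmod_opp in T. lra.
- pose proof (Cmod_triangle (h t) (h t' - h t)) as T.
  replace (h t + (h t' - h t))%C with (h t') in T by ring. lra.
Qed.

(** The coefficients are averages of [f] over a circle, whence the bound. *)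
Theorem taylor_disc (f : C -> C) R0 r : (forall z, Cmod z < R0 -> analytic_at f z) -> 0 < r < R0 ->
  exists (c : nat -> C) K, (forall m, Cmod (c m) * r ^ m <= K) /\
    forall z, Cmod z < r -> Cconv (csum (fun m => c m * z ^ m)%C) (f z).
Proof.
intros Hf Hr. pose proof PI_RGT_0 as Hpi.
assert (Hc : forall t, Ccont (fun t => f (circ r t)) t).
{ intros t. eapply Cder_cont, cdiff_chain; [|apply Cder_circ].
  apply analytic_cdiff, Hf. rewrite Cmod_circ; lra. }
assert (g0 : forall t, circ r t <> 0).
{ intros t E. pose proof (Cmod_circ r t ltac:(lra)) as M. rewrite E, Cmod_0 in M. lra. }
destruct (continuity_ab_maj (fun t => Cmod (f (circ r t))) 0 (2 * PI)) as (tm & Hmax & _); [lra| |].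
{ intros t _. apply Ccont_Cmod, Hc. }
set (B := Cmod (f (circ r tm))) in *.
assert (ex : forall m, exists v, CInt (fun t => f (circ r t) * (/ circ r t) ^ m)%C 0 (2 * PI) v).
{ intros m. apply ex_CInt. intros t _. apply Ccont_mult; [apply Hc|].
  eapply Cder_cont, Cder_pow, Cder_inv; [apply Cder_circ|apply g0]. }
destruct (functional_choice _ ex) as [c Hcm].
exists (fun m => / RtoC (2 * PI) * c m)%C, B. split.
- intros m. assert (b : Cmod (c m) <= B * / r ^ m * (2 * PI - 0)).
  { refine (CInt_bound_const _ _ _ _ _ _ _ (Hcm m)); [lra|]. intros t Ht.
    rewrite Cmod_mult, Cmod_pow, Cmod_inv, Cmod_circ, pow_inv by (auto; lra).
    apply Rmult_le_compat_r; [left; apply Rinv_0_lt_compat, pow_lt; lra|now apply Hmax]. }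
  pose proof (pow_lt r m ltac:(lra)) as P.
  rewrite Cmod_mult, Cmod_inv, Cmod_R, Rabs_pos_eq by (try apply RtoC_neq0; lra).
  apply (Rmult_le_reg_l (2 * PI)); [lra|].
  replace (2 * PI * (/ (2 * PI) * Cmod (c m) * r ^ m)) with (Cmod (c m) * r ^ m) by (field; lra).
  apply (Rmult_le_compat_r (r ^ m)) in b; [|lra].
  replace (B * / r ^ m * (2 * PI - 0) * r ^ m) with (2 * PI * B) in b by (field; lra). exact b.
- intros z Hz. now apply (cauchy_taylor f R0 r z Hf Hr Hz c B Hmax).
Qed.

(** * Appell polynomials and Bernoulli numbers *)

Lemma Cder_csum (a : nat -> R -> C) (b : nat -> C) t N :
  (forall m, (m < N)%nat -> Cder (a m) t (b m)) ->
  Cder (fun t => csum (fun m => a m t) N) t (csum b N).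
Proof.
induction N as [|N IH]; intros H; simpl; [apply Cder_const|].
apply Cder_plus; [apply IH; auto with arith|apply H; lia].
Qed.

Definition appell_poly (b : nat -> C) (N : nat) (u : C) : C :=
  csum (fun i => RtoC (Binomial.C N i) * b i * u ^ (N - i))%C (S N).

Lemma binom_absorb N i : (i <= N)%nat ->
  Binomial.C (S N) i * INR (S N - i) = INR (S N) * Binomial.C N i.
Proof.
intros H. unfold Binomial.C. replace (S N - i)%nat with (S (N - i)) by lia.
rewrite !fact_simpl, !mult_INR. field.
repeat split; try apply INR_fact_neq_0; apply not_0_INR; lia.
Qed.

Lemma binom_diag N : Binomial.C N N = 1.
Proof. unfold Binomial.C. rewrite Nat.sub_diag. simpl. field. apply INR_fact_neq_0. Qed.

Lemma binom_0 N : Binomial.C N 0 = 1.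
Proof. unfold Binomial.C. rewrite Nat.sub_0_r. simpl. field. apply INR_fact_neq_0. Qed.

Lemma Cder_appell_poly b N g t m : Cder g t m ->
  Cder (fun t => appell_poly b (S N) (g t)) t (RtoC (INR (S N)) * appell_poly b N (g t) * m)%C.
Proof.
intros H. unfold appell_poly.
set (d := fun i => (RtoC (Binomial.C (S N) i) * b i *
   (RtoC (INR (S N - i)) * g t ^ (S N - i - 1) * m))%C).
eapply Cder_eq.
- apply (Cder_csum _ d). intros i Hi. unfold d. apply Cder_scal. now apply Cder_pow.
- rewrite (csum_S d (S N)).
  assert (E : d (S N) = 0) by (unfold d; rewrite Nat.sub_diag; simpl (INR 0); ring).
  rewrite E, (csum_ext d (fun i => (RtoC (INR (S N)) * m) *
    (RtoC (Binomial.C N i) * b i * g t ^ (N - i)))%C).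
  + rewrite csum_scal. ring.
  + intros i Hi. unfold d. replace (S N - i - 1)%nat with (N - i)%nat by lia.
    assert (A := f_equal RtoC (binom_absorb N i ltac:(lia))). rewrite !RtoC_mult in A.
    replace (RtoC (Binomial.C (S N) i) * b i * (RtoC (INR (S N - i)) * g t ^ (N - i) * m))%C
      with ((RtoC (Binomial.C (S N) i) * RtoC (INR (S N - i))) * b i * g t ^ (N - i) * m)%C by ring.
    rewrite A. ring.
Qed.

Lemma csum_zero (a : nat -> C) N : (forall m, (m < N)%nat -> a m = 0) -> csum a N = 0.
Proof.
induction N as [|N IH]; intros H; simpl; [reflexivity|].
rewrite IH, H; [ring|lia|auto with arith].
Qed.

Lemma Cpow_0 m : (0 < m)%nat -> (RtoC 0 ^ m)%C = 0.
Proof. destruct m; [lia|]. intros _. rewrite Cpow_S. ring. Qed.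

Lemma appell_poly_at_0 b N : appell_poly b N 0 = b N.
Proof.
unfold appell_poly. rewrite csum_S.
rewrite csum_zero.
- rewrite binom_diag, Nat.sub_diag. simpl. ring.
- intros m Hm. rewrite Cpow_0 by lia. ring.
Qed.

Lemma appell_poly_0 b u : appell_poly b 0 u = b O.
Proof. unfold appell_poly. simpl. rewrite binom_diag. ring. Qed.

Lemma appell_poly_scale b c N u : appell_poly (fun i => b i * c ^ i)%C N (c * u)%C = (c ^ N * appell_poly b N u)%C.
Proof.
unfold appell_poly. rewrite <- csum_scal. apply csum_ext. intros i Hi.
rewrite Cpow_mult_l. replace (c ^ N)%C with (c ^ i * c ^ (N - i))%C; [ring|].
rewrite <- Cpow_add_r. f_equal. lia.
Qed.

Definition appell (f : nat -> R -> C) : Prop :=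
  (forall t, f O t = 1) /\ forall N t, Cder (f (S N)) t (RtoC (INR (S N)) * f N t)%C.

Lemma appell_appell_poly (b : nat -> C) : b O = 1 -> appell (fun N t => appell_poly b N (RtoC t)).
Proof.
intros H. split.
- intros t. now rewrite appell_poly_0.
- intros N t. eapply Cder_eq; [apply Cder_appell_poly; apply Cder_id|]. ring.
Qed.

Lemma Cder_zero_all (f : R -> C) : (forall t, Cder f t 0) -> forall s t, f s = f t.
Proof.
intros H s t. destruct (Rle_dec s t) as [L|L].
- symmetry. apply (Cder_zero_const f s t L). auto.
- apply (Cder_zero_const f t s); [lra|auto].
Qed.

(** The constant of integration of [f N] is fixed by the boundary condition
    on its primitive [f (N + 1)]. *)
Lemma appell_unique f g p q : p < q -> appell f -> appell g ->
  (forall N, (2 <= N)%nat -> f N p = f N q) -> (forall N, (2 <= N)%nat -> g N p = g N q) ->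
  forall N t, f N t = g N t.
Proof.
intros Hpq [f0 fd] [g0 gd] Hf Hg. induction N as [|N IH]; intros t.
- now rewrite f0, g0.
- assert (K : forall s t, (f (S N) s - g (S N) s)%C = (f (S N) t - g (S N) t)%C).
  { apply Cder_zero_all. intros s. eapply Cder_eq; [apply Cder_minus; [apply fd|apply gd]|].
    rewrite IH. ring. }
  set (c := (f (S N) t - g (S N) t)%C).
  assert (E : forall s, f (S N) s = (g (S N) s + c)%C).
  { intros s. unfold c. rewrite (K t s). ring. }
  set (n2 := RtoC (INR (S (S N)))).
  assert (K2 : forall s t, (f (S (S N)) s - g (S (S N)) s - n2 * c * RtoC s)%C =
     (f (S (S N)) t - g (S (S N)) t - n2 * c * RtoC t)%C).
  { apply Cder_zero_all. intros s. eapply Cder_eq.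
    - apply Cder_minus; [apply Cder_minus; [apply fd|apply gd]|]. apply Cder_scal, Cder_id.
    - rewrite E. unfold n2. ring. }
  specialize (K2 p q). rewrite (Hf (S (S N))), (Hg (S (S N))) in K2 by lia.
  assert (Z : (n2 * RtoC (q - p) * c)%C = 0).
  { rewrite RtoC_minus.
    replace (n2 * (RtoC q - RtoC p) * c)%C with
      ((f (S (S N)) q - g (S (S N)) q - n2 * c * RtoC p) -
       (f (S (S N)) q - g (S (S N)) q - n2 * c * RtoC q))%C by ring.
    rewrite K2. ring. }
  assert (N0 : (n2 * RtoC (q - p))%C <> 0).
  { apply Cmult_neq_0; apply RtoC_neq0; [apply not_0_INR; lia|lra]. }
  assert (C0 : c = 0).
  { replace c with (/ (n2 * RtoC (q - p)) * (n2 * RtoC (q - p) * c))%C.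
    - rewrite Z. ring.
    - field. split; [|]; intros Q; apply N0; rewrite Q; ring. }
  rewrite E, C0. ring.
Qed.

Lemma bernoulli_upto_eq m i : (i <= m)%nat -> bernoulli_upto m i = bernoulli i.
Proof.
induction m as [|m IH]; intros H.
- replace i with O by lia. reflexivity.
- destruct (Nat.eq_dec i (S m)) as [->|N]; [reflexivity|].
  simpl. destruct (Nat.leb_spec i m) as [L|L]; [now apply IH|lia].
Qed.

Lemma bernoulli_0 : bernoulli 0 = 1.
Proof. reflexivity. Qed.

Lemma bernoulli_S p : INR (p + 2) * bernoulli (S p) =
  - sum_f_R0 (fun l => Binomial.C (p + 2) l * bernoulli l) p.
Proof.
assert (E : bernoulli (S p) = - / INR (p + 2) *
  sum_f_R0 (fun l => Binomial.C (p + 2) l * bernoulli_upto p l) p).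
{ unfold bernoulli. cbn [bernoulli_upto]. destruct (Nat.leb_spec (S p) p); [lia|reflexivity]. }
rewrite E, (sum_eq _ (fun l => Binomial.C (p + 2) l * bernoulli l)).
- field. apply not_0_INR. lia.
- intros i Hi. now rewrite bernoulli_upto_eq.
Qed.

Definition Bern (i : nat) : C := RtoC (bernoulli i).

Lemma csum_sum_f (a : nat -> R) N : csum (fun i => RtoC (a i)) (S N) = RtoC (sum_f_R0 a N).
Proof.
induction N as [|N IH]; [simpl; ring|].
rewrite csum_S, IH, <- RtoC_plus. reflexivity.
Qed.

Lemma appell_poly_at_1 b N : appell_poly b N 1 = csum (fun i => RtoC (Binomial.C N i) * b i)%C (S N).
Proof. unfold appell_poly. apply csum_ext. intros i _. rewrite Cpow_1_l. ring. Qed.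

Lemma Bern_01 N : (2 <= N)%nat -> appell_poly Bern N 0 = appell_poly Bern N 1.
Proof.
intros HN. rewrite appell_poly_at_0, appell_poly_at_1.
rewrite csum_S. rewrite binom_diag.
replace (csum (fun i => RtoC (Binomial.C N i) * Bern i)%C N) with (RtoC 0); [ring|].
destruct N as [|[|p]]; [lia|lia|]. clear HN.
symmetry. unfold Bern.
rewrite (csum_ext _ (fun i => RtoC (Binomial.C (S (S p)) i * bernoulli i))) by (intros; now rewrite RtoC_mult).
rewrite csum_sum_f. f_equal. simpl sum_f_R0.
pose proof (bernoulli_S p) as H. replace (p + 2)%nat with (S (S p)) in H by lia.
replace (Binomial.C (S (S p)) (S p)) with (INR (S (S p))); [lra|].
unfold Binomial.C. replace (S (S p) - S p)%nat with 1%nat by lia.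
rewrite (fact_simpl (S p)), mult_INR. simpl (fact 1). simpl (INR 1).
field. apply INR_fact_neq_0.
Qed.

Lemma appell_scale f s c d : s <> 0 -> appell f -> s * d = 1 ->
  appell (fun N t => RtoC (s ^ N) * f N (d * t + c)%R)%C.
Proof.
intros Hs [f0 fd] Hsd. split.
- intros t. rewrite f0. simpl. ring.
- intros N t.
  assert (H : is_derive (fun t => d * t + c) t d) by (auto_derive; auto; ring).
  assert (Hc : Cder (fun t => f (S N) (d * t + c)) t (RtoC d * (RtoC (INR (S N)) * f N (d * t + c)%R))%C).
  { assert (I := is_derive_comp (V := C_R_NormedModule) (f (S N)) (fun t => d * t + c) t _ _ (fd N (d * t + c)) H).
    eapply Cder_eq; [exact I|]. unfold scal; simpl; unfold prod_scal, scal; simpl; unfold mult; simpl.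
    apply injective_projections; simpl; ring. }
  eapply Cder_eq; [apply Cder_scal; exact Hc|].
  simpl (s ^ S N). rewrite RtoC_mult.
  replace (RtoC s * RtoC (s ^ N) * (RtoC d * (RtoC (INR (S N)) * f N (d * t + c)%R)))%C with
    ((RtoC s * RtoC d) * (RtoC (INR (S N)) * (RtoC (s ^ N) * f N (d * t + c)%R)))%C by ring.
  rewrite <- RtoC_mult, Hsd. ring.
Qed.

(** The two sides are Appell sequences, and both take equal values at [0] and [1]. *)
Lemma Bern_refl N t : appell_poly Bern N (RtoC t) = (RtoC ((-1) ^ N) * appell_poly Bern N (RtoC (1 - t)))%C.
Proof.
assert (A := appell_appell_poly Bern eq_refl).
rewrite (appell_unique _ _ 0 1 Rlt_0_1 A (appell_scale _ (-1) 1 (-1) ltac:(lra) A ltac:(lra))).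
- do 2 f_equal. f_equal. ring.
- apply Bern_01.
- intros M HM. cbv beta. replace (-1 * 0 + 1) with 1 by ring. replace (-1 * 1 + 1) with 0 by ring.
  now rewrite Bern_01.
Qed.

Lemma pow_m1_odd N : Nat.Odd N -> (-1) ^ N = -1.
Proof. intros [k ->]. rewrite pow_add, pow_1_even. lra. Qed.

Lemma Copp_self (z : C) : z = (- z)%C -> z = 0.
Proof.
intros H. apply injective_projections.
- apply (f_equal fst) in H. simpl in *. lra.
- apply (f_equal snd) in H. simpl in *. lra.
Qed.

Lemma Bern_odd N : Nat.Odd N -> (3 <= N)%nat -> Bern N = 0.
Proof.
intros HN H3. apply Copp_self.
rewrite <- appell_poly_at_0 at 1. rewrite (Bern_refl N 0), pow_m1_odd by exact HN.
rewrite Rminus_0_r, <- Bern_01, appell_poly_at_0 by lia. ring.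
Qed.

Lemma Bern_half N : Nat.Odd N -> appell_poly Bern N (RtoC (/ 2)) = 0.
Proof.
intros HN. apply Copp_self. rewrite (Bern_refl N (/ 2)) at 1. rewrite pow_m1_odd by exact HN.
replace (1 - / 2) with (/ 2) by lra. ring.
Qed.

(** The coefficients of [Delta_n] as an Appell polynomial in [Log w / (i pi)]. *)
Definition delta_coef (i : nat) : C := (RtoC (2 - 2 ^ i) * Bern i)%C.

Lemma delta_coef_0 : delta_coef 0 = 1.
Proof. unfold delta_coef, Bern. rewrite bernoulli_0. simpl. replace (2 - 1) with 1 by ring. ring. Qed.

Lemma delta_coef_odd i : Nat.Odd i -> delta_coef i = 0.
Proof.
intros H. unfold delta_coef. destruct (le_lt_dec 3 i) as [L|L].
- rewrite Bern_odd by assumption. ring.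
- replace i with 1%nat by (destruct H; lia). simpl (2 ^ 1).
  replace (2 - 2 * 1) with 0 by ring. ring.
Qed.

Lemma appell_poly_delta_coef N t : appell_poly delta_coef N (RtoC t) =
  (2 * appell_poly Bern N (RtoC t) - RtoC (2 ^ N) * appell_poly Bern N (RtoC (t / 2)))%C.
Proof.
unfold appell_poly. rewrite <- !csum_scal, <- csum_minus. apply csum_ext. intros i Hi.
unfold delta_coef. replace (2 ^ N) with (2 ^ i * 2 ^ (N - i)) by (rewrite <- pow_add; f_equal; lia).
unfold Rdiv. rewrite RtoC_mult, RtoC_mult, Cpow_mult_l, RtoC_minus.
rewrite <- (RtoC_pow (/ 2)), pow_inv, RtoC_inv by (apply pow_nonzero; lra).
field. apply RtoC_neq0, pow_nonzero. lra.
Qed.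

Lemma appell_poly_delta_coef_opp N t : appell_poly delta_coef N (RtoC (- t)) = (RtoC ((-1) ^ N) * appell_poly delta_coef N (RtoC t))%C.
Proof.
unfold appell_poly. rewrite <- csum_scal. apply csum_ext. intros i Hi.
destruct (Nat.Even_or_Odd i) as [[j E]|O].
- replace ((-1) ^ N) with ((-1) ^ (N - i)).
  + replace (- t) with (-1 * t) by ring. rewrite RtoC_mult, Cpow_mult_l, <- RtoC_pow. ring.
  + replace N with (2 * j + (N - i))%nat at 2 by lia. rewrite pow_add, pow_1_even. ring.
- rewrite delta_coef_odd by exact O. ring.
Qed.

(** In odd degree both values vanish, because the Bernoulli polynomial then
    vanishes at [0], [1/2] and [1]. *)
Lemma delta_coef_m1_1 N : (2 <= N)%nat -> appell_poly delta_coef N (RtoC (-1)) = appell_poly delta_coef N (RtoC 1).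
Proof.
intros HN. replace (-1) with (- (1)) by ring. rewrite appell_poly_delta_coef_opp.
destruct (Nat.Even_or_Odd N) as [[j E]|O].
- rewrite E, pow_1_even. ring.
- assert (H : appell_poly delta_coef N (RtoC 1) = 0).
  { rewrite appell_poly_delta_coef. replace (1 / 2) with (/ 2) by lra.
    rewrite Bern_half, <- Bern_01, appell_poly_at_0, Bern_odd by (auto; destruct O; lia). ring. }
  rewrite H. ring.
Qed.

(** The mean of the two half-scale translates is again an Appell sequence with
    equal values at [-1] and [1], so it is the original sequence; the point [0]
    gives the formula. *)
Lemma delta_coef_dup N : (appell_poly delta_coef N (RtoC (/ 2)) + appell_poly delta_coef N (RtoC (- / 2)))%C =
  (RtoC (2 * (/ 2) ^ N) * appell_poly delta_coef N 0)%C.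
Proof.
assert (A := appell_appell_poly delta_coef delta_coef_0).
assert (A1 := appell_scale _ 2 (/ 2) (/ 2) ltac:(lra) A ltac:(lra)).
assert (A2 := appell_scale _ 2 (- / 2) (/ 2) ltac:(lra) A ltac:(lra)). cbv beta in A1, A2.
set (g := fun (N : nat) (t : R) => (RtoC (/ 2) * (RtoC (2 ^ N) * appell_poly delta_coef N (RtoC (/ 2 * t + / 2)%R)
  + RtoC (2 ^ N) * appell_poly delta_coef N (RtoC (/ 2 * t + - / 2)%R)))%C).
assert (H2 : (RtoC (/ 2) * (1 + 1))%C = 1).
{ rewrite <- RtoC_plus, <- RtoC_mult. f_equal. lra. }
assert (Ag : appell g).
{ split.
  - intros t. unfold g. rewrite (proj1 A1 t), (proj1 A2 t). exact H2.
  - intros M t. unfold g. eapply Cder_eq.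
    + apply Cder_scal, Cder_plus; [apply (proj2 A1)|apply (proj2 A2)].
    + ring. }
assert (E := appell_unique _ _ (-1) 1 ltac:(lra) A Ag (fun M HM => delta_coef_m1_1 M HM)).
specialize (fun H => E H N 0). rewrite E.
- unfold g. rewrite !Rmult_0_r, !Rplus_0_l.
  set (x := appell_poly delta_coef N (RtoC (/ 2))). set (y := appell_poly delta_coef N (RtoC (- / 2))).
  replace (RtoC (2 * (/ 2) ^ N) * (RtoC (/ 2) * (RtoC (2 ^ N) * x + RtoC (2 ^ N) * y)))%C with
    ((RtoC (2 * (/ 2) ^ N) * RtoC (/ 2) * RtoC (2 ^ N)) * (x + y))%C by ring.
  rewrite <- !RtoC_mult. replace (2 * (/ 2) ^ N * / 2 * 2 ^ N) with 1.
  + ring.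
  + rewrite pow_inv. field. apply pow_nonzero. lra.
- intros M HM. unfold g.
  replace (/ 2 * -1 + / 2) with 0 by lra. replace (/ 2 * -1 + - / 2) with (-1) by lra.
  replace (/ 2 * 1 + / 2) with 1 by lra. replace (/ 2 * 1 + - / 2) with 0 by lra.
  rewrite delta_coef_m1_1 by exact HM. ring.
Qed.

(** * The singular polynomial in the logarithm *)

Definition i_pi : C := (Ci * RtoC PI)%C.

(** The coefficients of odd index vanish, so that this sum over all indices is
    the sum over even ones that defines [Delta_log]. *)
Definition delta_poly (n : nat) (u : C) : C :=
  (- / RtoC (INR (S n)) * appell_poly (fun i => delta_coef i * i_pi ^ i)%C (S n) u)%C.

Lemma INR_S_neq0 n : RtoC (INR (S n)) <> 0.
Proof. apply RtoC_neq0, not_0_INR. lia. Qed.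

Lemma Cder_delta_poly_0 g t m : Cder g t m -> Cder (fun t => delta_poly 0 (g t)) t (- m)%C.
Proof.
intros H. unfold delta_poly. eapply Cder_eq; [apply Cder_scal, Cder_appell_poly, H|].
rewrite appell_poly_0, delta_coef_0. simpl (_ ^ 0)%C. field. apply (INR_S_neq0 0).
Qed.

Lemma Cder_delta_poly_S n g t m : Cder g t m ->
  Cder (fun t => delta_poly (S n) (g t)) t (RtoC (INR (S n)) * delta_poly n (g t) * m)%C.
Proof.
intros H. unfold delta_poly. eapply Cder_eq; [apply Cder_scal, Cder_appell_poly, H|].
field. split; apply INR_S_neq0.
Qed.

Lemma delta_poly_dup n : (delta_poly n (i_pi * RtoC (/ 2)) + delta_poly n (i_pi * RtoC (- / 2)))%C =
  (RtoC ((/ 2) ^ n) * delta_poly n 0)%C.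
Proof.
unfold delta_poly. replace (RtoC 0) with (i_pi * 0)%C by ring. rewrite !appell_poly_scale.
pose proof (delta_coef_dup (S n)) as H.
replace (2 * (/ 2) ^ S n) with ((/ 2) ^ n) in H by (simpl; field).
replace (- / RtoC (INR (S n)) * (i_pi ^ S n * appell_poly delta_coef (S n) (RtoC (/ 2))) +
   - / RtoC (INR (S n)) * (i_pi ^ S n * appell_poly delta_coef (S n) (RtoC (- / 2))))%C with
  (- / RtoC (INR (S n)) * i_pi ^ S n * (appell_poly delta_coef (S n) (RtoC (/ 2)) + appell_poly delta_coef (S n) (RtoC (- / 2))))%C by ring.
rewrite H. ring.
Qed.

Lemma csum_even (a : nat -> C) : (forall i, Nat.Odd i -> a i = 0) ->
  forall M, csum a (S M) = csum (fun j => a (2 * j)%nat) (S (M / 2)).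
Proof.
intros H. induction M as [|M IH]; [reflexivity|].
rewrite csum_S, IH.
destruct (Nat.Even_or_Odd (S M)) as [[k E]|O].
- assert (E1 : (S M / 2 = k)%nat) by (rewrite E, Nat.mul_comm; apply Nat.div_mul; lia).
  assert (E2 : (M / 2 = k - 1)%nat).
  { replace M with (1 + (k - 1) * 2)%nat by lia. rewrite Nat.div_add by lia. simpl. lia. }
  rewrite E1, E2. replace (S (k - 1)) with k by lia. simpl csum. now rewrite E.
- rewrite (H _ O). destruct O as [k E].
  assert (E1 : (S M / 2 = k)%nat).
  { replace (S M) with (1 + k * 2)%nat by lia. rewrite Nat.div_add by lia. simpl. lia. }
  assert (E2 : (M / 2 = k)%nat).
  { replace M with (k * 2)%nat by lia. apply Nat.div_mul. lia. }
  rewrite E1, E2. ring.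
Qed.

Lemma sum_n_m_csum (f : nat -> C) M : sum_n_m (G := C_AbelianMonoid) f 1 M = csum (fun j => f (S j)) M.
Proof.
induction M as [|M IH].
- rewrite sum_n_m_zero by lia. reflexivity.
- rewrite sum_n_Sm by lia. rewrite IH. reflexivity.
Qed.

Lemma i_pi_even j : (i_pi ^ (2 * j))%C = RtoC ((-1) ^ j * PI ^ (2 * j)).
Proof.
rewrite Cpow_mult_r. replace (i_pi ^ 2)%C with (RtoC (-1 * PI ^ 2)).
- rewrite <- RtoC_pow. f_equal. rewrite Rpow_mult_distr, <- pow_mult. reflexivity.
- unfold i_pi, Ci. apply injective_projections; simpl; ring.
Qed.

Lemma Delta_log_delta_poly n w : Delta_log n w = delta_poly n (Log w).
Proof.
unfold Delta_log, delta_poly, appell_poly. rewrite (csum_even _), csum_first.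
2:{ intros i Hi. rewrite delta_coef_odd by exact Hi. ring. }
rewrite sum_n_m_csum, Nat.add_1_r.
replace (2 * 0)%nat with O by reflexivity.
rewrite binom_0, delta_coef_0, Nat.sub_0_r. simpl (i_pi ^ 0)%C.
rewrite Cmult_plus_distr_l. f_equal.
{ field. apply INR_S_neq0. }
rewrite <- !csum_scal. apply csum_ext. intros j Hj.
assert (Lj : (2 * S j <= S n)%nat).
{ pose proof (Nat.Div0.mul_div_le (S n) 2). lia. }
rewrite i_pi_even. unfold delta_coef, Bern.
replace (n + 1 - 2 * S j)%nat with (S n - 2 * S j)%nat by lia.
set (L := (Log w ^ (S n - 2 * S j))%C).
rewrite !Cmult_assoc. f_equal.
rewrite <- RtoC_inv by (apply not_0_INR; lia). rewrite <- RtoC_opp, <- !RtoC_mult. f_equal.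
unfold Binomial.C. rewrite fact_simpl, mult_INR.
replace (2 ^ (2 * S j)) with (2 * 2 ^ (2 * S j - 1)).
2:{ replace (2 * S j)%nat with (S (2 * S j - 1)) at 2 by lia. reflexivity. }
field. repeat split; try apply INR_fact_neq_0. apply not_0_INR; lia.
Qed.

(** * Improper integrals at the origin *)

(** The improper integral over [(0, r]], with explicit bounds; [Int0_gen] returns
    to filters. *)
Definition Int0 (f : R -> C) (r : R) (v : C) : Prop :=
  forall eps, 0 < eps -> exists d, 0 < d /\ forall e, 0 < e < d ->
    exists y : C, CInt f e r y /\ Cmod (y - v) < eps.

Lemma Int0_gen f r v : Int0 f r v ->
  is_RInt_gen (V := C_R_NormedModule) f (at_right 0) (at_point r) v.
Proof.
intros H P [eps HP]. destruct (H eps (cond_pos eps)) as (d & Hd & K).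
exists (fun e => 0 < e < d) (fun x => x = r).
- now apply (at_right_intro _ d).
- reflexivity.
- intros e x He ->. destruct (K e He) as (y & I & L). exists y. split; [exact I|].
  apply HP. now apply C_NormedModule_mixin_compat1.
Qed.

Lemma Int0_unique f r v v' : Int0 f r v -> Int0 f r v' -> v = v'.
Proof.
intros H H'. apply (is_RInt_gen_C_unique f (at_right 0) (at_point r)).
- apply Proper_StrongProper, at_right_proper_filter.
- apply Proper_StrongProper, at_point_filter.
- now apply Int0_gen.
- now apply Int0_gen.
Qed.

Lemma Int0_plus f g r v u : Int0 f r v -> Int0 g r u -> Int0 (fun t => f t + g t)%C r (v + u)%C.
Proof.
intros Hf Hg eps He.
destruct (Hf (eps / 2) ltac:(lra)) as (d1 & Hd1 & H1).
destruct (Hg (eps / 2) ltac:(lra)) as (d2 & Hd2 & H2).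
exists (Rmin d1 d2). split; [now apply Rmin_glb_lt|]. intros e [E0 E1]. apply Rlt_min in E1.
destruct (H1 e ltac:(lra)) as (y1 & I1 & L1). destruct (H2 e ltac:(lra)) as (y2 & I2 & L2).
exists (y1 + y2)%C. split; [now apply CInt_plus|].
replace (y1 + y2 - (v + u))%C with ((y1 - v) + (y2 - u))%C by ring.
refine (Rle_lt_trans _ _ _ (Cmod_triangle _ _) _). lra.
Qed.

Lemma Int0_scal f r v c : Int0 f r v -> Int0 (fun t => c * f t)%C r (c * v)%C.
Proof.
intros Hf eps He. pose proof (Cmod_ge_0 c).
destruct (Hf (eps / (Cmod c + 1))) as (d & Hd & H1); [apply Rdiv_lt_0_compat; lra|].
exists d. split; [exact Hd|]. intros e E. destruct (H1 e E) as (y & I & L).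
exists (c * y)%C. split; [now apply CInt_scal|].
replace (c * y - c * v)%C with (c * (y - v))%C by ring. rewrite Cmod_mult.
apply Rlt_div_inv in L; [|lra].
pose proof (Cmod_ge_0 (y - v)). nra.
Qed.

Lemma Int0_minus f g r v u : Int0 f r v -> Int0 g r u -> Int0 (fun t => f t - g t)%C r (v - u)%C.
Proof.
intros Hf Hg. replace (v - u)%C with (v + (-1) * u)%C by ring.
intros eps He. destruct (Int0_plus _ _ _ _ _ Hf (Int0_scal _ _ _ (-1) Hg) eps He) as (d & Hd & H).
exists d. split; [exact Hd|]. intros e E. destruct (H e E) as (y & I & L). exists y. split; [|exact L].
eapply CInt_ext; [|exact I]. intros x _. cbv beta. ring.
Qed.

Lemma Int0_ext f g r v : 0 < r -> (forall t, 0 < t < r -> f t = g t) -> Int0 f r v -> Int0 g r v.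
Proof.
intros Hr H Hf eps He. destruct (Hf eps He) as (d & Hd & K).
exists (Rmin d r). split; [now apply Rmin_glb_lt|]. intros e [E0 E1].
apply Rlt_min in E1.
destruct (K e) as (y & I & L); [lra|]. exists y. split; [|exact L].
eapply CInt_ext; [|exact I]. intros x Hx. rewrite Rmin_left, Rmax_right in Hx by lra. apply H. lra.
Qed.

Lemma Int0_csum (a : nat -> R -> C) (b : nat -> C) r :
  (forall m, Int0 (a m) r (b m)) -> forall N, Int0 (fun t => csum (fun m => a m t) N) r (csum b N).
Proof.
intros H. induction N as [|N IH]; simpl.
- intros eps He. exists 1. split; [lra|]. intros e _. exists 0. split.
  + assert (I := CInt_const 0 e r). replace (RtoC (r - e) * 0)%C with (RtoC 0) in I by ring. exact I.
  + replace (0 - 0)%C with (RtoC 0) by ring. now rewrite Cmod_0.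
- now apply Int0_plus.
Qed.

Lemma Int0_derive (G g : R -> C) r G0 : 0 < r ->
  (forall t, 0 < t <= r -> Cder G t (g t)) -> (forall t, 0 < t <= r -> Ccont g t) ->
  (forall eps, 0 < eps -> exists d, 0 < d /\ forall e, 0 < e < d -> Cmod (G e - G0) < eps) ->
  Int0 g r (G r - G0)%C.
Proof.
intros Hr HD HC HG eps He. destruct (HG eps He) as (d & Hd & H).
exists (Rmin d r). split; [now apply Rmin_glb_lt|]. intros e [E0 E1].
apply Rlt_min in E1.
exists (G r - G e)%C. split.
- apply CInt_derive; intros x Hx; rewrite Rmin_left, Rmax_right in Hx by lra; [apply HD|apply HC]; lra.
- rewrite <- Cmod_opp. replace (- (G r - G e - (G r - G0)))%C with (G e - G0)%C by ring. apply H. lra.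
Qed.

Lemma sqrt_int B e r : 0 < e <= r -> is_RInt (fun t => B / sqrt t) e r (2 * B * (sqrt r - sqrt e)).
Proof.
intros H.
replace (2 * B * (sqrt r - sqrt e)) with (minus (2 * B * sqrt r) (2 * B * sqrt e))
  by (unfold minus, plus, opp; simpl; ring).
apply (is_RInt_derive (fun t => 2 * B * sqrt t)); intros x Hx; rewrite Rmin_left, Rmax_right in Hx by lra.
- pose proof (sqrt_lt_R0 x ltac:(lra)). auto_derive; [lra|]. field. lra.
- apply (ex_derive_continuous (fun t => B / sqrt t)).
  pose proof (sqrt_lt_R0 x ltac:(lra)). auto_derive. repeat split; lra.
Qed.

Lemma C_cauchy {T} (F : (T -> Prop) -> Prop) {FF : ProperFilter F} (f : T -> C) :
  (forall eps, 0 < eps -> exists P, F P /\ forall u v, P u -> P v -> Cmod (f v - f u) < eps) ->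
  exists y : C, filterlim f F (locally y).
Proof.
intros H. apply (filterlim_locally_cauchy (U := C_CompleteNormedModule)).
intros eps. destruct (H eps (cond_pos eps)) as (P & HP & K).
exists P. split; [exact HP|]. intros u v Hu Hv. apply C_NormedModule_mixin_compat1. now apply K.
Qed.

(** The majorant [t^(-1/2)] is integrable at the origin and dominates every power
    of the logarithm. *)
Lemma Int0_ex f B r : 0 < r -> (forall t, 0 < t <= r -> Ccont f t) ->
  (forall t, 0 < t <= r -> Cmod (f t) <= B / sqrt t) -> exists v, Int0 f r v.
Proof.
intros Hr HC HB.
assert (B0 : 0 <= B).
{ specialize (HB r ltac:(lra)). pose proof (Cmod_ge_0 (f r)). pose proof (sqrt_lt_R0 r Hr).
  destruct (Rle_lt_dec 0 B) as [|L]; [assumption|].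
  assert (B / sqrt r < 0) by (apply Rdiv_neg_pos; lra). lra. }
set (I := fun e => CRInt f e r).
assert (HI : forall e, 0 < e <= r -> CInt f e r (I e)).
{ intros e He. apply CRInt_correct.
  intros x Hx. rewrite Rmin_left, Rmax_right in Hx by lra. apply HC. lra. }
assert (K : forall e e', 0 < e -> e <= e' <= r -> Cmod (I e - I e') <= 2 * B * sqrt e').
{ intros e e' He Hee.
  assert (J : CInt f e e' (I e - I e')%C).
  { exact (CInt_Chasles _ _ _ _ _ _ (HI e ltac:(lra)) (CInt_swap _ _ _ _ (HI e' ltac:(lra)))). }
  refine (Rle_trans _ _ _ (CInt_bound _ _ _ _ _ _ (proj1 Hee) _ J (sqrt_int B e e' ltac:(lra))) _).
  - intros x Hx. apply HB. lra.
  - pose proof (sqrt_pos e). nra. }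
destruct (C_cauchy (at_right 0) I) as [v Hv].
{ intros eps He. set (s := eps / (4 * (B + 1))).
  assert (Hs : 0 < s) by (apply Rdiv_lt_0_compat; lra).
  set (d := Rmin r (s * s)).
  assert (Hd : 0 < d) by (apply Rmin_glb_lt; nra).
  exists (fun e => 0 < e < d). split.
  { now apply (at_right_intro _ d). }
  assert (W : forall e e', 0 < e -> e <= e' < d -> Cmod (I e - I e') < eps).
  { intros e e' E0 E1. destruct E1 as [E1 E2]. apply Rlt_min in E2.
    refine (Rle_lt_trans _ _ _ (K e e' E0 ltac:(lra)) _).
    assert (sqrt e' <= s).
    { rewrite <- (sqrt_square s) by lra. apply sqrt_le_1_alt. lra. }
    assert (E : s * (4 * (B + 1)) = eps) by (unfold s; field; lra). nra. }
  intros u v Hu Hv. destruct (Rle_dec u v).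
  - rewrite <- Cmod_opp. replace (- (I v - I u))%C with (I u - I v)%C by ring. apply W; lra.
  - apply W; lra. }
exists v. intros eps He. apply (Clim_iff (at_right 0) I v) with (eps := eps) in Hv; [|exact He].
apply at_right_elim in Hv. destruct Hv as (d & Hd0 & Hd).
exists (Rmin d r). split; [now apply Rmin_glb_lt|].
intros e [E0 E1].
apply Rlt_min in E1.
exists (I e). split; [apply HI; lra|]. apply Hd; lra.
Qed.

Lemma Int0_bound f B r v : 0 < r -> (forall t, 0 < t <= r -> Cmod (f t) <= B / sqrt t) ->
  Int0 f r v -> Cmod v <= 2 * B * sqrt r.
Proof.
intros Hr HB Hv.
assert (B0 : 0 <= B).
{ specialize (HB r ltac:(lra)). pose proof (Cmod_ge_0 (f r)). pose proof (sqrt_lt_R0 r Hr).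
  destruct (Rle_lt_dec 0 B) as [|L]; [assumption|].
  assert (B / sqrt r < 0) by (apply Rdiv_neg_pos; lra). lra. }
apply Rnot_lt_le. intros L.
destruct (Hv (Cmod v - 2 * B * sqrt r) ltac:(lra)) as (d & Hd & H).
set (e := Rmin d r / 2).
assert (0 < Rmin d r) by now apply Rmin_glb_lt.
assert (e < d) by (unfold e; pose proof (Rmin_l d r); lra).
assert (e < r) by (unfold e; pose proof (Rmin_r d r); lra).
destruct (H e) as (y & I & Ly); [unfold e in *; lra|].
assert (Y : Cmod y <= 2 * B * (sqrt r - sqrt e)).
{ refine (CInt_bound _ _ _ _ _ _ _ _ I (sqrt_int B e r _)); try (unfold e in *; lra).
  intros x Hx. apply HB. unfold e in *; lra. }
pose proof (Cmod_triangle y (- (y - v))) as T. replace (y + - (y - v))%C with v in T by ring.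
rewrite Cmod_opp in T. pose proof (sqrt_pos e). nra.
Qed.

Lemma exp_nat_mult x n : exp x ^ n = exp (INR n * x).
Proof.
induction n as [|n IH]; [simpl; now rewrite Rmult_0_l, exp_0|].
rewrite S_INR. simpl. rewrite IH, <- exp_plus. f_equal. ring.
Qed.

Lemma pow_exp_bound n c : 0 < c -> exists K, 0 < K /\ forall x, Rabs x ^ n <= K * exp (c * Rabs x).
Proof.
intros Hc. destruct n as [|n].
- exists 1. split; [lra|]. intros x. simpl. rewrite Rmult_1_l.
  pose proof (Rabs_pos x). destruct (Req_dec (c * Rabs x) 0) as [->|N]; [rewrite exp_0; lra|].
  pose proof (exp_ineq1 (c * Rabs x) N). assert (0 <= c * Rabs x) by nra. lra.
- set (m := INR (S n)). assert (Hm : 0 < m) by (apply lt_0_INR; lia).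
  exists ((m / c) ^ S n). split; [apply pow_lt, Rdiv_lt_0_compat; lra|]. intros x.
  pose proof (Rabs_pos x) as P.
  replace (exp (c * Rabs x)) with (exp (c / m * Rabs x) ^ S n).
  + rewrite <- Rpow_mult_distr. apply pow_incr. split; [exact P|].
    assert (E : c / m * Rabs x <= exp (c / m * Rabs x)).
    { destruct (Req_dec (c / m * Rabs x) 0) as [E|N]; [rewrite E, exp_0; lra|].
      pose proof (exp_ineq1 _ N). lra. }
    apply (Rmult_le_compat_l (m / c)) in E; [|left; apply Rdiv_lt_0_compat; lra].
    replace (m / c * (c / m * Rabs x)) with (Rabs x) in E by (field; lra). exact E.
  + rewrite exp_nat_mult. fold m. f_equal. field. lra.
Qed.

Lemma sqrt_exp t : 0 < t -> sqrt t = exp (ln t / 2).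
Proof.
intros Ht. apply sqrt_lem_1; [lra|left; apply exp_pos|].
rewrite <- exp_plus. replace (ln t / 2 + ln t / 2) with (ln t) by field. now apply exp_ln.
Qed.

Lemma ln_pow_bound n r : 0 < r -> exists K, 0 < K /\
  forall t, 0 < t <= r -> Cmod (RtoC (ln t ^ n)) <= K / sqrt t.
Proof.
intros Hr. destruct (pow_exp_bound n (/ 2)) as (K & HK & H); [lra|].
exists (K * Rmax 1 r). split; [apply Rmult_lt_0_compat; [exact HK|]; pose proof (Rmax_l 1 r); lra|].
intros t Ht. rewrite Cmod_R, <- RPow_abs. refine (Rle_trans _ _ _ (H (ln t)) _).
unfold Rdiv. rewrite Rmult_assoc. apply Rmult_le_compat_l; [lra|].
rewrite sqrt_exp, <- exp_Ropp by lra.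
pose proof (exp_pos (- (ln t / 2))) as P.
destruct (Rle_lt_dec (ln t) 0) as [L|L].
- rewrite Rabs_left1 by exact L. replace (/ 2 * - ln t) with (- (ln t / 2)) by lra.
  pose proof (Rmax_l 1 r). nra.
- rewrite Rabs_pos_eq by lra. replace (/ 2 * ln t) with (ln t + - (ln t / 2)) by lra.
  rewrite exp_plus, exp_ln by lra. apply Rmult_le_compat_r; [lra|].
  pose proof (Rmax_r 1 r). lra.
Qed.

Lemma Cder_ln_pow n t : 0 < t ->
  Cder (fun t => RtoC (ln t ^ n)) t (RtoC (INR n * ln t ^ (n - 1) / t)).
Proof.
intros Ht. apply Cder_RtoC. rewrite Nat.sub_1_r. auto_derive; [exact Ht|]. field. lra.
Qed.

(** * The integral of a power of the logarithm against the Stieltjes kernel *)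

(** The kernel [1/(w+t)] is bounded on the half-line, which holds exactly when
    [w] is off the cut. *)
Definition off_cut (w : C) : Prop :=
  exists c, 0 < c /\ forall t, 0 <= t -> c <= Cmod (w + RtoC t).

Lemma off_cut_re w : 0 < Re w -> off_cut w.
Proof.
intros L. exists (Re w). split; [exact L|]. intros t Ht.
refine (Rle_trans _ _ _ _ (re_le_Cmod (w + RtoC t))).
change (Re w <= Rabs (Re w + t)). rewrite Rabs_pos_eq; lra.
Qed.

Lemma off_cut_im w : Im w <> 0 -> off_cut w.
Proof.
intros N. exists (Rabs (Im w)). split; [now apply Rabs_pos_lt|]. intros t _.
refine (Rle_trans _ _ _ _ (Rmax_Cmod (w + RtoC t)%C)).
refine (Rle_trans _ _ _ _ (Rmax_r _ _)).
change (Rabs (Im w) <= Rabs (Im w + 0)). rewrite Rplus_0_r. lra.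
Qed.

Lemma off_cut_Cexp u : Rabs (Im u) < PI -> off_cut (Cexp u).
Proof.
intros Hu. destruct (Rlt_le_dec 0 (Re (Cexp u))) as [L|L]; [now apply off_cut_re|].
apply off_cut_im. unfold Cexp in *; simpl in *. pose proof (exp_pos (Re u)) as P. intros E.
apply Rmult_integral in E. destruct E as [E|E]; [lra|].
assert (Z : Im u = 0).
{ apply Rabs_def2 in Hu. destruct (Rtotal_order (Im u) 0) as [Q|[Q|Q]]; [|exact Q|].
  - pose proof (sin_lt_0_var (Im u) ltac:(lra) Q). lra.
  - pose proof (sin_gt_0 (Im u) Q ltac:(lra)). lra. }
rewrite Z, cos_0 in L. lra.
Qed.

Lemma off_cut_slit w : slit_plane w -> off_cut w.
Proof.
intros [H0 H]. rewrite <- (Cexp_Log w H0). apply off_cut_Cexp. exact H.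
Qed.

Lemma off_cut_neq w t : off_cut w -> 0 <= t -> (w + RtoC t)%C <> 0.
Proof. intros (c & Hc & H) Ht E. specialize (H t Ht). rewrite E, Cmod_0 in H. lra. Qed.

Lemma Cder_inv_wt w t : (w + RtoC t)%C <> 0 ->
  Cder (fun t => / (w + RtoC t))%C t (- (1) / ((w + RtoC t) * (w + RtoC t)))%C.
Proof.
intros H. apply Cder_inv; [|exact H].
eapply Cder_eq; [apply Cder_plus; [apply Cder_const|apply Cder_id]|]. ring.
Qed.

Lemma Int0_ln_ex n r (q : R -> C) B : 0 < r -> (forall t, 0 < t <= r -> Ccont q t) ->
  (forall t, 0 < t <= r -> Cmod (q t) <= B) ->
  exists v, Int0 (fun t => RtoC (ln t ^ n) * q t)%C r v.
Proof.
intros Hr Hq HB. destruct (ln_pow_bound n r Hr) as (K & HK & H).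
apply (Int0_ex _ (K * B)); [exact Hr| |].
- intros t Ht. apply Ccont_mult; [|now apply Hq]. eapply Cder_cont, Cder_ln_pow. lra.
- intros t Ht. rewrite Cmod_mult. replace (K * B / sqrt t) with (K / sqrt t * B) by (unfold Rdiv; ring).
  apply Rmult_le_compat; try apply Cmod_ge_0; auto.
Qed.

Lemma Int0_ln_bound n r : 0 < r -> exists K, 0 < K /\ forall (q : R -> C) B v,
  (forall t, 0 < t <= r -> Cmod (q t) <= B) ->
  Int0 (fun t => RtoC (ln t ^ n) * q t)%C r v -> Cmod v <= K * B.
Proof.
intros Hr. destruct (ln_pow_bound n r Hr) as (K & HK & H). pose proof (sqrt_lt_R0 r Hr) as S.
exists (2 * K * sqrt r). split; [nra|]. intros q B v HB Hv.
replace (2 * K * sqrt r * B) with (2 * (K * B) * sqrt r) by ring.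
refine (Int0_bound _ _ _ _ Hr _ Hv). intros t Ht.
rewrite Cmod_mult. replace (K * B / sqrt t) with (K / sqrt t * B) by (unfold Rdiv; ring).
apply Rmult_le_compat; try apply Cmod_ge_0; auto.
Qed.

(** The value is meaningful only for [w] off the cut. *)
Definition log_stieltjes (n : nat) (r : R) (w : C) : C :=
  iota (T := C_CompleteNormedModule)
    (fun v => Int0 (fun t => RtoC (ln t ^ n) * / (w + RtoC t))%C r v).

Lemma log_stieltjes_correct n r w : 0 < r -> off_cut w ->
  Int0 (fun t => RtoC (ln t ^ n) * / (w + RtoC t))%C r (log_stieltjes n r w).
Proof.
intros Hr Hw. destruct (Int0_ln_ex n r (fun t => / (w + RtoC t))%C (/ proj1_sig (constructive_indefinite_description _ Hw)) Hr) as [v Hv].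
- intros t Ht. eapply Cder_cont, Cder_inv_wt, off_cut_neq; [exact Hw|lra].
- intros t Ht. destruct constructive_indefinite_description as (c & Hc & H). simpl.
  rewrite Cmod_inv by (apply off_cut_neq; [exact Hw|lra]).
  apply Rinv_le_contravar; [exact Hc|apply H; lra].
- unfold log_stieltjes. rewrite (iota_unique (V := C_CompleteNormedModule) _ v); [exact Hv| |exact Hv].
  intros y Hy. exact (Int0_unique _ _ _ _ Hy Hv).
Qed.

(** After differentiation under the integral, the function
    [ln^n t * t/(w+t)] is integrated by parts: its derivative is
    [n ln^(n-1) t/(w+t) + w ln^n t/(w+t)^2]. *)
Lemma log_stieltjes_cdiff n r w : 0 < r -> off_cut w -> exists l, cdiff (log_stieltjes n r) w l /\
  (w * l)%C = (RtoC (INR n) * log_stieltjes (n - 1) r w - RtoC (ln r ^ n) * (RtoC r / (w + RtoC r)))%C.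
Proof.
intros Hr Hw. assert (Hw' := Hw). destruct Hw' as (c & Hc & H).
assert (N : forall t, 0 <= t -> (w + RtoC t)%C <> 0) by (intros; now apply off_cut_neq).
set (q2 := fun t => (/ (w + RtoC t) * / (w + RtoC t))%C).
assert (B : forall t, 0 <= t -> Cmod (/ (w + RtoC t)) <= / c).
{ intros t Ht. rewrite Cmod_inv by auto. apply Rinv_le_contravar; auto. }
assert (c0 : 0 < / c) by now apply Rinv_0_lt_compat.
assert (C1 : forall t, 0 <= t -> Ccont (fun t => / (w + RtoC t))%C t).
{ intros t Ht. eapply Cder_cont, Cder_inv_wt. auto. }
destruct (Int0_ln_ex n r q2 (/ c * / c) Hr) as [l Hl].
{ intros t Ht. apply Ccont_mult; apply C1; lra. }
{ intros t Ht. unfold q2. rewrite Cmod_mult. apply Rmult_le_compat; try apply Cmod_ge_0; apply B; lra. }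
destruct (Int0_ln_bound n r Hr) as (K & HK & HB).
exists (- l)%C. split.
- exists (K * (/ c * / c * / (c / 2))), (c / 2).
  assert (c2 : 0 < / (c / 2)) by (apply Rinv_0_lt_compat; lra).
  split; [repeat apply Rmult_le_pos; lra|split; [lra|]].
  intros w' Hw'.
  assert (H' : forall t, 0 <= t -> c / 2 <= Cmod (w' + RtoC t)).
  { intros t Ht. specialize (H t Ht).
    pose proof (Cmod_triangle (w' + RtoC t) (- (w' - w))) as T.
    replace (w' + RtoC t + - (w' - w))%C with (w + RtoC t)%C in T by ring.
    rewrite Cmod_opp in T. lra. }
  assert (A' : off_cut w') by (exists (c / 2); split; [lra|exact H']).
  assert (N' : forall t, 0 <= t -> (w' + RtoC t)%C <> 0) by (intros; now apply off_cut_neq).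
  assert (I := Int0_plus _ _ _ _ _ (Int0_minus _ _ _ _ _ (log_stieltjes_correct n r w' Hr A') (log_stieltjes_correct n r w Hr Hw))
     (Int0_scal _ _ _ (w' - w)%C Hl)).
  replace (log_stieltjes n r w' - log_stieltjes n r w - (w' - w) * - l)%C with
    (log_stieltjes n r w' - log_stieltjes n r w + (w' - w) * l)%C by ring.
  replace (K * (/ c * / c * / (c / 2)) * Cmod (w' - w) ^ 2)
    with (K * (/ c * / c * / (c / 2) * Cmod (w' - w) ^ 2)) by ring.
  apply (HB (fun t => q2 t * / (w' + RtoC t) * ((w' - w) * (w' - w)))%C).
  + intros t Ht. rewrite !Cmod_mult. replace (Cmod (w' - w) ^ 2) with (Cmod (w' - w) * Cmod (w' - w)) by ring.
    apply Rmult_le_compat_r; [apply Rmult_le_pos; apply Cmod_ge_0|].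
    unfold q2. rewrite Cmod_mult.
    apply Rmult_le_compat; [apply Rmult_le_pos; apply Cmod_ge_0|apply Cmod_ge_0| |].
    * apply Rmult_le_compat; try apply Cmod_ge_0; apply B; lra.
    * rewrite Cmod_inv by (apply N'; lra). apply Rinv_le_contravar; [lra|apply H'; lra].
  + eapply Int0_ext; [exact Hr| |exact I]. intros t Ht. cbv beta. unfold q2.
    field. split; [apply N'; lra|apply N; lra].
- destruct (ln_pow_bound n r Hr) as (K1 & HK1 & L1).
  set (G := fun t => (RtoC (ln t ^ n) * (RtoC t * / (w + RtoC t)))%C).
  assert (IG : Int0 (fun t => RtoC (INR n) * (RtoC (ln t ^ (n - 1)) * / (w + RtoC t)) +
       w * (RtoC (ln t ^ n) * q2 t))%C r (G r - 0)%C).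
  { apply Int0_derive; [exact Hr| | |].
    - intros t Ht. unfold G. eapply Cder_eq.
      + apply Cder_mult; [apply Cder_ln_pow; lra|].
        apply Cder_mult; [apply Cder_id|apply Cder_inv_wt, N; lra].
      + unfold q2, Rdiv. rewrite !RtoC_mult, RtoC_inv by lra.
        field. split; [apply N; lra|apply RtoC_neq0; lra].
    - intros t Ht. eapply Cder_cont.
      apply Cder_plus; apply Cder_scal; (apply Cder_mult; [apply Cder_ln_pow; lra|]).
      + apply Cder_inv_wt, N; lra.
      + apply Cder_mult; apply Cder_inv_wt, N; lra.
    - intros eps He.
      set (s := eps * c / (2 * K1)).
      assert (Hs : 0 < s) by (apply Rdiv_lt_0_compat; nra).
      exists (Rmin r (s * s)). split; [apply Rmin_glb_lt; nra|]. intros e [E0 E1].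
      apply Rlt_min in E1.
      replace (G e - 0)%C with (G e) by ring. unfold G. rewrite !Cmod_mult.
      assert (S0 : 0 < sqrt e) by (apply sqrt_lt_R0; lra).
      assert (S1 : sqrt e <= s).
      { rewrite <- (sqrt_square s) by lra. apply sqrt_le_1_alt. lra. }
      rewrite (Cmod_R e), (Rabs_pos_eq e) by lra.
      apply Rle_lt_trans with (K1 / sqrt e * (e * / c)).
      + apply Rmult_le_compat; [apply Cmod_ge_0| |apply L1; lra|].
        * apply Rmult_le_pos; [lra|apply Cmod_ge_0].
        * apply Rmult_le_compat_l; [lra|apply B; lra].
      + rewrite <- (sqrt_sqrt e) at 2 by lra.
        replace (K1 / sqrt e * (sqrt e * sqrt e * / c)) with (K1 * / c * sqrt e) by (field; lra).
        apply Rle_lt_trans with (K1 * / c * s); [apply Rmult_le_compat_l; nra|].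
        unfold s. replace (K1 * / c * (eps * c / (2 * K1))) with (eps / 2) by (field; lra). lra. }
  assert (IS := Int0_plus _ _ _ _ _ (Int0_scal _ _ _ (RtoC (INR n)) (log_stieltjes_correct (n - 1) r w Hr Hw))
    (Int0_scal _ _ _ w Hl)).
  assert (E := Int0_unique _ _ _ _ IG IS). unfold G in E.
  replace (w * - l)%C with (RtoC (INR n) * log_stieltjes (n - 1) r w -
    (RtoC (INR n) * log_stieltjes (n - 1) r w + w * l))%C by ring.
  rewrite <- E. unfold Cdiv. ring.
Qed.

(** * Finite parts of powers of the logarithm *)

(** An antiderivative of [ln^n t / t^(i+1)] made of terms that diverge at the
    origin, so that its value at [r] is the finite part over [(0, r]]. *)
Fixpoint fp_log (n i : nat) (t : R) : R :=
  match i with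
  | O => ln t ^ (S n) / INR (S n)
  | S _ =>
    match n with
    | O => - / (INR i * t ^ i)
    | S p => (INR n * fp_log p i t - ln t ^ n / t ^ i) / INR i
    end
  end.

Lemma Rder_inv_pow i t : 0 < t -> is_derive (fun t => / t ^ i) t (- INR i / t ^ (S i)).
Proof.
intros Ht. assert (P : is_derive (fun t => t ^ i) t (INR i * t ^ (i - 1))).
{ rewrite Nat.sub_1_r. auto_derive; [exact I|ring]. }
assert (Q : t ^ i <> 0) by (apply pow_nonzero; lra).
evar_last; [exact (is_derive_inv _ t _ P Q)|].
destruct i as [|i]; [simpl; field; lra|].
simpl (S i - 1)%nat. rewrite Nat.sub_0_r. simpl (_ ^ S _) in *. field.
split; [|lra]. intros E; apply Q; rewrite E; ring.
Qed.

Lemma Rder_ln_pow n t : 0 < t -> is_derive (fun t => ln t ^ n) t (INR n * ln t ^ (n - 1) / t).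
Proof. intros Ht. rewrite Nat.sub_1_r. auto_derive; [exact Ht|]. field. lra. Qed.

Lemma fp_log_der n i t : 0 < t -> is_derive (fp_log n i) t (ln t ^ n / t ^ (S i)).
Proof.
intros Ht. destruct i as [|i].
- apply (is_derive_ext (fun t => / INR (S n) * ln t ^ (S n))).
  { intros u. destruct n; unfold fp_log, Rdiv; apply Rmult_comm. }
  evar_last; [apply is_derive_scal, Rder_ln_pow, Ht|].
  simpl (S n - 1)%nat. rewrite Nat.sub_0_r, pow_1. field.
  split; [lra|apply not_0_INR; lia].
- assert (Ii : INR (S i) <> 0) by (apply not_0_INR; lia).
  assert (Q : t ^ S i <> 0) by (apply pow_nonzero; lra).
  assert (Q0 : t ^ i <> 0) by (apply pow_nonzero; lra).
  induction n as [|n IH].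
  + apply (is_derive_ext (fun t => - / INR (S i) * / t ^ S i)).
    { intros u. change (- / INR (S i) * / u ^ S i = - / (INR (S i) * u ^ S i)). rewrite Rinv_mult. ring. }
    evar_last; [apply is_derive_scal, Rder_inv_pow, Ht|].
    simpl (ln t ^ 0). simpl (_ ^ S _). field. repeat split; auto; lra.
  + apply (is_derive_ext (fun t => / INR (S i) * (INR (S n) * fp_log n (S i) t - ln t ^ S n * / t ^ S i))).
    { intros u. change (/ INR (S i) * (INR (S n) * fp_log n (S i) u - ln u ^ S n * / u ^ S i) =
        (INR (S n) * fp_log n (S i) u - ln u ^ S n / u ^ S i) / INR (S i)).
      unfold Rdiv. ring. }
    evar_last.
    * apply is_derive_scal. apply (is_derive_minus (V := R_NormedModule)).
      -- apply is_derive_scal. exact IH.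
      -- apply Rder_mult; [apply Rder_ln_pow, Ht|apply Rder_inv_pow, Ht].
    * unfold minus, plus, opp; cbn -[pow INR Nat.sub]. replace (S n - 1)%nat with n by lia.
      simpl (_ ^ S _). field. repeat split; auto; lra.
Qed.

Lemma fp_log_rec n i t : 0 < t -> (1 <= n + i)%nat ->
  INR i * fp_log n i t = INR n * fp_log (n - 1) i t - ln t ^ n / t ^ i.
Proof.
intros Ht H. destruct i as [|i].
- destruct n as [|n]; [lia|]. simpl (S n - 1)%nat. rewrite Nat.sub_0_r.
  replace (fp_log n 0 t) with (ln t ^ S n / INR (S n)) by now destruct n.
  simpl (INR 0). simpl (t ^ 0). field. apply not_0_INR; lia.
- assert (Ii : INR (S i) <> 0) by (apply not_0_INR; lia).
  destruct n as [|n].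
  + change (fp_log 0 (S i) t) with (- / (INR (S i) * t ^ S i)). rewrite Rinv_mult.
    simpl (INR 0). simpl (ln t ^ 0). unfold Rdiv. rewrite Rmult_0_l.
    rewrite Ropp_mult_distr_l, <- Rmult_assoc, Ropp_mult_distr_r_reverse, Rinv_r by exact Ii. ring.
  + simpl (S n - 1)%nat. rewrite Nat.sub_0_r.
    change (fp_log (S n) (S i) t) with ((INR (S n) * fp_log n (S i) t - ln t ^ S n / t ^ S i) / INR (S i)).
    field. split; [apply pow_nonzero; lra|exact Ii].
Qed.

Lemma fp_log_bound n t : 0 < t -> exists K, forall i, Rabs (fp_log n i t) * t ^ i <= K.
Proof.
intros Ht. induction n as [|n [K IH]].
- exists (Rmax (Rabs (fp_log 0 0 t)) 1). intros [|i].
  + simpl (t ^ 0). rewrite Rmult_1_r. apply Rmax_l.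
  + refine (Rle_trans _ _ _ _ (Rmax_r _ _)).
    change (fp_log 0 (S i) t) with (- / (INR (S i) * t ^ S i)).
    assert (P : 0 < t ^ S i) by now apply pow_lt.
    assert (I : 1 <= INR (S i)) by (rewrite S_INR; pose proof (pos_INR i); lra).
    assert (I' : 0 < / INR (S i)) by (apply Rinv_0_lt_compat; lra).
    rewrite Rabs_Ropp, Rabs_pos_eq, Rinv_mult, Rmult_assoc, Rinv_l, Rmult_1_r by
      (try (left; apply Rinv_0_lt_compat, Rmult_lt_0_compat); lra).
    rewrite <- Rinv_1. apply Rinv_le_contravar; lra.
- exists (Rmax (Rabs (fp_log (S n) 0 t)) (INR (S n) * K + Rabs (ln t ^ S n))). intros [|i].
  + simpl (t ^ 0). rewrite Rmult_1_r. apply Rmax_l.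
  + refine (Rle_trans _ _ _ _ (Rmax_r _ _)).
    change (fp_log (S n) (S i) t) with ((INR (S n) * fp_log n (S i) t - ln t ^ S n / t ^ S i) / INR (S i)).
    specialize (IH (S i)).
    assert (P : 0 < t ^ S i) by now apply pow_lt.
    assert (I : 1 <= INR (S i)) by (rewrite S_INR; pose proof (pos_INR i); lra).
    assert (J : 0 <= INR (S n)) by apply pos_INR.
    set (F := fp_log n (S i) t) in *. set (L := ln t ^ S n). set (p := t ^ S i) in *.
    apply Rle_trans with (Rabs (INR (S n) * F - L / p) * p).
    * apply Rmult_le_compat_r; [lra|]. unfold Rdiv. rewrite Rabs_mult.
      rewrite <- (Rmult_1_r (Rabs (INR (S n) * F - L * / p))) at 2.
      apply Rmult_le_compat_l; [apply Rabs_pos|].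
      rewrite Rabs_pos_eq by (left; apply Rinv_0_lt_compat; lra).
      rewrite <- Rinv_1. apply Rinv_le_contravar; lra.
    * apply Rle_trans with ((INR (S n) * Rabs F + Rabs L / p) * p).
      -- apply Rmult_le_compat_r; [lra|]. unfold Rminus.
         refine (Rle_trans _ _ _ (Rabs_triang _ _) _).
         rewrite Rabs_Ropp, Rabs_mult, (Rabs_pos_eq (INR (S n))) by lra.
         unfold Rdiv. rewrite Rabs_mult, Rabs_inv, (Rabs_pos_eq p) by lra. lra.
      -- replace ((INR (S n) * Rabs F + Rabs L / p) * p) with (INR (S n) * (Rabs F * p) + Rabs L)
           by (field; lra). nra.
Qed.

(** The effect of the substitution [t -> t^2] on the finite parts. *)
Lemma fp_log_dbl n j t : 0 < t -> fp_log n (2 * j) t = (/ 2) ^ S n * fp_log n j (t * t).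
Proof.
intros Ht. assert (L : ln (t * t) = 2 * ln t) by (rewrite ln_mult by lra; ring).
destruct j as [|j].
- replace (2 * 0)%nat with O by lia.
  assert (E : forall t, fp_log n 0 t = ln t ^ S n / INR (S n)) by (intros; now destruct n).
  rewrite !E, L, Rpow_mult_distr, pow_inv. field.
  split; [apply not_0_INR; lia|apply pow_nonzero; lra].
- replace (2 * S j)%nat with (S (2 * j + 1)) by lia.
  assert (Ij : INR (S (2 * j + 1)) = 2 * INR (S j)).
  { replace (S (2 * j + 1)) with (2 * S j)%nat by lia. rewrite mult_INR. reflexivity. }
  assert (Pj : t ^ S (2 * j + 1) = (t * t) ^ S j).
  { replace (S (2 * j + 1)) with (2 * S j)%nat by lia. rewrite pow_mult. f_equal. ring. }
  assert (I0 : INR (S j) <> 0) by (apply not_0_INR; lia).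
  assert (P0 : (t * t) ^ S j <> 0) by (apply pow_nonzero; nra).
  induction n as [|n IH].
  + change (fp_log 0 (S (2 * j + 1)) t) with (- / (INR (S (2 * j + 1)) * t ^ S (2 * j + 1))).
    change (fp_log 0 (S j) (t * t)) with (- / (INR (S j) * (t * t) ^ S j)).
    rewrite Ij, Pj. simpl ((/ 2) ^ 1). field. auto.
  + change (fp_log (S n) (S (2 * j + 1)) t) with
      ((INR (S n) * fp_log n (S (2 * j + 1)) t - ln t ^ S n / t ^ S (2 * j + 1)) / INR (S (2 * j + 1))).
    change (fp_log (S n) (S j) (t * t)) with
      ((INR (S n) * fp_log n (S j) (t * t) - ln (t * t) ^ S n / (t * t) ^ S j) / INR (S j)).
    rewrite IH, Ij, Pj, L, (Rpow_mult_distr 2), !pow_inv.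
    change (2 ^ S (S n)) with (2 * 2 ^ S n).
    field. repeat split; auto. apply pow_nonzero; lra.
Qed.

(** * The finite-part series of the logarithm *)

(** The series obtained by expanding the kernel of [log_stieltjes] in powers of
    [w/t] and replacing each divergent integral by its finite part. *)
Definition fp_log_series (n : nat) (r : R) (w : C) : C :=
  iota (T := C_CompleteNormedModule)
    (fun v => Cconv (csum (fun i => (- w) ^ i * RtoC (fp_log n i r))%C) v).

Lemma fp_log_series_coef_bound n r w : 0 < r -> Cmod w < r -> exists K,
  forall i, Cmod ((- w) ^ i * RtoC (fp_log n i r)) <= K * (Cmod w / r) ^ i.
Proof.
intros Hr Hw. destruct (fp_log_bound n r Hr) as [K HK]. exists K. intros i.
rewrite Cmod_mult, Cmod_pow, Cmod_opp, Cmod_R. specialize (HK i).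
pose proof (pow_lt r i Hr) as P. unfold Rdiv. rewrite Rpow_mult_distr, pow_inv.
replace (Cmod w ^ i * Rabs (fp_log n i r)) with ((Rabs (fp_log n i r) * r ^ i) * (Cmod w ^ i * / r ^ i))
  by (field; lra).
apply Rmult_le_compat_r; [|exact HK].
apply Rmult_le_pos; [apply pow_le, Cmod_ge_0|left; now apply Rinv_0_lt_compat].
Qed.

Lemma ratio_bound (w : C) r : 0 < r -> Cmod w < r -> 0 <= Cmod w / r < 1.
Proof.
intros Hr Hw. split.
- apply Rmult_le_pos; [apply Cmod_ge_0|left; now apply Rinv_0_lt_compat].
- now apply ratio_lt_1.
Qed.

Lemma fp_log_series_correct n r w : 0 < r -> Cmod w < r ->
  Cconv (csum (fun i => (- w) ^ i * RtoC (fp_log n i r))%C) (fp_log_series n r w).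
Proof.
intros Hr Hw. destruct (fp_log_series_coef_bound n r w Hr Hw) as [K HK].
destruct (geo_sum _ K _ (ratio_bound w r Hr Hw) HK) as [v Hv].
apply geo_sum_conv in Hv; [|now apply ratio_bound].
unfold fp_log_series. rewrite (iota_unique (V := C_CompleteNormedModule) _ v); [exact Hv| |exact Hv].
intros y Hy. exact (Cconv_unique _ _ _ Hy Hv).
Qed.

Lemma fp_log_series_rate n r w : 0 < r -> Cmod w < r -> exists K, forall N,
  Cmod (csum (fun i => (- w) ^ i * RtoC (fp_log n i r))%C N - fp_log_series n r w) <= K * (Cmod w / r) ^ N.
Proof.
intros Hr Hw. destruct (fp_log_series_coef_bound n r w Hr Hw) as [K HK].
pose proof (ratio_bound w r Hr Hw) as Hq.
destruct (geo_sum _ K _ Hq HK) as [v Hv].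
assert (Hv' := Hv). apply geo_sum_conv in Hv'; [|exact Hq].
rewrite (Cconv_unique _ _ _ (fp_log_series_correct n r w Hr Hw) Hv').
exists (K / (1 - Cmod w / r)). exact Hv.
Qed.

Lemma geo_conv x : Cmod x < 1 -> Cconv (csum (fun m => x ^ m)%C) (/ (1 - x))%C.
Proof.
intros Hx. assert (N : (1 - x)%C <> 0).
{ intros E. apply Csub_0 in E. rewrite <- E, Cmod_1 in Hx. lra. }
assert (E : forall M, (csum (fun m => x ^ m)%C M - / (1 - x))%C = (- x ^ M * / (1 - x))%C).
{ induction M as [|M IH]; simpl; [ring|].
  replace (csum (fun m => x ^ m) M + x ^ M - / (1 - x))%C with
    (csum (fun m => x ^ m) M - / (1 - x) + x ^ M)%C by ring. rewrite IH. field. exact N. }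
apply (Cconv_bound _ _ (fun M => Cmod (/ (1 - x)) * Cmod x ^ M)).
- intros M. rewrite E, Cmod_mult, Cmod_opp, Cmod_pow. right; ring.
- apply geo_lim. split; [apply Cmod_ge_0|exact Hx].
Qed.

(** The recurrence [fp_log_rec], which fails only at [n = i = 0], turns [w d/dw]
    of the series into the series one degree lower. *)
Lemma fp_log_series_cdiff n r w : 0 < r -> Cmod w < r -> exists l, cdiff (fp_log_series n r) w l /\
  (w * l)%C = match n with
    | O => (1 - RtoC r / (w + RtoC r))%C
    | S p => (RtoC (INR n) * fp_log_series p r w - RtoC (ln r ^ n) * (RtoC r / (w + RtoC r)))%C
    end.
Proof.
intros Hr Hw. set (c := fun i => (RtoC ((-1) ^ i) * RtoC (fp_log n i r))%C).
assert (Ec : forall z i, (c i * z ^ i)%C = ((- z) ^ i * RtoC (fp_log n i r))%C).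
{ intros z i. unfold c. replace (- z)%C with (RtoC (-1) * z)%C by ring.
  rewrite Cpow_mult_l, <- RtoC_pow. ring. }
destruct (fp_log_bound n r Hr) as [K HK].
set (R := (Cmod w + r) / 2).
assert (HR : Cmod w < R < r) by (unfold R; lra). pose proof (Cmod_ge_0 w) as W0.
destruct (pseries_diff c (fp_log_series n r) K r R) as [M HM].
{ lra. }
{ intros m. unfold c. rewrite Cmod_mult, !Cmod_R, <- RPow_abs, Rabs_m1, pow1, Rmult_1_l. apply HK. }
{ intros z Hz. eapply Cconv_ext; [|apply fp_log_series_correct; lra].
  intros N. apply csum_ext. intros m _. symmetry. apply Ec. }
destruct (HM w ltac:(lra)) as (D & HD & HQ). exists D. split.
{ exists (Rmax M 0), (R - Cmod w). split; [apply Rmax_r|split; [lra|]]. intros z Hz.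
  refine (Rle_trans _ _ _ (HQ z _) _).
  - replace z with ((z - w) + w)%C by ring. refine (Rle_trans _ _ _ (Cmod_triangle _ _) _). lra.
  - apply Rmult_le_compat_r; [apply pow2_ge_0|apply Rmax_l]. }
assert (HD' : Cconv (csum (fun i => (- w) ^ i * RtoC (INR i * fp_log n i r))%C) (w * D)%C).
{ apply Cconv_shift. apply (Cconv_scal _ _ w) in HD.
  eapply Cconv_ext; [|exact HD]. intros N. cbv beta. rewrite csum_first, <- csum_scal.
  simpl (INR 0). rewrite Rmult_0_l.
  rewrite (csum_ext (fun m => w * (RtoC (INR (S m)) * c (S m) * w ^ m))%C
    (fun m => (- w) ^ S m * RtoC (INR (S m) * fp_log n (S m) r))%C); [ring|].
  intros m _. rewrite RtoC_mult.
  replace ((- w) ^ S m * (RtoC (INR (S m)) * RtoC (fp_log n (S m) r)))%C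
    with (RtoC (INR (S m)) * ((- w) ^ S m * RtoC (fp_log n (S m) r)))%C by ring.
  rewrite <- Ec, (Cpow_S w). ring. }
set (x := (- w / RtoC r)%C).
assert (r0 : RtoC r <> 0) by (apply RtoC_neq0; lra).
assert (wr : (w + RtoC r)%C <> 0).
{ intros E. assert (Q : Cmod w = r).
  { replace w with (- RtoC r)%C by (replace w with (w + RtoC r - RtoC r)%C by ring; rewrite E; ring).
    rewrite Cmod_opp, Cmod_R. apply Rabs_pos_eq; lra. }
  lra. }
assert (Hx : Cmod x < 1).
{ unfold x. rewrite Cmod_div, Cmod_opp, Cmod_R, Rabs_pos_eq by (auto; lra). now apply ratio_bound. }
assert (G : Cconv (csum (fun m => x ^ m)%C) (RtoC r / (w + RtoC r))%C).
{ replace (RtoC r / (w + RtoC r))%C with (/ (1 - x))%C; [now apply geo_conv|].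
  unfold x. field. repeat split; auto. }
assert (Ex : forall m, ((- w) ^ m * RtoC (/ r ^ m))%C = (x ^ m)%C).
{ intros m. unfold x, Cdiv. rewrite Cpow_mult_l, <- RtoC_inv, <- RtoC_pow, pow_inv by lra. reflexivity. }
apply (Cconv_unique _ _ _ HD'). destruct n as [|n].
- apply Cconv_shift.
  eapply Cconv_ext; [|exact (Cconv_minus _ _ _ _ (Cconv_const 1) (Cconv_incr _ _ G))].
  intros N. cbv beta. rewrite !csum_first. simpl (INR 0). rewrite Rmult_0_l.
  rewrite (csum_ext (fun m => (- w) ^ S m * RtoC (INR (S m) * fp_log 0 (S m) r))%C
    (fun m => (-1) * x ^ S m)%C).
  + rewrite csum_scal. simpl (_ ^ 0)%C. ring.
  + intros m _. rewrite fp_log_rec by (auto; lia). simpl (INR 0). simpl (ln r ^ 0).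
    rewrite Rmult_0_l. unfold Rdiv. rewrite Rmult_1_l.
    replace (0 - / r ^ S m) with (- 1 * / r ^ S m) by ring.
    rewrite RtoC_mult, <- Ex. ring.
- eapply Cconv_ext; [|exact (Cconv_minus _ _ _ _
    (Cconv_scal _ _ (RtoC (INR (S n))) (fp_log_series_correct n r w Hr Hw))
    (Cconv_scal _ _ (RtoC (ln r ^ S n)) G))].
  intros N. cbv beta. rewrite <- !csum_scal, <- csum_minus. apply csum_ext. intros m _.
  rewrite fp_log_rec by (auto; lia). replace (S n - 1)%nat with n by lia.
  unfold Rdiv. rewrite <- Ex, RtoC_minus, !RtoC_mult. ring.
Qed.

(** * The Mellin-type identity for the pure logarithm *)

(** What termwise finite parts miss of the integral for the constant function [1]. *)
Definition log_defect (n : nat) (r : R) (w : C) : C := (log_stieltjes n r w - fp_log_series n r w)%C.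

Lemma cdiff_minus f g z l m : cdiff f z l -> cdiff g z m -> cdiff (fun z => f z - g z)%C z (l - m)%C.
Proof.
intros (K & d & HK & Hd & H) (K' & d' & HK' & Hd' & H').
exists (K + K'), (Rmin d d'). split; [lra|split; [now apply Rmin_glb_lt|]]. intros z' Hz'.
specialize (H z' (Rlt_le_trans _ _ _ Hz' (Rmin_l _ _))).
specialize (H' z' (Rlt_le_trans _ _ _ Hz' (Rmin_r _ _))).
replace (f z' - g z' - (f z - g z) - (z' - z) * (l - m))%C with
  ((f z' - f z - (z' - z) * l) + - (g z' - g z - (z' - z) * m))%C by ring.
refine (Rle_trans _ _ _ (Cmod_triangle _ _) _). rewrite Cmod_opp. lra.
Qed.

Lemma log_defect_cdiff n r w : 0 < r -> Cmod w < r -> off_cut w -> exists l, cdiff (log_defect n r) w l /\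
  (w * l)%C = match n with O => - (1) | S p => RtoC (INR n) * log_defect p r w end%C.
Proof.
intros Hr Hw Ha.
destruct (log_stieltjes_cdiff n r w Hr Ha) as (l & Hl & El).
destruct (fp_log_series_cdiff n r w Hr Hw) as (m & Hm & Em).
exists (l - m)%C. split; [now apply cdiff_minus|].
replace (w * (l - m))%C with (w * l - w * m)%C by ring. rewrite El, Em.
destruct n as [|n].
- simpl (ln r ^ 0). simpl (INR 0). ring.
- replace (S n - 1)%nat with n by lia. unfold log_defect. ring.
Qed.

Lemma Int0_Chasles f r s v u : Int0 f r v -> CInt f r s u -> Int0 f s (v + u)%C.
Proof.
intros Hv Hu eps He. destruct (Hv eps He) as (d & Hd & H). exists d. split; [exact Hd|].
intros e E. destruct (H e E) as (y & I & L). exists (y + u)%C.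
split; [exact (CInt_Chasles _ _ _ _ _ _ I Hu)|].
now replace (y + u - (v + u))%C with (y - v)%C by ring.
Qed.

Lemma CInt_fp_log n i r s : 0 < r <= s ->
  CInt (fun t => RtoC (ln t ^ n) / RtoC (t ^ S i))%C r s (RtoC (fp_log n i s) - RtoC (fp_log n i r))%C.
Proof.
intros H. apply (CInt_ext (fun t => RtoC (ln t ^ n / t ^ S i))).
{ intros t Ht. rewrite Rmin_left, Rmax_right in Ht by lra. unfold Rdiv.
  rewrite RtoC_mult, RtoC_inv by (apply pow_nonzero; lra). reflexivity. }
apply (CInt_derive (fun t => RtoC (fp_log n i t))); intros t Ht; rewrite Rmin_left, Rmax_right in Ht by lra.
- apply Cder_RtoC, fp_log_der. lra.
- eapply Cder_cont, Cder_RtoC. unfold Rdiv. apply Rder_mult; [apply Rder_ln_pow; lra|apply Rder_inv_pow; lra].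
Qed.

Lemma Cmod_wt_neq (w : C) t : Cmod w < t -> (w + RtoC t)%C <> 0.
Proof.
intros H E. assert (Q : Cmod w = t).
{ replace w with (- RtoC t)%C by (replace w with (w + RtoC t - RtoC t)%C by ring; rewrite E; ring).
  rewrite Cmod_opp, Cmod_R. apply Rabs_pos_eq. pose proof (Cmod_ge_0 w). lra. }
lra.
Qed.

Lemma kernel_expand (w : C) t N : 0 < t -> (w + RtoC t)%C <> 0 ->
  (/ (w + RtoC t))%C = (csum (fun i => (- w) ^ i / RtoC (t ^ S i)) N
    + (- w / RtoC t) ^ N * / (w + RtoC t))%C.
Proof.
intros Ht H. assert (t0 : RtoC t <> 0) by (apply RtoC_neq0; lra).
induction N as [|N IH]; simpl csum; [simpl; ring|].
rewrite IH at 1. rewrite <- Cplus_assoc. f_equal.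
assert (X : ((- w) ^ N)%C = ((- w / RtoC t) ^ N * RtoC (t ^ N))%C).
{ rewrite RtoC_pow, <- Cpow_mult_l. f_equal. field. exact t0. }
rewrite X, Cpow_S. simpl (t ^ S N). rewrite RtoC_mult. field.
repeat split; auto. apply RtoC_neq0, pow_nonzero. lra.
Qed.

(** Between [r] and [s] the expansion of the kernel converges uniformly, so the
    integral and the series grow by the same amount. *)
Lemma log_defect_indep n r s w : 0 < r <= s -> Cmod w < r -> off_cut w -> log_defect n s w = log_defect n r w.
Proof.
intros Hrs Hw Ha. pose proof (Cmod_ge_0 w) as W0.
assert (C1 : forall t, r <= t <= s -> Ccont (fun t => RtoC (ln t ^ n) * / (w + RtoC t))%C t).
{ intros t Ht. eapply Cder_cont, Cder_mult; [apply Cder_ln_pow; lra|].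
  apply Cder_inv_wt, Cmod_wt_neq. lra. }
destruct (ex_CInt (fun t => RtoC (ln t ^ n) * / (w + RtoC t))%C r s) as [I HI].
{ intros t Ht. rewrite Rmin_left, Rmax_right in Ht by lra. now apply C1. }
assert (EA : log_stieltjes n s w = (log_stieltjes n r w + I)%C).
{ apply (Int0_unique _ _ _ _ (log_stieltjes_correct n s w ltac:(lra) Ha)).
  eapply Int0_Chasles; [apply log_stieltjes_correct; [lra|exact Ha]|exact HI]. }
assert (EV : Cconv (fun N => csum (fun i => (- w) ^ i * RtoC (fp_log n i s))%C N
   - csum (fun i => (- w) ^ i * RtoC (fp_log n i r))%C N)%C I).
{ destruct (continuity_ab_maj (fun t => Cmod (RtoC (ln t ^ n) * / (w + RtoC t))) r s) as (tm & Hmax & _);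
    [lra|intros t Ht; now apply Ccont_Cmod, C1|].
  set (B := Cmod (RtoC (ln tm ^ n) * / (w + RtoC tm))) in *.
  apply (Cconv_bound _ _ (fun N => B * (s - r) * (Cmod w / r) ^ N));
    [|apply geo_lim, ratio_bound; lra].
  intros N. rewrite <- Cmod_opp.
  assert (J := CInt_minus _ _ _ _ _ _ HI (CInt_csum (fun i t => (- w) ^ i * (RtoC (ln t ^ n) / RtoC (t ^ S i)))%C
    _ r s (fun i => CInt_scal _ _ _ _ ((- w) ^ i)%C (CInt_fp_log n i r s Hrs)) N)).
  match goal with |- Cmod ?X <= _ =>
    replace X with (I - csum (fun i => (- w) ^ i * (RtoC (fp_log n i s) - RtoC (fp_log n i r))) N)%C end.
  2:{ rewrite (csum_ext _ (fun i => (- w) ^ i * RtoC (fp_log n i s) - (- w) ^ i * RtoC (fp_log n i r))%C)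
        by (intros; ring). rewrite csum_minus. ring. }
  replace (B * (s - r) * (Cmod w / r) ^ N) with (B * (Cmod w / r) ^ N * (s - r)) by ring.
  refine (CInt_bound_const _ _ r s _ _ _ J); [lra|].
  intros t Ht. cbv beta.
  rewrite (csum_ext (fun i => (- w) ^ i * (RtoC (ln t ^ n) / RtoC (t ^ S i)))%C
    (fun i => RtoC (ln t ^ n) * ((- w) ^ i / RtoC (t ^ S i)))%C)
    by (intros; unfold Cdiv; ring).
  rewrite csum_scal. rewrite (kernel_expand w t N) at 1 by (try apply Cmod_wt_neq; lra).
  match goal with |- Cmod ?X <= _ =>
    replace X with ((RtoC (ln t ^ n) * / (w + RtoC t)) * (- w / RtoC t) ^ N)%C by ring end.
  rewrite Cmod_mult. apply Rmult_le_compat; try apply Cmod_ge_0; [apply Hmax; lra|].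
  rewrite Cmod_pow. apply pow_incr. split; [apply Cmod_ge_0|].
  rewrite Cmod_div, Cmod_opp, Cmod_R, Rabs_pos_eq by (try apply RtoC_neq0; lra).
  apply Rmult_le_compat_l; [exact W0|]. apply Rinv_le_contravar; lra. }
assert (EV' := Cconv_minus _ _ _ _ (fp_log_series_correct n s w ltac:(lra) ltac:(lra)) (fp_log_series_correct n r w ltac:(lra) Hw)).
assert (E := Cconv_unique _ _ _ EV EV'). unfold log_defect. rewrite EA, E. ring.
Qed.

Lemma off_cut_1 : off_cut 1. Proof. apply off_cut_re. simpl. lra. Qed.
Lemma off_cut_Ci : off_cut Ci. Proof. apply off_cut_im. simpl. lra. Qed.
Lemma off_cut_mCi : off_cut (- Ci)%C. Proof. apply off_cut_im. simpl. lra. Qed.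

Lemma Ci2 : (Ci * Ci)%C = (- (1))%C.
Proof. unfold Ci. apply injective_projections; simpl; ring. Qed.

(** Since [1/(i+t) + 1/(-i+t) = 2t/(1+t^2)], this is the substitution [s = t^2]. *)
Lemma log_stieltjes_dup n r : 0 < r ->
  (RtoC (2 ^ n) * (log_stieltjes n r Ci + log_stieltjes n r (- Ci)))%C = log_stieltjes n (r * r) 1.
Proof.
intros Hr.
assert (H := Int0_scal _ _ _ (RtoC (2 ^ n)) (Int0_plus _ _ _ _ _ (log_stieltjes_correct n r Ci Hr off_cut_Ci)
  (log_stieltjes_correct n r (- Ci) Hr off_cut_mCi))).
apply (Int0_unique _ _ _ _ H).
assert (H1 := log_stieltjes_correct n (r * r) 1 ltac:(nra) off_cut_1).
intros eps He. destruct (H1 eps He) as (d & Hd & K).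
exists (Rmin (Rmin d r) 1). split; [repeat apply Rmin_glb_lt; lra|]. intros e [E0 E1].
apply Rlt_min in E1. destruct E1 as [E2 E1].
apply Rlt_min in E2.
destruct (K (e * e)) as (y & I & L); [nra|]. exists y. split; [|exact L].
set (f := fun s => (RtoC (ln s ^ n) * / (1 + RtoC s))%C) in *.
assert (J := is_RInt_comp (V := C_R_CompleteNormedModule) f (fun t => t * t) (fun t => 2 * t) e r).
rewrite Rmin_left, Rmax_right in J by lra.
fold (CRInt f (e * e) (r * r)) in J. rewrite (CRInt_unique _ _ _ _ I) in J.
refine (CInt_ext _ _ _ _ _ _ (J _ _)).
- intros t Ht. rewrite Rmin_left, Rmax_right in Ht by lra.
  assert (L2 : ln (t * t) = 2 * ln t) by (rewrite ln_mult by lra; ring).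
  replace (scal (2 * t) (f (t * t) : C_R_CompleteNormedModule)) with (RtoC (2 * t) * f (t * t)%R)%C.
  + unfold f. rewrite L2, Rpow_mult_distr, !RtoC_mult.
    assert (N1 := off_cut_neq Ci t off_cut_Ci ltac:(lra)). assert (N2 := off_cut_neq (- Ci)%C t off_cut_mCi ltac:(lra)).
    assert (N3 : (1 + RtoC t * RtoC t)%C = ((Ci + RtoC t) * (- Ci + RtoC t))%C).
    { transitivity (RtoC t * RtoC t - Ci * Ci)%C; [rewrite Ci2; ring|ring]. }
    rewrite N3. field. split; assumption.
  + unfold scal; simpl; unfold prod_scal, scal; simpl; unfold mult; simpl.
    apply injective_projections; simpl; ring.
- intros t Ht. change (Ccont f (t * t)). eapply Cder_cont. unfold f.
  apply Cder_mult; [apply Cder_ln_pow; nra|]. apply Cder_inv_wt, off_cut_neq; [apply off_cut_1|nra].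
- intros t Ht. split; [auto_derive; [exact Logic.I|ring]|].
  apply (ex_derive_continuous (fun t => 2 * t)). auto_derive. exact Logic.I.
Qed.

Lemma Cconv_subseq u l (phi : nat -> nat) : (forall n, (phi n < phi (S n))%nat) ->
  Cconv u l -> Cconv (fun N => u (phi N)) l.
Proof.
intros Hp H. apply (is_lim_seq_subseq (fun N => Cmod (u N - l)) 0 phi); [|exact H].
now apply eventually_subseq.
Qed.

Lemma Ci_even j : (Ci ^ (2 * j))%C = ((- (1)) ^ j)%C.
Proof. rewrite Cpow_mult_r. simpl (Ci ^ 2)%C. now rewrite Cmult_1_r, Ci2. Qed.

Lemma fp_log_series_dup n r : 1 < r ->
  (RtoC (2 ^ n) * (fp_log_series n r Ci + fp_log_series n r (- Ci)))%C = fp_log_series n (r * r) 1.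
Proof.
intros Hr.
assert (M1 : Cmod Ci < r) by (rewrite Cmod_Ci; lra).
assert (M2 : Cmod (- Ci) < r) by (rewrite Cmod_opp, Cmod_Ci; lra).
assert (M3 : Cmod 1 < r * r) by (rewrite Cmod_1; nra).
set (a := fun i => ((- Ci) ^ i * RtoC (fp_log n i r) + (- - Ci) ^ i * RtoC (fp_log n i r))%C).
assert (H : Cconv (csum a) (fp_log_series n r Ci + fp_log_series n r (- Ci))%C).
{ eapply Cconv_ext; [|exact (Cconv_plus _ _ _ _ (fp_log_series_correct n r Ci ltac:(lra) M1)
    (fp_log_series_correct n r (- Ci) ltac:(lra) M2))].
  intros N. cbv beta. now rewrite <- csum_plus. }
assert (Em : forall i, ((- Ci) ^ i)%C = (RtoC ((-1) ^ i) * Ci ^ i)%C).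
{ intros i. replace (- Ci)%C with (RtoC (-1) * Ci)%C by ring. now rewrite Cpow_mult_l, <- RtoC_pow. }
assert (Ei : forall i, ((- - Ci) ^ i)%C = (Ci ^ i)%C) by (intros i; f_equal; ring).
assert (Ho : forall i, Nat.Odd i -> a i = 0).
{ intros i Hi. unfold a. rewrite Em, Ei, pow_m1_odd by exact Hi. ring. }
apply (Cconv_scal _ _ (RtoC (2 ^ n))) in H.
apply (Cconv_subseq _ _ (fun N => S (2 * N))) in H; [|intros; lia].
apply (Cconv_unique _ _ _ H).
eapply Cconv_ext; [|exact (Cconv_incr _ _ (fp_log_series_correct n (r * r) 1 ltac:(nra) M3))].
intros N. cbv beta. rewrite (csum_even a Ho), (Nat.mul_comm 2 N), Nat.div_mul by lia.
rewrite <- csum_scal. apply csum_ext. intros j _. unfold a.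
rewrite Em, Ei, pow_1_even, Ci_even, fp_log_dbl by lra.
rewrite RtoC_mult. replace (RtoC ((/ 2) ^ S n)) with (RtoC (/ 2) * / RtoC (2 ^ n))%C.
- rewrite RtoC_inv by lra. field. apply RtoC_neq0, pow_nonzero; lra.
- rewrite <- RtoC_inv, <- RtoC_mult by (apply pow_nonzero; lra). simpl. now rewrite pow_inv.
Qed.

Lemma log_defect_dup n r : 1 < r -> (log_defect n r Ci + log_defect n r (- Ci))%C = (RtoC ((/ 2) ^ n) * log_defect n r 1)%C.
Proof.
intros Hr. rewrite <- (log_defect_indep n r (r * r) 1) by (try apply off_cut_1; rewrite ?Cmod_1; nra).
unfold log_defect. rewrite <- log_stieltjes_dup, <- fp_log_series_dup by lra.
rewrite pow_inv, RtoC_inv by (apply pow_nonzero; lra).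
field. apply RtoC_neq0, pow_nonzero; lra.
Qed.

Lemma Cexp_i_pi_half : Cexp (i_pi * RtoC (/ 2)) = Ci.
Proof.
unfold Cexp, i_pi, Ci, Re, Im; simpl.
replace ((0 * PI - 1 * 0) * / 2 - (0 * 0 + 1 * PI) * 0) with 0 by ring.
replace ((0 * PI - 1 * 0) * 0 + (0 * 0 + 1 * PI) * / 2) with (PI / 2) by field.
rewrite exp_0, cos_PI2, sin_PI2. apply injective_projections; simpl; ring.
Qed.

Lemma Cexp_i_pi_mhalf : Cexp (i_pi * RtoC (- / 2)) = (- Ci)%C.
Proof.
unfold Cexp, i_pi, Ci, Re, Im; simpl.
replace ((0 * PI - 1 * 0) * - / 2 - (0 * 0 + 1 * PI) * 0) with 0 by ring.
replace ((0 * PI - 1 * 0) * 0 + (0 * 0 + 1 * PI) * - / 2) with (- (PI / 2)) by field.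
rewrite exp_0, cos_neg, sin_neg, cos_PI2, sin_PI2. apply injective_projections; simpl; ring.
Qed.

(** Both sides satisfy the same differential equation in the logarithm, so
    they differ by a constant; the duplication formulas force the constant [c]
    to satisfy [2 c = 2^-n c]. *)
Lemma log_defect_delta_poly n : forall r, 1 < r -> forall L : C, Rabs (Im L) < PI -> exp (Re L) < r ->
  log_defect n r (Cexp L) = delta_poly n L.
Proof.
induction n as [n IH] using lt_wf_ind. intros r Hr.
assert (D : forall L : C, Rabs (Im L) < PI -> exp (Re L) < r ->
  log_defect n r (Cexp L) = (delta_poly n L + (log_defect n r 1 - delta_poly n 0))%C).
{ intros L HL HLr.
  assert (Sd : forall s, 0 <= s <= 1 -> Rabs (Im (RtoC s * L)) < PI /\ exp (Re (RtoC s * L)) < r).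
  { intros s Hs. replace (Im (RtoC s * L)) with (s * Im L) by (unfold Im; simpl; ring).
    replace (Re (RtoC s * L)) with (s * Re L) by (unfold Re; simpl; ring). split.
    - rewrite Rabs_mult, Rabs_pos_eq by lra. pose proof (Rabs_pos (Im L)). nra.
    - destruct (Rle_lt_dec (Re L) 0) as [Q|Q].
      + apply Rle_lt_trans with (exp 0); [|rewrite exp_0; lra].
        destruct (Req_dec (s * Re L) 0) as [->|N]; [lra|]. left. apply exp_increasing. nra.
      + apply Rle_lt_trans with (exp (Re L)); [|exact HLr].
        destruct (Req_dec (s * Re L) (Re L)) as [->|N]; [lra|]. left. apply exp_increasing. nra. }
  set (phi := fun s => (log_defect n r (Cexp (RtoC s * L)) - delta_poly n (RtoC s * L))%C).
  assert (E : phi 1 = phi 0).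
  { apply Cder_zero_const; [lra|]. intros s Hs. destruct (Sd s Hs) as [S1 S2].
    assert (g1 : Cder (fun s => RtoC s * L)%C s L).
    { eapply Cder_eq; [apply Cder_mult; [apply Cder_id|apply Cder_const]|]. cbv beta. ring. }
    assert (g2 := Cder_Cexp _ _ _ g1). cbv beta in g2.
    destruct (log_defect_cdiff n r (Cexp (RtoC s * L))) as (l & Hl & El);
      [lra|rewrite Cmod_Cexp; exact S2|now apply off_cut_Cexp|].
    assert (g3 := cdiff_chain _ _ _ _ _ Hl g2).
    unfold phi. destruct n as [|n].
    - eapply Cder_eq; [exact (Cder_minus _ _ _ _ _ g3 (Cder_delta_poly_0 _ _ _ g1))|].
      replace (Cexp (RtoC s * L) * L * l)%C with (L * (Cexp (RtoC s * L) * l))%C by ring.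
      rewrite El. ring.
    - eapply Cder_eq; [exact (Cder_minus _ _ _ _ _ g3 (Cder_delta_poly_S n _ _ _ g1))|].
      replace (Cexp (RtoC s * L) * L * l)%C with (L * (Cexp (RtoC s * L) * l))%C by ring.
      rewrite El. rewrite (IH n) by (auto; lia). ring. }
  unfold phi in E. rewrite !Cmult_1_l, !Cmult_0_l, Cexp_0 in E.
  rewrite <- E. ring. }
pose proof PI_RGT_0 as Hpi.
set (c := (log_defect n r 1 - delta_poly n 0)%C) in *.
assert (P : forall x, Rabs x < 1 -> Rabs (Im (i_pi * RtoC x)) < PI /\ exp (Re (i_pi * RtoC x)) < r).
{ intros x Hx. unfold i_pi, Ci, Re, Im; simpl.
  replace ((0 * PI - 1 * 0) * x - (0 * 0 + 1 * PI) * 0) with 0 by ring.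
  replace ((0 * PI - 1 * 0) * 0 + (0 * 0 + 1 * PI) * x) with (PI * x) by ring.
  rewrite exp_0. split; [|lra]. rewrite Rabs_mult, Rabs_pos_eq by lra. nra. }
destruct (P (/ 2)) as [P1 P2]; [rewrite Rabs_pos_eq; lra|].
destruct (P (- / 2)) as [P3 P4]; [rewrite Rabs_Ropp, Rabs_pos_eq; lra|].
assert (E1 := D _ P1 P2). assert (E2 := D _ P3 P4).
rewrite Cexp_i_pi_half in E1. rewrite Cexp_i_pi_mhalf in E2.
assert (E := log_defect_dup n r Hr). rewrite E1, E2 in E.
assert (E3 := delta_poly_dup n).
assert (Hc : (RtoC (2 - (/ 2) ^ n) * c)%C = 0).
{ replace (log_defect n r 1) with (delta_poly n 0 + c)%C in E by (unfold c; ring).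
  rewrite RtoC_minus.
  replace ((RtoC 2 - RtoC ((/ 2) ^ n)) * c)%C with
   ((delta_poly n (i_pi * RtoC (/ 2)) + c + (delta_poly n (i_pi * RtoC (- / 2)) + c)) -
    (delta_poly n (i_pi * RtoC (/ 2)) + delta_poly n (i_pi * RtoC (- / 2))) - RtoC ((/ 2) ^ n) * c)%C.
  - rewrite E, E3. ring.
  - replace (RtoC 2) with (1 + 1)%C by (rewrite <- RtoC_plus; f_equal). ring. }
assert (N : RtoC (2 - (/ 2) ^ n) <> 0).
{ apply RtoC_neq0. assert (Q : (/ 2) ^ n <= 1 ^ n) by (apply pow_incr; lra). rewrite pow1 in Q. lra. }
assert (C0 : c = 0).
{ replace c with (/ RtoC (2 - (/ 2) ^ n) * (RtoC (2 - (/ 2) ^ n) * c))%C by (field; exact N).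
  rewrite Hc. ring. }
intros L HL HLr. rewrite (D L HL HLr), C0. ring.
Qed.

(** The radius may be replaced by one that is at least [2], which brings the point [1],
    where the constants are determined, into the disc. *)
Theorem log_identity n r w : 0 < r -> Cmod w < r -> slit_plane w ->
  (log_stieltjes n r w - fp_log_series n r w)%C = Delta_log n w.
Proof.
intros Hr Hw Hs. rewrite Delta_log_delta_poly. destruct Hs as [w0 wa].
pose proof (Rmax_l r 2). pose proof (Rmax_r r 2).
change (log_defect n r w = delta_poly n (Log w)).
rewrite <- (log_defect_indep n r (Rmax r 2) w) by (auto; try (now apply off_cut_slit); lra).
rewrite <- (log_defect_delta_poly n (Rmax r 2)).
- now rewrite Cexp_Log.
- lra.
- exact wa.
- simpl. rewrite exp_ln by (now apply Cmod_gt_0). lra.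
Qed.

(** * Improper integrals at the right end point *)

Lemma left_end_proper a : Rbar_lt 0 a -> ProperFilter (left_end a).
Proof.
destruct a as [b| |]; simpl; intros H; [apply at_left_proper_filter|apply Rbar_locally_filter|contradiction].
Qed.

Lemma left_end_near a c : Rbar_lt (Finite c) a -> left_end a (fun x => c < x /\ Rbar_lt x a).
Proof.
destruct a as [b| |]; simpl; intros H; [|now exists c|contradiction].
exists (mkposreal (b - c) ltac:(lra)). intros x Hx Hxb. split; [|exact Hxb].
apply ball_R in Hx; simpl in Hx.
apply Rabs_def2 in Hx. lra.
Qed.

(** The improper integral from [r] to the right end point [a], finite or not. *)
Definition Int_end (a : Rbar) (f : R -> C) (r : R) (v : C) : Prop :=
  forall eps, 0 < eps -> left_end a (fun x => exists y : C, CInt f r x y /\ Cmod (y - v) < eps).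

Lemma Int_end_gen a f r v : Int_end a f r v ->
  is_RInt_gen (V := C_R_NormedModule) f (at_point r) (left_end a) v.
Proof.
intros H P [eps HP]. exists (fun x => x = r)
  (fun x => exists y : C, CInt f r x y /\ Cmod (y - v) < eps).
- reflexivity.
- apply H, cond_pos.
- intros e x -> (y & I & L). exists y. split; [exact I|].
  apply HP. now apply C_NormedModule_mixin_compat1.
Qed.

Lemma below_a {a : Rbar} x y : x <= y -> Rbar_lt (Finite y) a -> Rbar_lt (Finite x) a.
Proof. destruct a as [b| |]; simpl; auto. intros; lra. Qed.

Section Tail.
Variables (a : Rbar) (Ha : Rbar_lt 0 a).

Lemma left_end_filter : ProperFilter (left_end a).
Proof. now apply left_end_proper. Qed.

Lemma Int_end_unique f r v v' : Int_end a f r v -> Int_end a f r v' -> v = v'.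
Proof.
intros H H'. pose proof left_end_filter as PF.
apply (is_RInt_gen_C_unique f (at_point r) (left_end a)).
- apply Proper_StrongProper, at_point_filter.
- apply Proper_StrongProper, left_end_filter.
- now apply Int_end_gen.
- now apply Int_end_gen.
Qed.

Lemma Int_end_plus f g r v u : Int_end a f r v -> Int_end a g r u -> Int_end a (fun t => f t + g t)%C r (v + u)%C.
Proof.
intros Hf Hg eps He. pose proof left_end_filter as PF.
eapply filter_imp; [|exact (filter_and (F := left_end a) _ _ (Hf (eps / 2) ltac:(lra)) (Hg (eps / 2) ltac:(lra)))].
intros x [(y1 & I1 & L1) (y2 & I2 & L2)].
exists (y1 + y2)%C. split; [now apply CInt_plus|].
replace (y1 + y2 - (v + u))%C with ((y1 - v) + (y2 - u))%C by ring.
refine (Rle_lt_trans _ _ _ (Cmod_triangle _ _) _). lra.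
Qed.

Lemma Int_end_scal f r v c : Int_end a f r v -> Int_end a (fun t => c * f t)%C r (c * v)%C.
Proof.
intros Hf eps He. pose proof (Cmod_ge_0 c). pose proof left_end_filter as PF.
eapply filter_imp; [|exact (Hf (eps / (Cmod c + 1)) ltac:(apply Rdiv_lt_0_compat; lra))].
intros x (y & I & L). exists (c * y)%C. split; [now apply CInt_scal|].
replace (c * y - c * v)%C with (c * (y - v))%C by ring. rewrite Cmod_mult.
apply Rlt_div_inv in L; [|lra].
pose proof (Cmod_ge_0 (y - v)). nra.
Qed.

Lemma Int_end_ext f g r v : Rbar_lt (Finite r) a -> (forall t, r < t -> Rbar_lt (Finite t) a -> f t = g t) ->
  Int_end a f r v -> Int_end a g r v.
Proof.
intros Hr H Hf eps He. pose proof left_end_filter as PF.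
eapply filter_imp; [|exact (filter_and (F := left_end a) _ _ (Hf eps He) (left_end_near a r Hr))].
intros x [(y & I & L) [X1 X2]]. exists y. split; [|exact L].
eapply CInt_ext; [|exact I]. intros t Ht. rewrite Rmin_left, Rmax_right in Ht by lra.
apply H; [lra|]. destruct a as [b| |]; simpl in *; auto. lra.
Qed.

Lemma Int_end_csum (u : nat -> R -> C) (b : nat -> C) r :
  (forall m, Int_end a (u m) r (b m)) -> forall N, Int_end a (fun t => csum (fun m => u m t) N) r (csum b N).
Proof.
intros H. pose proof left_end_filter as PF. induction N as [|N IH]; simpl.
- intros eps He. apply filter_forall. intros x. exists 0. split.
  + assert (I := CInt_const 0 r x). replace (RtoC (x - r) * 0)%C with (RtoC 0) in I by ring. exact I.
  + replace (0 - 0)%C with (RtoC 0) by ring. now rewrite Cmod_0.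
- now apply Int_end_plus.
Qed.

Variables (h : R -> C).
Hypothesis (Hc : forall t, 0 < t -> Rbar_lt (Finite t) a -> Ccont h t).

Let I r x := CRInt h r x.

Lemma tail_CInt r x : 0 < r -> Rbar_lt (Finite r) a -> 0 < x -> Rbar_lt (Finite x) a ->
  CInt h r x (I r x).
Proof.
intros Hr Hra Hx Hxa. apply CRInt_correct.
intros t [H1 H2]. apply Hc.
- eapply Rlt_le_trans; [|exact H1]. now apply Rmin_glb_lt.
- eapply below_a; [exact H2|]. unfold Rmax. now destruct Rle_dec.
Qed.

(** The oscillation of the tail near [a] is that of the convergent integral, as
    the part near the origin cancels in differences. *)
Lemma tail_lim r l : 0 < r -> Rbar_lt (Finite r) a ->
  is_RInt_gen (V := C_R_NormedModule) h (at_right 0) (left_end a) l ->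
  exists L : C, filterlim (I r) (left_end a) (locally L).
Proof.
intros Hr Hra Hl. pose proof left_end_filter as PF.
apply C_cauchy; [exact PF|]. intros eps He.
destruct (Hl (fun y => Cmod (y - l) < eps / 2)) as [Q W HQ HW HQW].
{ apply (locally_C l). exists (mkposreal (eps / 2) ltac:(lra)). intros y Hy. exact Hy. }
assert (HQ' : at_right 0 (fun e => 0 < e < r)).
{ now apply (at_right_intro _ r). }
destruct (filter_ex (F := at_right 0) _ (filter_and (F := at_right 0) _ _ HQ HQ')) as [e0 [Qe0 He0]].
exists (fun x => W x /\ (r < x /\ Rbar_lt (Finite x) a)). split.
{ apply filter_and; [exact HW|now apply left_end_near]. }
assert (Z : forall x, W x -> r < x /\ Rbar_lt (Finite x) a -> Cmod (I e0 r + I r x - l) < eps / 2).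
{ intros x Wx [X1 X2]. destruct (HQW e0 x Qe0 Wx) as (y & Iy & Ly). simpl in Iy.
  assert (e0a : Rbar_lt (Finite e0) a) by (apply (below_a e0 r); [lra|exact Hra]).
  rewrite (CInt_unique h e0 x (I e0 r + I r x)%C y); [exact Ly| |exact Iy].
  apply (CInt_Chasles _ _ r); apply tail_CInt; auto; lra. }
intros u v [Wu Xu] [Wv Xv]. specialize (Z u Wu Xu) as Zu. specialize (Z v Wv Xv) as Zv.
replace (I r v - I r u)%C with ((I e0 r + I r v - l) + - (I e0 r + I r u - l))%C by ring.
refine (Rle_lt_trans _ _ _ (Cmod_triangle _ _) _). rewrite Cmod_opp. lra.
Qed.

(** Increasing bounded functions satisfy Cauchy's criterion at finite and
    infinite end points alike, which avoids treating the two separately. *)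
Lemma mono_cauchy r (E : R -> R) B : Rbar_lt (Finite r) a ->
  (forall x, r <= x -> E x <= B) -> (forall x y, r <= x <= y -> E x <= E y) ->
  forall eps, 0 < eps -> exists x0, r <= x0 /\ Rbar_lt (Finite x0) a /\
    forall x y, x0 <= x -> Rbar_lt (Finite x) a -> x0 <= y -> Rbar_lt (Finite y) a -> Rabs (E y - E x) < eps.
Proof.
intros Hra HB Hm eps He.
destruct (completeness (fun z => exists x, r <= x /\ Rbar_lt (Finite x) a /\ z = E x)) as [s [Hs1 Hs2]].
- exists B. intros z (x & Hx & _ & ->). now apply HB.
- exists (E r), r. repeat split; [lra|exact Hra].
- destruct (classic (exists x, r <= x /\ Rbar_lt (Finite x) a /\ s - eps < E x)) as [(x0 & H1 & H2 & H3)|N].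
  + exists x0. split; [exact H1|split; [exact H2|]]. intros x y X1 X2 Y1 Y2.
    assert (E x <= s) by (apply Hs1; exists x; repeat split; [lra|exact X2]).
    assert (E y <= s) by (apply Hs1; exists y; repeat split; [lra|exact Y2]).
    assert (E x0 <= E x) by (apply Hm; lra). assert (E x0 <= E y) by (apply Hm; lra).
    apply Rabs_def1; lra.
  + exfalso. assert (s <= s - eps); [|lra]. apply Hs2. intros z (x & H1 & H2 & ->).
    apply Rnot_lt_le. intros K. apply N. exists x. auto.
Qed.

(** Both [g] and [t g'] are of order [t^(-del)].  The class is stable under
    products, and Abel's test applies to it. *)
Definition symbol (r del : R) (g g' : R -> C) (B : R) : Prop :=
  forall t, r <= t -> Cder g t (g' t) /\ Ccont g' t /\
    Cmod (g t) <= B * exp (- del * ln t) /\ t * Cmod (g' t) <= B * exp (- del * ln t).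

(** Abel's test.  Integration by parts against the primitive of [h] that
    vanishes at the end point leaves an absolutely convergent integral; all
    the constants of the bound are independent of [g]. *)
Lemma tail_abel r del l : 0 < r -> Rbar_lt (Finite r) a -> 0 < del ->
  is_RInt_gen (V := C_R_NormedModule) h (at_right 0) (left_end a) l ->
  exists M, 0 <= M /\ forall g g' B, symbol r del g g' B ->
    exists v, Int_end a (fun t => h t * g t)%C r v /\ Cmod v <= M * B.
Proof.
intros Hr Hra Hdel Hl. pose proof left_end_filter as PF.
destruct (tail_lim r l Hr Hra Hl) as [L HL].
set (K := fun x => (I r x - L)%C).
assert (HK : forall x, r <= x -> Rbar_lt (Finite x) a -> Cder K x (h x)).
{ intros x Hx Hxa. unfold K. replace (h x) with (h x - 0)%C by ring.
  apply Cder_minus; [|apply Cder_const].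
  apply (is_derive_RInt (V := C_R_NormedModule) h (I r) r x); [|apply Hc; [lra|exact Hxa]].
  assert (W : locally x (fun y => 0 < y /\ Rbar_lt (Finite y) a)).
  { destruct a as [b| |]; simpl in *; [|exists (mkposreal x ltac:(lra))|contradiction].
    - exists (mkposreal (Rmin x (b - x)) ltac:(apply Rmin_glb_lt; lra)). intros y Hy.
      apply ball_R in Hy; simpl in Hy.
      pose proof (Rmin_l x (b - x)). pose proof (Rmin_r x (b - x)). apply Rabs_def2 in Hy. lra.
    - intros y Hy. apply ball_R in Hy; simpl in Hy. apply Rabs_def2 in Hy. lra. }
  eapply filter_imp; [|exact W]. intros y [Y1 Y2]. now apply tail_CInt. }
assert (Kl : forall eps, 0 < eps -> left_end a (fun x => Cmod (K x) < eps)).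
{ exact (proj1 (Clim_iff (left_end a) (I r) L) HL). }
(* [K] is bounded: near the end it is small, elsewhere it is continuous on a segment *)
assert (exM : exists M, 0 <= M /\ forall x, r <= x -> Rbar_lt (Finite x) a -> Cmod (K x) <= M).
{ assert (Bx : exists x0, r <= x0 /\ Rbar_lt (Finite x0) a /\
    forall x, x0 <= x -> Rbar_lt (Finite x) a -> Cmod (K x) <= 1).
  { destruct a as [b| |]; simpl in *; [| |contradiction].
    - destruct (Kl 1 Rlt_0_1) as [d Hd]. pose proof (cond_pos d) as Pd.
      exists (Rmax r (b - d / 2)). split; [apply Rmax_l|].
      split; [apply Rmax_lub_lt; lra|]. intros x Hx Hxb. left. apply Hd; [|exact Hxb].
      pose proof (Rmax_r r (b - d / 2)).
      change (Rabs (x - b) < d). apply Rabs_def1; lra.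
    - destruct (Kl 1 Rlt_0_1) as [M HM]. exists (Rmax r (M + 1)).
      split; [apply Rmax_l|]. split; [exact Logic.I|]. intros x Hx _. left. apply HM.
      pose proof (Rmax_r r (M + 1)). lra. }
  destruct Bx as (x0 & X1 & X2 & X3).
  destruct (continuity_ab_maj (fun x => Cmod (K x)) r x0 X1) as (xm & Hm & _).
  { intros x Hx. apply Ccont_Cmod. eapply Cder_cont, HK; [lra|]. apply (below_a x x0); [lra|exact X2]. }
  exists (Rmax 1 (Cmod (K xm))). split; [pose proof (Rmax_l 1 (Cmod (K xm))); lra|].
  intros x Hx Hxa. destruct (Rle_lt_dec x x0) as [Q|Q].
  - eapply Rle_trans; [apply Hm; lra|apply Rmax_r].
  - eapply Rle_trans; [apply X3; [lra|exact Hxa]|apply Rmax_l]. }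
destruct exM as (M & M0 & HM).
set (ed := fun t => exp (- del * ln t)).
assert (ed0 : forall t, 0 < ed t) by (intros; apply exp_pos).
assert (edm : forall x y, r <= x <= y -> ed y <= ed x).
{ intros x y Hxy. unfold ed. destruct (Req_dec x y) as [->|N]; [lra|].
  left. apply exp_increasing. assert (ln x < ln y) by (apply ln_increasing; lra). nra. }
set (E := fun t => - ed t / del).
assert (Eint : forall B x y, r <= x <= y -> is_RInt (fun t => B * (ed t / t)) x y (B * (E y - E x))).
{ intros B x y Hxy.
  replace (B * (E y - E x)) with (minus (B * E y) (B * E x)) by (unfold minus, plus, opp; simpl; ring).
  apply (is_RInt_derive (fun t => B * E t)); intros t Ht; rewrite Rmin_left, Rmax_right in Ht by lra.
  - unfold E, ed. auto_derive; [lra|]. field. lra.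
  - apply (ex_derive_continuous (fun t => B * (ed t / t))). unfold ed. auto_derive. lra. }
assert (Emono : forall x y, r <= x <= y -> E x <= E y).
{ intros x y Hxy. unfold E, Rdiv. apply Rmult_le_compat_r; [left; now apply Rinv_0_lt_compat|].
  specialize (edm x y Hxy). lra. }
assert (Eneg : forall x, E x <= 0).
{ intros x. unfold E, Rdiv. specialize (ed0 x). pose proof (Rinv_0_lt_compat _ Hdel). nra. }
exists (M * ed r + M * (ed r / del)). split.
{ pose proof (ed0 r) as P. assert (0 < ed r / del) by now apply Rdiv_lt_0_compat. nra. }
intros g g' B HS.
assert (B0 : 0 <= B).
{ destruct (HS r (Rle_refl r)) as (_ & _ & Q & _). pose proof (Cmod_ge_0 (g r)).
  fold (ed r) in Q. pose proof (ed0 r). nra. }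
assert (gb : forall t, r <= t -> Cmod (g t) <= B * ed r).
{ intros t Ht. destruct (HS t Ht) as (_ & _ & Q & _). refine (Rle_trans _ _ _ Q _).
  apply Rmult_le_compat_l; [exact B0|]. apply edm; lra. }
set (J := fun x => CRInt (fun t => K t * g' t)%C r x).
assert (Kg : forall x y, r <= x <= y -> Rbar_lt (Finite y) a ->
  exists z, CInt (fun t => K t * g' t)%C x y z /\ Cmod z <= M * B * (E y - E x)).
{ intros x y Hxy Hya. destruct (ex_CInt (fun t => K t * g' t)%C x y) as [z Hz].
  { intros t Ht. rewrite Rmin_left, Rmax_right in Ht by lra. apply Ccont_mult.
    - eapply Cder_cont, HK; [lra|]. apply (below_a t y); [lra|exact Hya].
    - apply HS. lra. }
  exists z. split; [exact Hz|].
  refine (CInt_bound _ _ _ _ _ _ (proj2 Hxy) _ Hz (Eint (M * B) x y Hxy)).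
  intros t Ht. rewrite Cmod_mult. destruct (HS t ltac:(lra)) as (_ & _ & _ & Q).
  rewrite Rmult_assoc. apply Rmult_le_compat; try apply Cmod_ge_0.
  - apply HM; [lra|]. apply (below_a t y); [lra|exact Hya].
  - apply (Rmult_le_reg_l t); [lra|]. replace (t * (B * (ed t / t))) with (B * ed t) by (field; lra).
    exact Q. }
assert (HJ : forall x, r <= x -> Rbar_lt (Finite x) a -> CInt (fun t => K t * g' t)%C r x (J x)).
{ intros x Hx Hxa. apply (RInt_correct (V := C_R_CompleteNormedModule)).
  destruct (Kg r x ltac:(lra) Hxa) as (z & Hz & _). now exists z. }
assert (dJ : forall x y, r <= x <= y -> Rbar_lt (Finite y) a -> Cmod (J y - J x) <= M * B * (E y - E x)).
{ intros x y Hxy Hya. destruct (Kg x y Hxy Hya) as (z & Hz & Bz).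
  assert (Q := CInt_Chasles _ _ _ _ _ _ (HJ x ltac:(lra) (below_a x y ltac:(lra) Hya)) Hz).
  rewrite (CInt_unique _ _ _ _ _ (HJ y ltac:(lra) Hya) Q).
  replace (J x + z - J x)%C with z by ring. exact Bz. }
destruct (C_cauchy (left_end a) J) as [vJ HvJ].
{ intros eps He.
  destruct (mono_cauchy r E 0 Hra (fun x _ => Eneg x) Emono (eps / (M * B + 1))) as (x0 & X1 & X2 & X3).
  { apply Rdiv_lt_0_compat; nra. }
  exists (fun x => x0 < x /\ Rbar_lt (Finite x) a). split; [now apply left_end_near|].
  assert (W : forall u v, x0 < u -> Rbar_lt (Finite v) a -> u <= v -> Cmod (J v - J u) < eps).
  { intros u v U V UV. refine (Rle_lt_trans _ _ _ (dJ u v ltac:(lra) V) _).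
    specialize (X3 u v ltac:(lra) (below_a u v UV V) ltac:(lra) V). apply Rabs_def2 in X3.
    assert (MB : 0 <= M * B) by nra. destruct X3 as [X3 _].
    apply Rlt_div_inv in X3; [|lra].
    assert (E u <= E v) by (apply Emono; lra). nra. }
  intros u v [U1 U2] [V1 V2]. destruct (Rle_dec u v); [now apply W|].
  rewrite <- Cmod_opp. replace (- (J v - J u))%C with (J u - J v)%C by ring. apply W; auto. lra. }
assert (HvJ' := proj1 (Clim_iff (left_end a) J vJ) HvJ).
exists (- (K r * g r) - vJ)%C. split.
- intros eps He.
  set (e1 := eps / (2 * (B * ed r + 1))).
  assert (P : 0 <= B * ed r) by (specialize (ed0 r); nra).
  assert (He1 : 0 < e1) by (apply Rdiv_lt_0_compat; lra).
  eapply filter_imp; [|exact (filter_and (F := left_end a) _ _ (filter_and (F := left_end a) _ _ (HvJ' (eps / 2) ltac:(lra)) (Kl e1 He1))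
    (left_end_near a r Hra))].
  intros x [[L1 L2] [X1 X2]].
  exists (K x * g x - K r * g r - J x)%C. split.
  + assert (D : CInt (fun t => h t * g t + K t * g' t)%C r x (K x * g x - K r * g r)%C).
    { apply (CInt_derive (fun t => K t * g t)%C); intros t Ht; rewrite Rmin_left, Rmax_right in Ht by lra;
        assert (ta : Rbar_lt (Finite t) a) by (apply (below_a t x); [lra|exact X2]).
      - apply Cder_mult; [apply HK; [lra|exact ta]|apply HS; lra].
      - destruct (HS t ltac:(lra)) as (S1 & S2 & _).
        apply (continuous_plus (V := C_NormedModule)); apply Ccont_mult.
        + apply Hc; [lra|exact ta].
        + eapply Cder_cont, S1.
        + eapply Cder_cont, HK; [lra|exact ta].
        + exact S2. }
    eapply CInt_ext; [|exact (CInt_minus _ _ _ _ _ _ D (HJ x ltac:(lra) X2))].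
    intros t _. cbv beta. ring.
  + replace (K x * g x - K r * g r - J x - (- (K r * g r) - vJ))%C with
      (K x * g x + - (J x - vJ))%C by ring.
    refine (Rle_lt_trans _ _ _ (Cmod_triangle _ _) _). rewrite Cmod_opp, Cmod_mult.
    assert (Cmod (K x) * Cmod (g x) <= eps / 2); [|lra].
    apply Rle_trans with (e1 * (B * ed r)).
    * apply Rmult_le_compat; try apply Cmod_ge_0; [lra|apply gb; lra].
    * assert (Q : e1 * (2 * (B * ed r + 1)) = eps) by (unfold e1; field; lra). nra.
- refine (Rle_trans _ _ _ (Cmod_triangle _ _) _). rewrite !Cmod_opp, Cmod_mult.
  rewrite Rmult_plus_distr_r. apply Rplus_le_compat.
  + rewrite Rmult_assoc, (Rmult_comm (ed r)). apply Rmult_le_compat; try apply Cmod_ge_0.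
    * apply HM; [lra|exact Hra].
    * apply gb; lra.
  + apply Rnot_lt_le. intros Q.
    assert (Q' : 0 < Cmod vJ - M * (ed r / del) * B) by lra.
    destruct (filter_ex (F := left_end a) _ (filter_and (F := left_end a) _ _ (HvJ' _ Q') (left_end_near a r Hra)))
      as [x [L1 [X1 X2]]].
    assert (D := dJ r x ltac:(lra) X2).
    replace (J r) with (RtoC 0) in D.
    2:{ symmetry. apply (CInt_unique _ _ _ _ _ (HJ r ltac:(lra) Hra)).
        apply (is_RInt_point (V := C_R_NormedModule)). }
    unfold Cminus in D. rewrite Copp_0, Cplus_0_r in D.
    pose proof (Cmod_triangle (J x) (- (J x - vJ))) as T.
    replace (J x + - (J x - vJ))%C with vJ in T by ring. rewrite Cmod_opp in T.
    assert (E x - E r <= ed r / del) by (specialize (Eneg x); unfold E in *; unfold Rdiv in *; lra).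
    assert (M * B * (E x - E r) <= M * B * (ed r / del)) by (apply Rmult_le_compat_l; nra).
    nra.
Qed.

End Tail.

Lemma symbol_mult r del g g' q q' B Q : 0 < r -> symbol r del g g' B -> symbol r 0 q q' Q ->
  symbol r del (fun t => g t * q t)%C (fun t => g' t * q t + g t * q' t)%C (2 * (B * Q)).
Proof.
intros Hr Hg Hq t Ht. destruct (Hg t Ht) as (G1 & G2 & G3 & G4). destruct (Hq t Ht) as (Q1 & Q2 & Q3 & Q4).
replace (- 0 * ln t) with 0 in Q3, Q4 by ring. rewrite exp_0, Rmult_1_r in Q3, Q4.
set (e := exp (- del * ln t)) in *. assert (e0 : 0 < e) by apply exp_pos.
pose proof (Cmod_ge_0 (g t)). pose proof (Cmod_ge_0 (g' t)).
pose proof (Cmod_ge_0 (q t)). pose proof (Cmod_ge_0 (q' t)).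
assert (P1 : Cmod (g t) * Cmod (q t) <= (B * e) * Q) by (apply Rmult_le_compat; lra).
assert (P2 : (t * Cmod (g' t)) * Cmod (q t) <= (B * e) * Q) by (apply Rmult_le_compat; try lra; nra).
assert (P3 : Cmod (g t) * (t * Cmod (q' t)) <= (B * e) * Q) by (apply Rmult_le_compat; try lra; nra).
split; [now apply Cder_mult|]. split; [|split].
- apply (continuous_plus (V := C_NormedModule)); apply Ccont_mult; auto; eapply Cder_cont; eassumption.
- rewrite Cmod_mult. pose proof (Rmult_le_pos _ _ H H1). nra.
- apply Rle_trans with (t * (Cmod (g' t) * Cmod (q t) + Cmod (g t) * Cmod (q' t))); [|nra].
  apply Rmult_le_compat_l; [lra|]. rewrite <- !Cmod_mult. apply Cmod_triangle.
Qed.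

Lemma symbol_pow r j : 0 < r ->
  symbol r 0 (fun t => RtoC (/ t ^ j)) (fun t => RtoC (- INR j / t ^ S j)) (INR (S j) * / r ^ j).
Proof.
intros Hr t Ht. replace (- 0 * ln t) with 0 by ring. rewrite exp_0, Rmult_1_r.
assert (P : 0 < t ^ j) by (apply pow_lt; lra).
assert (Pr : 0 < r ^ j) by (apply pow_lt; lra).
assert (L : / t ^ j <= / r ^ j) by (apply Rinv_le_contravar; [exact Pr|apply pow_incr; lra]).
assert (Lp : 0 < / t ^ j) by now apply Rinv_0_lt_compat.
pose proof (pos_INR j) as J0. rewrite S_INR.
split; [apply Cder_RtoC, Rder_inv_pow; lra|]. split; [|split].
- eapply Cder_cont, Cder_RtoC. unfold Rdiv. apply is_derive_scal, Rder_inv_pow. lra.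
- rewrite Cmod_R, Rabs_pos_eq by lra. nra.
- rewrite Cmod_R. simpl (t ^ S j). unfold Rdiv. rewrite Rabs_mult, Rabs_Ropp, Rabs_pos_eq, Rinv_mult by lra.
  rewrite Rabs_pos_eq.
  + replace (t * (INR j * (/ t * / t ^ j))) with (INR j * / t ^ j) by (field; split; lra). nra.
  + apply Rmult_le_pos; [left; apply Rinv_0_lt_compat; lra|lra].
Qed.

Lemma symbol_kernel r w : 0 < r -> Cmod w < r -> exists q' Q,
  symbol r 0 (fun t => RtoC t / (w + RtoC t))%C q' Q.
Proof.
intros Hr Hw. pose proof (Cmod_ge_0 w) as W0.
set (c := 1 - Cmod w / r).
assert (Hc : 0 < c <= 1).
{ unfold c. pose proof (ratio_bound w r Hr Hw). lra. }
exists (fun t => w * (/ (w + RtoC t) * / (w + RtoC t)))%C, (/ c * / c).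
intros t Ht. replace (- 0 * ln t) with 0 by ring. rewrite exp_0, Rmult_1_r.
assert (N : (w + RtoC t)%C <> 0) by (apply Cmod_wt_neq; lra).
assert (L : t * c <= Cmod (w + RtoC t)).
{ pose proof (Cmod_triangle (w + RtoC t) (- w)) as T.
  replace (w + RtoC t + - w)%C with (RtoC t) in T by ring.
  rewrite Cmod_opp, Cmod_R, Rabs_pos_eq in T by lra.
  assert (E : Cmod w = (1 - c) * r) by (unfold c; field; lra).
  assert ((1 - c) * r <= (1 - c) * t) by (apply Rmult_le_compat_l; lra). lra. }
assert (tc : 0 < t * c) by (apply Rmult_lt_0_compat; lra).
assert (LI : Cmod (/ (w + RtoC t)) <= / (t * c)).
{ rewrite Cmod_inv by exact N. now apply Rinv_le_contravar. }
assert (c1 : 1 <= / c) by (rewrite <- Rinv_1; apply Rinv_le_contravar; lra).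
pose proof (Cmod_ge_0 (/ (w + RtoC t))) as I0.
split; [|split; [|split]].
- eapply Cder_eq; [apply Cder_div; [apply Cder_id| |exact N]|].
  + apply Cder_plus; [apply Cder_const|apply Cder_id].
  + cbv beta. field. exact N.
- eapply Cder_cont, Cder_scal, Cder_mult; apply Cder_inv_wt; exact N.
- unfold Cdiv. rewrite Cmod_mult, Cmod_R, Rabs_pos_eq by lra.
  apply Rle_trans with (t * / (t * c)); [apply Rmult_le_compat_l; lra|].
  replace (t * / (t * c)) with (/ c) by (field; lra). nra.
- rewrite !Cmod_mult.
  apply Rle_trans with (t * (t * (/ (t * c) * / (t * c)))).
  + apply Rmult_le_compat_l; [lra|]. apply Rmult_le_compat; [lra|apply Rmult_le_pos; lra|lra|].
    apply Rmult_le_compat; lra.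
  + right. field. lra.
Qed.

Lemma exp_ln_bound n del r : 0 < del -> 0 < r -> exists K, 0 < K /\
  forall t, r <= t -> Rabs (ln t ^ n) * exp (- (2 * del) * ln t) <= K * exp (- del * ln t).
Proof.
intros Hd Hr. destruct (pow_exp_bound n del Hd) as (K & HK & H).
exists (K * exp (del * (2 * Rabs (ln r)))). split; [apply Rmult_lt_0_compat; [exact HK|apply exp_pos]|].
intros t Ht. rewrite <- RPow_abs.
assert (A : Rabs (ln t) <= ln t + 2 * Rabs (ln r)).
{ assert (ln r <= ln t) by (destruct (Req_dec r t) as [->|N]; [lra|left; apply ln_increasing; lra]).
  pose proof (Rle_abs (- ln r)) as Q. rewrite Rabs_Ropp in Q. pose proof (Rabs_pos (ln r)).
  unfold Rabs at 1. destruct Rcase_abs; lra. }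
apply Rle_trans with (K * exp (del * (ln t + 2 * Rabs (ln r))) * exp (- (2 * del) * ln t)).
- apply Rmult_le_compat_r; [left; apply exp_pos|].
  refine (Rle_trans _ _ _ (H (ln t)) _). apply Rmult_le_compat_l; [lra|].
  destruct (Req_dec (del * Rabs (ln t)) (del * (ln t + 2 * Rabs (ln r)))) as [->|N]; [lra|].
  left. apply exp_increasing. nra.
- right. rewrite !Rmult_assoc, <- !exp_plus. do 2 f_equal. ring.
Qed.

Lemma symbol_ln n r del : 0 < r -> 0 < del -> exists g' B, 0 <= B /\
  symbol r del (fun t => RtoC (ln t ^ n * exp (- (2 * del) * ln t))) g' B.
Proof.
intros Hr Hd.
destruct (exp_ln_bound n del r Hd Hr) as (K1 & HK1 & H1).
destruct (exp_ln_bound (n - 1) del r Hd Hr) as (K2 & HK2 & H2).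
pose proof (pos_INR n) as J0.
exists (fun t => RtoC ((INR n * ln t ^ (n - 1) / t) * exp (- (2 * del) * ln t) +
   ln t ^ n * (- (2 * del) / t * exp (- (2 * del) * ln t)))), (K1 + (INR n * K2 + 2 * del * K1)).
assert (P0 : 0 <= INR n * K2) by (apply Rmult_le_pos; lra).
assert (P1 : 0 <= 2 * del * K1) by (apply Rmult_le_pos; lra).
split; [lra|].
assert (De : forall t, 0 < t -> is_derive (fun t => exp (- (2 * del) * ln t)) t (- (2 * del) / t * exp (- (2 * del) * ln t))).
{ intros t Ht. auto_derive; [exact Ht|]. field. lra. }
assert (Di : forall t, 0 < t -> is_derive (fun t => / t) t (- 1 / t ^ 2)).
{ intros t Ht. auto_derive; [lra|]. field. lra. }
intros t Ht.
assert (e0 : 0 < exp (- del * ln t)) by apply exp_pos.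
split; [|split; [|split]].
- apply Cder_RtoC. apply (Rder_mult (fun t => ln t ^ n) (fun t => exp (- (2 * del) * ln t)));
    [apply Rder_ln_pow; lra|apply De; lra].
- eapply Cder_cont, Cder_RtoC. apply (is_derive_plus (V := R_NormedModule)); unfold Rdiv.
  + apply (Rder_mult (fun t => INR n * ln t ^ (n - 1) * / t) (fun t => exp (- (2 * del) * ln t))); [|apply De; lra].
    apply (Rder_mult (fun t => INR n * ln t ^ (n - 1)) (fun t => / t)); [|apply Di; lra].
    apply is_derive_scal, Rder_ln_pow; lra.
  + apply (Rder_mult (fun t => ln t ^ n) (fun t => - (2 * del) * / t * exp (- (2 * del) * ln t)));
      [apply Rder_ln_pow; lra|].
    apply (Rder_mult (fun t => - (2 * del) * / t) (fun t => exp (- (2 * del) * ln t))); [|apply De; lra].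
    apply is_derive_scal, Di; lra.
- rewrite Cmod_R, Rabs_mult, (Rabs_pos_eq (exp _)) by (left; apply exp_pos).
  specialize (H1 t Ht). nra.
- rewrite Cmod_R.
  set (E := exp (- (2 * del) * ln t)) in *. assert (E0 : 0 < E) by apply exp_pos.
  replace (INR n * ln t ^ (n - 1) / t * E + ln t ^ n * (- (2 * del) / t * E)) with
    ((INR n * (ln t ^ (n - 1) * E) - 2 * del * (ln t ^ n * E)) * / t) by (field; lra).
  rewrite Rabs_mult, (Rabs_pos_eq (/ t)) by (left; apply Rinv_0_lt_compat; lra).
  rewrite (Rmult_comm _ (/ t)), <- Rmult_assoc, Rinv_r, Rmult_1_l by lra.
  unfold Rminus. refine (Rle_trans _ _ _ (Rabs_triang _ _) _).
  rewrite Rabs_Ropp, !Rabs_mult, (Rabs_pos_eq (INR n)), (Rabs_pos_eq E), (Rabs_pos_eq del), (Rabs_pos_eq 2) by lra.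
  specialize (H1 t Ht). specialize (H2 t Ht). fold E in H1, H2.
  assert (INR n * (Rabs (ln t ^ (n - 1)) * E) <= INR n * (K2 * exp (- del * ln t)))
    by (apply Rmult_le_compat_l; lra).
  assert (2 * del * (Rabs (ln t ^ n) * E) <= 2 * del * (K1 * exp (- del * ln t)))
    by (apply Rmult_le_compat_l; lra).
  nra.
Qed.

Lemma Cexp_RtoC x : Cexp (RtoC x) = RtoC (exp x).
Proof.
unfold Cexp, Re, Im; simpl. rewrite cos_0, sin_0. apply injective_projections; simpl; ring.
Qed.

Lemma Rcpow_RtoC t s : Rcpow t (RtoC s) = RtoC (exp (s * ln t)).
Proof. unfold Rcpow. now rewrite <- RtoC_mult, Cexp_RtoC. Qed.

(** A real exponent [1 - 2 del] in the strip of convergence leaves a factor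
    [t^(-2 del)], half of which absorbs the logarithms. *)
Lemma class_K_mellin a k : class_K a k -> exists del l, 0 < del /\
  is_RInt_gen (V := C_R_NormedModule) (fun t => k t * RtoC (exp ((2 * del - 1) * ln t)))%C
    (at_right 0) (left_end a) l.
Proof.
intros (_ & _ & d & Hd & _ & H).
assert (X : exists lam, Rbar_lt d (Finite lam) /\ lam < 1).
{ destruct d as [x| |]; simpl in *; [|contradiction|exists 0; split; [exact Logic.I|lra]].
  exists ((x + 1) / 2). lra. }
destruct X as (lam & L1 & L2).
destruct (H (RtoC lam) L1 L2) as [l Hl]. exists ((1 - lam) / 2), l. split; [lra|].
replace (fun t => k t * RtoC (exp ((2 * ((1 - lam) / 2) - 1) * ln t)))%C
  with (fun t => k t * Rcpow t (- RtoC lam))%C; [exact Hl|].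
apply FunctionalExtensionality.functional_extensionality. intros t.
rewrite <- RtoC_opp, Rcpow_RtoC. do 4 f_equal. field.
Qed.

(** * Divergent terms of the finite part *)

(** The functions that a finite part discards. *)
Definition divergent (F : R -> C) : Prop :=
  exists D, List.Forall (fun '(_, mu, q) => has_no_limit mu q) D /\
    forall eps, 0 < eps -> eval_terms D eps = F eps.

Lemma divergent_zero : divergent (fun _ => 0).
Proof. exists nil. split; [constructor|reflexivity]. Qed.

Lemma divergent_plus F G : divergent F -> divergent G -> divergent (fun t => F t + G t)%C.
Proof.
intros (D & HD & ED) (D' & HD' & ED'). exists (D ++ D'). split; [now apply Forall_app|].
intros eps He. now rewrite eval_terms_app, ED, ED'.
Qed.

Lemma divergent_scal c F : divergent F -> divergent (fun t => c * F t)%C.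
Proof.
intros (D & HD & ED). exists (map (fun '(x, mu, q) => ((c * x)%C, mu, q)) D). split.
- apply Forall_map. eapply Forall_impl; [|exact HD]. now intros [[x mu] q].
- intros eps He. rewrite <- ED by exact He. clear. induction D as [|[[x mu] q] D IH]; simpl; [ring|].
  rewrite IH. ring.
Qed.

Lemma divergent_ext F G : (forall t, 0 < t -> F t = G t) -> divergent F -> divergent G.
Proof. intros H (D & HD & ED). exists D. split; [exact HD|]. intros eps He. now rewrite ED, H. Qed.

Lemma divergent_csum (u : nat -> R -> C) N : (forall m, divergent (u m)) ->
  divergent (fun t => csum (fun m => u m t) N).
Proof.
intros H. induction N as [|N IH]; simpl; [apply divergent_zero|now apply divergent_plus].
Qed.

(** At [eps = exp (-T)] the modulus is [exp (i T) T^q], which is at least [T]. *)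
Lemma monomial_no_limit i q : (1 <= i + q)%nat -> has_no_limit (RtoC (- INR i)) q.
Proof.
intros H [l Hl]. rewrite (Clim_iff (at_right 0) _ l) in Hl.
destruct (at_right_elim _ (Hl 1 Rlt_0_1)) as (d & Hd & K).
set (T := Rmax 1 (Rmax (Cmod l + 1) (1 - ln d))).
assert (T1 : 1 <= T) by apply Rmax_l.
assert (T2 : Cmod l + 1 <= T) by (eapply Rle_trans; [apply Rmax_l|apply Rmax_r]).
assert (T3 : 1 - ln d <= T) by (eapply Rle_trans; [apply (Rmax_r (Cmod l + 1))|apply Rmax_r]).
assert (Q := K (exp (- T))).
assert (Hx : 0 < exp (- T) < d).
{ split; [apply exp_pos|]. apply Rlt_le_trans with (exp (ln d)); [|rewrite exp_ln; lra]. apply exp_increasing. lra. }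
specialize (Q Hx). unfold monomial in Q. rewrite Rcpow_RtoC, ln_exp in Q.
assert (E : Cmod (RtoC (exp (- INR i * - T)) * RtoC ((- T) ^ q)) = exp (INR i * T) * T ^ q).
{ rewrite Cmod_mult, !Cmod_R, Rabs_pos_eq by (left; apply exp_pos).
  rewrite <- RPow_abs, Rabs_Ropp, (Rabs_pos_eq T) by lra. f_equal. f_equal. ring. }
pose proof (Cmod_triangle (RtoC (exp (- INR i * - T)) * RtoC ((- T) ^ q) - l) l) as Tr.
replace (RtoC (exp (- INR i * - T)) * RtoC ((- T) ^ q) - l + l)%C with
  (RtoC (exp (- INR i * - T)) * RtoC ((- T) ^ q))%C in Tr by ring.
rewrite E in Tr.
assert (e1 : 1 <= exp (INR i * T)).
{ pose proof (pos_INR i). rewrite <- exp_0. destruct (Req_dec 0 (INR i * T)) as [<-|N]; [lra|].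
  left. apply exp_increasing. assert (0 <= INR i * T) by nra. lra. }
assert (q1 : 1 <= T ^ q) by (apply pow_R1_Rle; exact T1).
assert (T <= exp (INR i * T) * T ^ q); [|lra].
destruct i as [|i].
- destruct q as [|q]; [lia|]. simpl (INR 0). rewrite Rmult_0_l, exp_0, Rmult_1_l.
  simpl. pose proof (pow_R1_Rle T q T1). nra.
- assert (T <= exp (INR (S i) * T)); [|nra].
  assert (I1 : 1 <= INR (S i)) by (rewrite S_INR; pose proof (pos_INR i); lra).
  pose proof (exp_ineq1 (INR (S i) * T) ltac:(nra)). nra.
Qed.

Lemma divergent_monomial i q : (1 <= i + q)%nat ->
  divergent (fun t => RtoC (ln t ^ q / t ^ i)).
Proof.
intros H. exists ((RtoC 1, RtoC (- INR i), q) :: nil). split.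
- constructor; [now apply monomial_no_limit|constructor].
- intros eps He. simpl. unfold monomial. rewrite Rcpow_RtoC.
  replace (exp (- INR i * ln eps)) with (/ eps ^ i).
  + unfold Rdiv. rewrite RtoC_mult. ring.
  + rewrite <- (exp_ln eps He) at 1. rewrite exp_nat_mult, <- exp_Ropp. f_equal. ring.
Qed.

Lemma divergent_fp_log n i : divergent (fun t => RtoC (fp_log n i t)).
Proof.
destruct i as [|i].
- apply (divergent_ext (fun t => RtoC (/ INR (S n)) * RtoC (ln t ^ S n / t ^ 0))%C).
  + intros t Ht. rewrite <- RtoC_mult. f_equal.
    replace (fp_log n 0 t) with (ln t ^ S n / INR (S n)) by now destruct n.
    simpl (t ^ 0). field. apply not_0_INR; lia.
  + apply divergent_scal, divergent_monomial. lia.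
- assert (Ii : INR (S i) <> 0) by (apply not_0_INR; lia).
  induction n as [|n IH].
  + apply (divergent_ext (fun t => RtoC (- / INR (S i)) * RtoC (ln t ^ 0 / t ^ S i))%C).
    * intros t Ht. rewrite <- RtoC_mult. f_equal.
      change (fp_log 0 (S i) t) with (- / (INR (S i) * t ^ S i)). simpl (ln t ^ 0).
      field. split; [apply pow_nonzero; lra|exact Ii].
    * apply divergent_scal, divergent_monomial. lia.
  + apply (divergent_ext (fun t => RtoC (INR (S n) / INR (S i)) * RtoC (fp_log n (S i) t) +
       RtoC (- / INR (S i)) * RtoC (ln t ^ S n / t ^ S i))%C).
    * intros t Ht. rewrite <- !RtoC_mult, <- RtoC_plus. f_equal.
      change (fp_log (S n) (S i) t) with ((INR (S n) * fp_log n (S i) t - ln t ^ S n / t ^ S i) / INR (S i)).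
      field. split; [apply pow_nonzero; lra|exact Ii].
    * apply divergent_plus; apply divergent_scal; [exact IH|apply divergent_monomial; lia].
Qed.

(** * Products of series *)

Lemma csum_bound (u : nat -> C) B N : (forall m, (m < N)%nat -> Cmod (u m) <= B) ->
  Cmod (csum u N) <= INR N * B.
Proof.
induction N as [|N IH]; intros H.
- simpl. rewrite Cmod_0. lra.
- rewrite S_INR. simpl csum. refine (Rle_trans _ _ _ (Cmod_triangle _ _) _).
  specialize (IH (fun m Hm => H m (Nat.lt_lt_succ_r _ _ Hm))).
  specialize (H N (Nat.lt_succ_diag_r N)). lra.
Qed.

(** Both sides are the sum over the pairs [(m, i)] with [m + i < N]. *)
Lemma csum_cauchy_product (x : C) (c F : nat -> C) N :
  csum (fun j => x ^ j * csum (fun m => c m * F (j - m)%nat) (S j))%C N =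
  csum (fun m => c m * x ^ m * csum (fun i => x ^ i * F i) (N - m))%C N.
Proof.
induction N as [|N IH]; [reflexivity|].
rewrite csum_S, IH.
rewrite <- csum_scal.
rewrite (csum_ext (fun m => c m * x ^ m * csum (fun i => x ^ i * F i) (S N - m))%C
  (fun m => c m * x ^ m * csum (fun i => x ^ i * F i) (N - m) + x ^ N * (c m * F (N - m)%nat))%C (S N)).
- rewrite csum_plus, (csum_S (fun m => c m * x ^ m * csum (fun i => x ^ i * F i) (N - m))%C N), Nat.sub_diag.
  simpl (csum _ 0). ring.
- intros m Hm. replace (S N - m)%nat with (S (N - m)) by lia. rewrite csum_S.
  replace (x ^ N)%C with (x ^ m * x ^ (N - m))%C by (rewrite <- Cpow_add_r; f_equal; lia). ring.
Qed.

(** Both factors converge geometrically with ratio [q], so the error of the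
    product is of order [N q^N]. *)
Lemma cauchy_product_conv (x : C) (c F : nat -> C) (A V : C) K1 K2 q : 0 < q < 1 ->
  (forall m, Cmod (c m * x ^ m) <= K1 * q ^ m) -> Cconv (csum (fun m => c m * x ^ m)%C) A ->
  (forall N, Cmod (csum (fun i => x ^ i * F i)%C N - V) <= K2 * q ^ N) ->
  Cconv (csum (fun j => x ^ j * csum (fun m => c m * F (j - m)%nat) (S j))%C) (A * V)%C.
Proof.
intros Hq Hc HA HV.
assert (E : Cconv (fun N => csum (fun m => c m * x ^ m * (csum (fun i => x ^ i * F i) (N - m) - V))%C N) 0).
{ destruct (lin_geo q ((q + 1) / 2)) as (K & HK & HL); [lra|].
  assert (K10 : 0 <= K1).
  { specialize (Hc O). simpl in Hc. pose proof (Cmod_ge_0 (c O * 1)). lra. }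
  assert (K20 : 0 <= K2).
  { specialize (HV O). simpl in HV. pose proof (Cmod_ge_0 (0 - V)). lra. }
  apply (Cconv_bound _ _ (fun N => K1 * K2 * K * ((q + 1) / 2) ^ N)); [|apply geo_lim; lra].
  intros N. match goal with |- Cmod (?X - RtoC 0)%C <= _ => replace (X - RtoC 0)%C with X by ring end.
  apply Rle_trans with (INR N * (K1 * K2 * q ^ N)).
  - apply csum_bound. intros m Hm. rewrite Cmod_mult.
    replace (q ^ N) with (q ^ m * q ^ (N - m)) by (rewrite <- pow_add; f_equal; lia).
    replace (K1 * K2 * (q ^ m * q ^ (N - m))) with ((K1 * q ^ m) * (K2 * q ^ (N - m))) by ring.
    apply Rmult_le_compat; try apply Cmod_ge_0; auto.
  - specialize (HL N). assert (0 <= K1 * K2) by now apply Rmult_le_pos.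
    replace (INR N * (K1 * K2 * q ^ N)) with (K1 * K2 * (INR N * q ^ N)) by ring.
    rewrite (Rmult_assoc (K1 * K2)). now apply Rmult_le_compat_l. }
replace (A * V)%C with (0 + V * A)%C by ring.
eapply Cconv_ext; [|exact (Cconv_plus _ _ _ _ E (Cconv_scal _ _ V HA))].
intros N. cbv beta. rewrite csum_cauchy_product, <- csum_scal, <- csum_plus.
apply csum_ext. intros m _. ring.
Qed.

Lemma Int_end_Chasles a f r e v u : Rbar_lt 0 a -> CInt f e r u -> Int_end a f r v -> Int_end a f e (u + v)%C.
Proof.
intros Ha Hu Hv eps He. pose proof (left_end_proper a Ha) as PF.
eapply filter_imp; [|exact (Hv eps He)]. intros x (y & I & L). exists (u + y)%C.
split; [exact (CInt_Chasles _ _ _ _ _ _ Hu I)|].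
now replace (u + y - (u + v))%C with (y - v)%C by ring.
Qed.

(** For [a = oo] the finite part is first taken over intervals [(0, b)] that end at
    an interior point, where the improper integral is an ordinary one. *)
Lemma Int_end_interior (f : R -> C) r b : 0 < r -> 0 < b -> (forall t, 0 < t -> Ccont f t) ->
  Int_end (Finite b) f r (CRInt f r b).
Proof.
intros Hr Hb Hf.
assert (HI : forall x, 0 < x -> CInt f r x (CRInt f r x)).
{ intros x Hx. apply (tail_CInt p_infty f (fun t Ht _ => Hf t Ht)); simpl; auto. }
assert (HC : Ccont (fun x => CRInt f r x) b).
{ apply (Cder_cont _ _ (f b)).
  apply (is_derive_RInt (V := C_R_NormedModule) f _ r b); [|now apply Hf].
  exists (mkposreal b Hb). intros y Hy. apply HI.
  apply ball_R in Hy; simpl in Hy.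
  apply Rabs_def2 in Hy. lra. }
intros eps He. destruct (Ccont_eps_inv _ _ HC eps He) as (d & Hd & K).
exists (mkposreal (Rmin b d) ltac:(now apply Rmin_glb_lt)). intros x Hx _.
pose proof (Rmin_l b d). pose proof (Rmin_r b d).
apply ball_R in Hx; simpl in Hx.
exists (CRInt f r x). split.
- apply HI. apply Rabs_def2 in Hx. lra.
- apply K. lra.
Qed.

(** * The expansion of the Stieltjes integral *)

Section Expansion.
Variables (a : Rbar) (k : R -> C) (kc : C -> C) (n : nat) (w : C) (r r1 K : R) (c : nat -> C).
Hypotheses (Ha : Rbar_lt 0 a) (Hclass : class_K a k) (Hext : complex_extension a k kc)
  (Hw : slit_plane w) (Hr : Cmod w < r < r1) (Hra : Rbar_lt (Finite r) a)
  (Hc : forall m, Cmod (c m) * r1 ^ m <= K)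
  (Hk : forall z, Cmod z < r1 -> Cconv (csum (fun m => c m * z ^ m)%C) (kc z)).

Lemma w_pos : 0 < Cmod w. Proof. apply Cmod_gt_0. apply Hw. Qed.
Lemma r_pos : 0 < r. Proof. pose proof w_pos. lra. Qed.

Lemma Cder_k t : 0 < t -> Rbar_lt (Finite t) a -> exists l, Cder k t l.
Proof.
intros Ht Hta. destruct (Hext t ltac:(lra) Hta) as [An _].
exists (1 * cderiv kc (RtoC t))%C.
apply (Cder_ext_loc (fun t => kc (RtoC t))).
- assert (W : exists d, 0 < d /\ forall u, Rabs (u - t) < d -> 0 <= u /\ Rbar_lt (Finite u) a).
  { destruct a as [b| |]; simpl in *; [exists (Rmin t (b - t))|exists t|contradiction].
    - split; [apply Rmin_glb_lt; lra|]. intros u Hu. apply Rabs_def2 in Hu.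
      pose proof (Rmin_l t (b - t)). pose proof (Rmin_r t (b - t)). lra.
    - split; [exact Ht|]. intros u Hu. apply Rabs_def2 in Hu. split; [lra|exact Logic.I]. }
  destruct W as (d & Hd & W). exists (mkposreal d Hd). intros u Hu.
  destruct (W u Hu) as [U1 U2]. now apply Hext.
- apply (cdiff_chain kc (fun t => RtoC t)); [now apply analytic_cdiff|apply Cder_id].
Qed.

Lemma k_head t : 0 < t <= r -> k t = kc (RtoC t).
Proof.
intros Ht. symmetry. apply Hext; [lra|]. exact (below_a t r (proj2 Ht) Hra).
Qed.

Lemma Ccont_k_head t : 0 < t <= r -> Ccont k t.
Proof.
intros Ht. destruct (Cder_k t) as [l Hl]; [lra|exact (below_a t r (proj2 Ht) Hra)|].
eapply Cder_cont, Hl.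
Qed.

(** A Taylor remainder divided by the first power that it contains: bounded on
    [(0, r]]. *)
Definition taylor_quot (N : nat) (t : R) : C :=
  ((k t - csum (fun m => c m * RtoC t ^ m) N) / RtoC (t ^ N))%C.

Lemma coef_bound z m : 0 < r1 -> Cmod (c m * z ^ m) <= K * (Cmod z / r1) ^ m.
Proof.
intros H1. rewrite Cmod_mult, Cmod_pow. unfold Rdiv. rewrite Rpow_mult_distr, pow_inv.
pose proof (pow_lt r1 m H1) as P.
replace (Cmod (c m) * Cmod z ^ m) with ((Cmod (c m) * r1 ^ m) * (Cmod z ^ m * / r1 ^ m)) by (field; lra).
apply Rmult_le_compat_r; [|apply Hc].
apply Rmult_le_pos; [apply pow_le, Cmod_ge_0|left; now apply Rinv_0_lt_compat].
Qed.

Lemma K_pos : 0 <= K.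
Proof. specialize (Hc O). simpl in Hc. pose proof (Cmod_ge_0 (c O)). lra. Qed.

Definition taylor_quot_cst := K / (1 - r / r1).

Lemma taylor_quot_cst_pos : 0 <= taylor_quot_cst.
Proof.
pose proof K_pos. pose proof r_pos. apply Rmult_le_pos; [lra|].
assert (r / r1 < 1) by (apply ratio_lt_1; lra).
left; apply Rinv_0_lt_compat; lra.
Qed.

Lemma taylor_quot_bound N t : 0 < t <= r -> Cmod (taylor_quot N t) <= taylor_quot_cst * / r1 ^ N.
Proof.
intros Ht. pose proof r_pos as r0. pose proof K_pos as K0.
assert (tm : Cmod (RtoC t) = t) by (rewrite Cmod_R; apply Rabs_pos_eq; lra).
assert (q1 : 0 <= Cmod (RtoC t) / r1 < 1) by (apply ratio_bound; rewrite ?tm; lra).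
destruct (geo_sum _ K _ q1 (fun m => coef_bound (RtoC t) m ltac:(lra))) as [S HS].
assert (E : S = k t).
{ rewrite k_head by exact Ht.
  apply (Cconv_unique (csum (fun m => c m * RtoC t ^ m)%C)); [|apply Hk; rewrite tm; lra].
  exact (geo_sum_conv _ _ _ _ q1 HS). }
subst S. specialize (HS N). rewrite tm in *.
unfold taylor_quot. rewrite Cmod_div, Cmod_R, Rabs_pos_eq by
  (try apply RtoC_neq0, pow_nonzero; try apply pow_le; lra).
rewrite <- Cmod_opp. replace (- (k t - csum (fun m => c m * RtoC t ^ m) N))%C
  with (csum (fun m => c m * RtoC t ^ m) N - k t)%C by ring.
pose proof (pow_lt t N (proj1 Ht)) as P. pose proof (pow_lt r1 N ltac:(lra)) as P1.
apply (Rmult_le_reg_r (t ^ N)); [exact P|].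
unfold Rdiv at 1. rewrite Rmult_assoc, Rinv_l, Rmult_1_r by lra.
refine (Rle_trans _ _ _ HS _).
replace ((t / r1) ^ N) with (t ^ N * / r1 ^ N)
  by (unfold Rdiv; rewrite Rpow_mult_distr, pow_inv; reflexivity).
replace (taylor_quot_cst * / r1 ^ N * t ^ N) with (taylor_quot_cst * (t ^ N * / r1 ^ N)) by ring.
apply Rmult_le_compat_r.
- apply Rmult_le_pos; [lra|left; now apply Rinv_0_lt_compat].
- unfold taylor_quot_cst. apply Rmult_le_compat_l; [exact K0|].
  assert (r / r1 < 1) by (apply ratio_lt_1; lra).
  apply Rinv_le_contravar; [lra|]. apply Rplus_le_compat_l, Ropp_le_contravar.
  apply Rmult_le_compat_r; [left; apply Rinv_0_lt_compat; lra|lra].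
Qed.

Lemma Ccont_taylor_quot N t : 0 < t <= r -> Ccont (taylor_quot N) t.
Proof.
intros Ht. destruct (Cder_k t) as [l Hl]; [lra|exact (below_a t r (proj2 Ht) Hra)|].
eapply Cder_cont. unfold taylor_quot. apply Cder_div.
- apply Cder_minus; [exact Hl|].
  apply (Cder_csum (fun m t => c m * RtoC t ^ m)%C (fun m => c m * (RtoC (INR m) * RtoC t ^ (m - 1) * 1))%C).
  intros m _. apply Cder_scal. apply (Cder_pow (fun t => RtoC t)). apply Cder_id.
- apply (Cder_ext (fun t => RtoC t ^ N)%C); [intros; symmetry; apply RtoC_pow|].
  apply (Cder_pow (fun t => RtoC t)). apply Cder_id.
- apply RtoC_neq0, pow_nonzero; lra.
Qed.

(** Since [t * taylor_quot (N+1) t = taylor_quot N t - c N], multiplication by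
    [w + t] makes the sum telescope. *)
Lemma taylor_quot_telescope N t : 0 < t <= r ->
  (csum (fun j => (- w) ^ j * taylor_quot (S j) t) N * (w + RtoC t))%C =
  (k t - csum (fun m => c m * (- w) ^ m) N - (- w) ^ N * taylor_quot N t)%C.
Proof.
intros Ht. induction N as [|N IH].
- simpl csum. unfold taylor_quot. simpl. field.
- rewrite !csum_S, Cmult_plus_distr_r, IH.
  assert (E : (RtoC t * taylor_quot (S N) t)%C = (taylor_quot N t - c N)%C).
  { unfold taylor_quot. rewrite csum_S. simpl (t ^ S N). rewrite RtoC_mult, <- RtoC_pow. field.
    split; rewrite <- ?RtoC_pow; apply RtoC_neq0; try apply pow_nonzero; lra. }
  rewrite Cpow_S.
  replace ((- w) ^ N * taylor_quot (S N) t * (w + RtoC t))%C with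
    ((- w) ^ N * (RtoC t * taylor_quot (S N) t) + (- w) ^ N * w * taylor_quot (S N) t)%C by ring.
  rewrite E. ring.
Qed.

Definition logint (q : R -> C) (t : R) : C := (RtoC (ln t ^ n) * q t)%C.

Lemma head_values : exists Hv : nat -> C, forall N, Int0 (logint (taylor_quot N)) r (Hv N).
Proof.
apply (functional_choice (fun N v => Int0 (logint (taylor_quot N)) r v)). intros N. apply (Int0_ln_ex n r (taylor_quot N) (taylor_quot_cst * / r1 ^ N)).
- apply r_pos.
- intros t Ht. now apply Ccont_taylor_quot.
- intros t Ht. now apply taylor_quot_bound.
Qed.

(** The remainder in [taylor_quot_telescope] is of order [(|w|/r1)^N], uniformly
    in [t]. *)
Lemma head_stieltjes (Hv : nat -> C) : (forall N, Int0 (logint (taylor_quot N)) r (Hv N)) ->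
  exists U : C, Int0 (stieltjes_integrand k n w) r U /\
    Cconv (csum (fun j => (- w) ^ j * Hv (S j))%C) (U - kc (- w) * log_stieltjes n r w)%C.
Proof.
intros HHv. pose proof r_pos as r0. pose proof taylor_quot_cst_pos as K0. pose proof w_pos as w0.
assert (Aw := off_cut_slit w Hw). destruct Aw as (cw & Hcw & Lcw).
assert (Aw := off_cut_slit w Hw).
assert (kb : forall t, 0 < t <= r -> Cmod (k t) <= taylor_quot_cst).
{ intros t Ht. assert (B := taylor_quot_bound 0 t Ht). unfold taylor_quot in B. simpl in B.
  replace ((k t - 0) / 1)%C with (k t) in B by field. rewrite Rinv_1, Rmult_1_r in B. exact B. }
assert (ib : forall t, 0 < t <= r -> Cmod (/ (w + RtoC t)) <= / cw).
{ intros t Ht. rewrite Cmod_inv by (apply off_cut_neq; [exact Aw|lra]).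
  apply Rinv_le_contravar; [exact Hcw|apply Lcw; lra]. }
assert (cw0 : 0 < / cw) by now apply Rinv_0_lt_compat.
assert (ic : forall t, 0 < t <= r -> Ccont (fun t => / (w + RtoC t))%C t).
{ intros t Ht. eapply Cder_cont, Cder_inv_wt, off_cut_neq; [exact Aw|lra]. }
destruct (Int0_ln_ex n r (fun t => k t * / (w + RtoC t))%C (taylor_quot_cst * / cw) r0) as [U HU].
{ intros t Ht. apply Ccont_mult; [now apply Ccont_k_head|now apply ic]. }
{ intros t Ht. rewrite Cmod_mult. apply Rmult_le_compat; try apply Cmod_ge_0; auto. }
exists U. split.
{ eapply Int0_ext; [exact r0| |exact HU]. intros t _. unfold stieltjes_integrand, Cdiv. ring. }
destruct (Int0_ln_bound n r r0) as (Kn & HKn & Bn).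
set (sN := fun N => csum (fun m => c m * (- w) ^ m)%C N).
assert (E : Cconv (fun N => U - sN N * log_stieltjes n r w - csum (fun j => (- w) ^ j * Hv (S j)) N)%C 0).
{ apply (Cconv_bound _ _ (fun N => Kn * (taylor_quot_cst * / cw) * (Cmod w / r1) ^ N)).
  2:{ apply geo_lim, ratio_bound; lra. }
  intros N.
  assert (I := Int0_minus _ _ _ _ _ (Int0_minus _ _ _ _ _ HU
      (Int0_scal _ _ _ (sN N) (log_stieltjes_correct n r w r0 Aw)))
     (Int0_csum (fun j t => (- w) ^ j * logint (taylor_quot (S j)) t)%C _ r
        (fun j => Int0_scal _ _ _ ((- w) ^ j)%C (HHv (S j))) N)).
  match goal with |- Cmod (?X - RtoC 0)%C <= _ => replace (X - RtoC 0)%C with X by ring end.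
  rewrite Rmult_assoc.
  apply (Bn (fun t => (- w) ^ N * taylor_quot N t * / (w + RtoC t))%C).
  - intros t Ht. rewrite !Cmod_mult, Cmod_pow, Cmod_opp. unfold Rdiv. rewrite Rpow_mult_distr, pow_inv.
    assert (B := taylor_quot_bound N t Ht).
    replace (taylor_quot_cst * / cw * (Cmod w ^ N * / r1 ^ N)) with (Cmod w ^ N * (taylor_quot_cst * / r1 ^ N) * / cw) by ring.
    pose proof (pow_le (Cmod w) N (Cmod_ge_0 w)) as P.
    apply Rmult_le_compat; [apply Rmult_le_pos; [exact P|apply Cmod_ge_0]|apply Cmod_ge_0| |now apply ib].
    now apply Rmult_le_compat_l.
  - eapply Int0_ext; [exact r0| |exact I]. intros t Ht. cbv beta. unfold logint.
    rewrite (csum_ext (fun j => (- w) ^ j * (RtoC (ln t ^ n) * taylor_quot (S j) t))%C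
      (fun j => RtoC (ln t ^ n) * ((- w) ^ j * taylor_quot (S j) t))%C) by (intros; ring).
    rewrite csum_scal.
    assert (T := taylor_quot_telescope N t ltac:(lra)). assert (N0 := off_cut_neq w t Aw ltac:(lra)).
    set (X := csum (fun j => (- w) ^ j * taylor_quot (S j) t)%C N) in *.
    replace X with ((k t - sN N - (- w) ^ N * taylor_quot N t) * / (w + RtoC t))%C.
    + ring.
    + unfold sN. rewrite <- T. field. exact N0. }
assert (W1 : Cmod (- w) < r1) by (rewrite Cmod_opp; lra).
replace (U - kc (- w) * log_stieltjes n r w)%C with (U - log_stieltjes n r w * kc (- w) - 0)%C by ring.
eapply Cconv_ext; [|exact (Cconv_minus _ _ _ _ (Cconv_minus _ _ _ _ (Cconv_const U)
  (Cconv_scal _ _ (log_stieltjes n r w) (Hk (- w)%C W1))) E)].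
intros N. cbv beta. unfold sN. ring.
Qed.

(** A Cauchy product of the Taylor series at [-w] and of the finite-part series. *)
Lemma head_singular : Cconv (csum (fun j => (- w) ^ j *
    csum (fun m => c m * RtoC (fp_log n (j - m) r)) (S j))%C) (kc (- w) * fp_log_series n r w)%C.
Proof.
pose proof r_pos as r0. pose proof w_pos as w0.
assert (W1 : Cmod (- w) < r1) by (rewrite Cmod_opp; lra).
destruct (fp_log_series_rate n r w r0 ltac:(lra)) as [K2 HK2].
pose proof (ratio_bound w r r0 ltac:(lra)) as Hq.
assert (q0 : 0 < Cmod w / r) by now apply Rdiv_lt_0_compat.
apply (cauchy_product_conv (- w)%C c (fun i => RtoC (fp_log n i r)) (kc (- w)) (fp_log_series n r w) K K2 (Cmod w / r)).
- lra.
- intros m. refine (Rle_trans _ _ _ (coef_bound (- w)%C m ltac:(lra)) _).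
  apply Rmult_le_compat_l; [apply K_pos|]. rewrite Cmod_opp. apply pow_incr. split.
  + apply Rmult_le_pos; [apply Cmod_ge_0|left; apply Rinv_0_lt_compat; lra].
  + apply Rmult_le_compat_l; [apply Cmod_ge_0|]. apply Rinv_le_contravar; lra.
- apply Hk. exact W1.
- exact HK2.
Qed.

Lemma moment_head j e (y : C) : 0 < e < r -> CInt (logint (taylor_quot (S j))) e r y ->
  CInt (moment_integrand k n j) e r
    (csum (fun m => c m * (RtoC (fp_log n (j - m) r) - RtoC (fp_log n (j - m) e))) (S j) + y)%C.
Proof.
intros He Hy.
assert (I := CInt_plus _ _ _ _ _ _ (CInt_csum (fun m t => c m * (RtoC (ln t ^ n) / RtoC (t ^ S (j - m))))%C _ e r
   (fun m => CInt_scal _ _ _ _ (c m) (CInt_fp_log n (j - m) e r ltac:(lra))) (S j)) Hy).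
eapply CInt_ext; [|exact I]. intros t Ht. rewrite Rmin_left, Rmax_right in Ht by lra. cbv beta.
unfold moment_integrand, logint, taylor_quot. rewrite Nat.add_1_r.
assert (P0 : RtoC (t ^ S j) <> 0) by (apply RtoC_neq0, pow_nonzero; lra).
rewrite (csum_ext (fun m => c m * (RtoC (ln t ^ n) / RtoC (t ^ S (j - m))))%C
  (fun m => RtoC (ln t ^ n) / RtoC (t ^ S j) * (c m * RtoC t ^ m))%C).
- rewrite csum_scal. field. exact P0.
- intros m Hm. assert (P1 : RtoC (t ^ m) <> 0) by (apply RtoC_neq0, pow_nonzero; lra).
  assert (P2 : RtoC (t ^ S (j - m)) <> 0) by (apply RtoC_neq0, pow_nonzero; lra).
  rewrite <- RtoC_pow. replace (t ^ S j) with (t ^ S (j - m) * t ^ m).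
  + rewrite RtoC_mult. field. split; assumption.
  + rewrite <- pow_add. f_equal. lia.
Qed.

(** The values of [fp_log] at the lower end are the divergent terms; everything
    else converges. *)
Lemma is_fp_head (Hv : nat -> C) b j (T : C) : (forall N, Int0 (logint (taylor_quot N)) r (Hv N)) -> 0 < b ->
  Int_end (Finite b) (moment_integrand k n j) r T ->
  is_fp_finite b (moment_integrand k n j)
    (csum (fun m => c m * RtoC (fp_log n (j - m) r)) (S j) + Hv (S j) + T)%C.
Proof.
intros HHv Hb HT. pose proof r_pos as r0.
destruct (divergent_scal (RtoC (-1)) _ (divergent_csum (fun m t => c m * RtoC (fp_log n (j - m) t))%C (S j)
  (fun m => divergent_scal (c m) _ (divergent_fp_log n (j - m))))) as (D & HD & ED).
set (Y := fun e => CRInt (logint (taylor_quot (S j))) e r).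
assert (HY : forall e, 0 < e < r -> CInt (logint (taylor_quot (S j))) e r (Y e)).
{ intros e He. apply CRInt_correct.
  intros t Ht. rewrite Rmin_left, Rmax_right in Ht by lra.
  apply Ccont_mult; [eapply Cder_cont, Cder_ln_pow; lra|apply Ccont_taylor_quot; lra]. }
exists (fun e => csum (fun m => c m * RtoC (fp_log n (j - m) r)) (S j) + Y e + T)%C, D.
split; [exact HD|split].
- apply (at_right_intro _ r r0). intros e He.
  apply (Int_end_gen (Finite b)). rewrite ED by lra. cbv beta.
  assert (I := Int_end_Chasles (Finite b) _ r e T _ Hb (moment_head j e _ He (HY e He)) HT).
  match goal with |- Int_end _ _ _ ?X => match type of I with Int_end _ _ _ ?Z => replace X with Z; [exact I|] end end.
  rewrite (csum_ext (fun m => c m * (RtoC (fp_log n (j - m) r) - RtoC (fp_log n (j - m) e)))%C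
    (fun m => c m * RtoC (fp_log n (j - m) r) - c m * RtoC (fp_log n (j - m) e))%C) by (intros; ring).
  rewrite csum_minus. ring.
- apply (Clim_iff (at_right 0)). intros eps He.
  destruct (HHv (S j) eps He) as (d & Hd & Kd).
  apply (at_right_intro _ (Rmin d r)); [now apply Rmin_glb_lt|]. intros e [He0 He1].
  apply Rlt_min in He1.
  destruct (Kd e ltac:(lra)) as (y & Iy & Ly).
  rewrite (CInt_unique _ _ _ _ _ (HY e ltac:(lra)) Iy).
  match goal with |- Cmod ?X < _ => replace X with (y - Hv (S j))%C by ring end. exact Ly.
Qed.

Lemma moment_cont j t : 0 < t -> Rbar_lt (Finite t) a -> Ccont (moment_integrand k n j) t.
Proof.
intros Ht Hta. destruct (Cder_k t Ht Hta) as [l Hl]. eapply Cder_cont. unfold moment_integrand.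
apply Cder_div.
- apply Cder_mult; [exact Hl|apply Cder_ln_pow; exact Ht].
- apply (Cder_ext (fun t => RtoC t ^ (j + 1))%C); [intros; symmetry; apply RtoC_pow|].
  apply (Cder_pow (fun t => RtoC t)). apply Cder_id.
- apply RtoC_neq0, pow_nonzero; lra.
Qed.

Lemma is_fp_moment (Hv : nat -> C) j (T : C) : (forall N, Int0 (logint (taylor_quot N)) r (Hv N)) ->
  Int_end a (moment_integrand k n j) r T ->
  is_fp a (moment_integrand k n j)
    (csum (fun m => c m * RtoC (fp_log n (j - m) r)) (S j) + Hv (S j) + T)%C.
Proof.
intros HHv HT. assert (r0 := r_pos). assert (Hmc := moment_cont j).
assert (Hhead := fun b T => is_fp_head Hv b j T HHv).
destruct a as [b| |]; [now apply Hhead| |contradiction].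
set (P := (csum (fun m => c m * RtoC (fp_log n (j - m) r)) (S j) + Hv (S j))%C) in *.
exists (fun b => P + CRInt (moment_integrand k n j) r b)%C. split.
- intros b Hb. apply Hhead; [exact Hb|]. apply Int_end_interior; [exact r0|exact Hb|].
  intros t Ht. apply Hmc; [exact Ht|exact Logic.I].
- apply (Clim_iff (Rbar_locally p_infty)). intros eps He.
  eapply filter_imp; [|exact (HT eps He)]. intros x (y & Iy & Ly).
  rewrite (CRInt_unique _ _ _ _ Iy).
  match goal with |- Cmod ?X < _ => replace X with (y - T)%C by ring end. exact Ly.
Qed.

(** All the factors of [k(t) t^(2 del - 1)] that occur are symbols: those of the
    moments, of the Stieltjes integrand, and of the remainder after [N] terms.
    The size of the last one is of order [N r^(-N)]. *)
Lemma tail_values : exists (Tv : nat -> C) (Tw : C),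
  (forall j, Int_end a (moment_integrand k n j) r (Tv j)) /\
  Int_end a (stieltjes_integrand k n w) r Tw /\
  Cconv (csum (fun j => (- w) ^ j * Tv j)%C) Tw.
Proof.
pose proof r_pos as r0. pose proof w_pos as w0.
destruct (class_K_mellin a k Hclass) as (del & l & Hdel & Hl).
set (h := fun t => (k t * RtoC (exp ((2 * del - 1) * ln t)))%C) in *.
assert (hc : forall t, 0 < t -> Rbar_lt (Finite t) a -> Ccont h t).
{ intros t Ht Hta. destruct (Cder_k t Ht Hta) as [kl Hkl]. apply Ccont_mult; [eapply Cder_cont, Hkl|].
  eapply Cder_cont, Cder_RtoC with (l := (2 * del - 1) / t * exp ((2 * del - 1) * ln t)).
  auto_derive; [exact Ht|]. field. lra. }
destruct (tail_abel a Ha h hc r del l r0 Hra Hdel Hl) as (M & M0 & HM).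
destruct (symbol_ln n r del r0 Hdel) as (g' & B & B0 & HS).
set (g := fun t => RtoC (ln t ^ n * exp (- (2 * del) * ln t))) in *.
assert (hg : forall t, 0 < t -> (h t * g t)%C = (k t * RtoC (ln t ^ n) * RtoC (/ t))%C).
{ intros t Ht. unfold h, g. rewrite RtoC_mult.
  replace (/ t) with (exp ((2 * del - 1) * ln t) * exp (- (2 * del) * ln t)).
  - rewrite RtoC_mult. ring.
  - rewrite <- exp_plus. replace ((2 * del - 1) * ln t + - (2 * del) * ln t) with (- ln t) by ring.
    now rewrite exp_Ropp, exp_ln. }
destruct (symbol_kernel r w r0 ltac:(lra)) as (q' & Q & HQ).
assert (Q0 : 0 <= Q).
{ destruct (HQ r (Rle_refl r)) as (_ & _ & X & _). pose proof (Cmod_ge_0 (RtoC r / (w + RtoC r))).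
  replace (- 0 * ln r) with 0 in X by ring. rewrite exp_0, Rmult_1_r in X. lra. }
assert (exT : forall j, exists v, Int_end a (moment_integrand k n j) r v).
{ intros j. destruct (HM _ _ _ (symbol_mult r del _ _ _ _ _ _ r0 HS (symbol_pow r j r0))) as (v & Hv & _).
  exists v. apply (Int_end_ext a Ha (fun t => h t * (g t * RtoC (/ t ^ j)))%C); [exact Hra| |exact Hv].
  intros t Ht _. rewrite Cmult_assoc, hg by lra. unfold moment_integrand, Cdiv.
  rewrite Nat.add_1_r, <- RtoC_inv by (apply pow_nonzero; lra).
  simpl (t ^ S j). rewrite Rinv_mult, RtoC_mult. ring. }
destruct (functional_choice _ exT) as [Tv HTv].
assert (HSw := symbol_mult r del _ _ _ _ _ _ r0 HS HQ).
destruct (HM _ _ _ HSw) as (Tw & HTw & _).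
assert (HTw' : Int_end a (stieltjes_integrand k n w) r Tw).
{ apply (Int_end_ext a Ha (fun t => h t * (g t * (RtoC t / (w + RtoC t))))%C); [exact Hra| |exact HTw].
  intros t Ht _. rewrite Cmult_assoc, hg by lra. unfold stieltjes_integrand.
  rewrite RtoC_inv by lra. field. split; [apply Cmod_wt_neq; lra|apply RtoC_neq0; lra]. }
exists Tv, Tw. split; [exact HTv|split; [exact HTw'|]].
set (B1 := M * (2 * (2 * (B * Q)))).
assert (B10 : 0 <= B1).
{ unfold B1. apply Rmult_le_pos; [exact M0|]. pose proof (Rmult_le_pos _ _ B0 Q0). lra. }
destruct (lin_geo (Cmod w / r) ((Cmod w / r + 1) / 2)) as (K2 & HK2 & HL).
{ pose proof (ratio_bound w r r0 ltac:(lra)). lra. }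
pose proof (ratio_bound w r r0 ltac:(lra)) as Hq.
apply (Cconv_bound _ _ (fun N => B1 * (K2 * ((Cmod w / r + 1) / 2) ^ N + (Cmod w / r) ^ N))).
2:{ replace (Finite 0) with (Rbar_mult B1 0) by (simpl; f_equal; ring).
    apply is_lim_seq_scal_l. replace (Finite 0) with (Finite (0 + 0)) by (f_equal; ring).
    apply is_lim_seq_plus'; [apply geo_lim; lra|].
    eapply is_lim_seq_ext; [|apply (geo_lim 1 (Cmod w / r) Hq)]. intros N; simpl; ring. }
intros N.
destruct (HM _ _ _ (symbol_mult r del _ _ _ _ _ _ r0 HSw (symbol_pow r N r0))) as (v & Hv & Bv).
assert (E : (Tw + (-1) * ((- w) ^ N * v))%C = csum (fun j => (- w) ^ j * Tv j)%C N).
{ apply (Int_end_unique a Ha (fun t => csum (fun j => (- w) ^ j * moment_integrand k n j t)%C N) r).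
  2:{ apply (Int_end_csum a Ha (fun j t => (- w) ^ j * moment_integrand k n j t)%C).
      intros j. apply Int_end_scal; [exact Ha|apply HTv]. }
  eapply Int_end_ext; [exact Ha|exact Hra| |exact (Int_end_plus a Ha _ _ _ _ _ HTw'
    (Int_end_scal a Ha _ _ _ (-1) (Int_end_scal a Ha _ _ _ ((- w) ^ N)%C Hv)))].
  intros t Ht _. cbv beta.
  assert (tn : RtoC t <> 0) by (apply RtoC_neq0; lra).
  assert (wt : (w + RtoC t)%C <> 0) by (apply Cmod_wt_neq; lra).
  rewrite (csum_ext (fun j => (- w) ^ j * moment_integrand k n j t)%C
    (fun j => k t * RtoC (ln t ^ n) * ((- w) ^ j / RtoC (t ^ S j)))%C).
  2:{ intros j _. unfold moment_integrand, Cdiv. rewrite Nat.add_1_r. ring. }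
  rewrite csum_scal.
  assert (X := kernel_expand w t N ltac:(lra) wt).
  set (Y := csum (fun i => (- w) ^ i / RtoC (t ^ S i))%C N) in *.
  replace Y with (/ (w + RtoC t) - (- w / RtoC t) ^ N * / (w + RtoC t))%C
    by (rewrite X at 1; ring).
  replace (h t * (g t * (RtoC t / (w + RtoC t)) * RtoC (/ t ^ N)))%C with
    ((h t * g t) * (RtoC t / (w + RtoC t)) * RtoC (/ t ^ N))%C by ring.
  rewrite hg by lra. unfold stieltjes_integrand.
  assert (Z : ((- w / RtoC t) ^ N)%C = ((- w) ^ N * RtoC (/ t ^ N))%C).
  { unfold Cdiv. rewrite Cpow_mult_l, <- RtoC_inv, <- RtoC_pow, pow_inv by lra. reflexivity. }
  rewrite Z, RtoC_inv by lra. field. split; assumption. }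
rewrite <- E. replace (Tw + (-1) * ((- w) ^ N * v) - Tw)%C with (- ((- w) ^ N * v))%C by ring.
rewrite Cmod_opp, Cmod_mult, Cmod_pow, Cmod_opp.
pose proof (pow_le (Cmod w) N ltac:(lra)) as P.
refine (Rle_trans _ _ _ (Rmult_le_compat_l _ _ _ P Bv) _).
specialize (HL N).
replace (Cmod w ^ N * (M * (2 * (2 * (B * Q) * (INR (S N) * / r ^ N))))) with
  (B1 * (INR N * (Cmod w / r) ^ N + (Cmod w / r) ^ N)).
- apply Rmult_le_compat_l; [exact B10|]. lra.
- unfold B1, Rdiv. rewrite S_INR, Rpow_mult_distr, pow_inv. ring.
Qed.

Theorem expansion : exists (M : nat -> C) (S : C),
  (forall j, is_fp a (moment_integrand k n j) (M j)) /\
  Cconv (csum (fun j => (- w) ^ j * M j)%C) S /\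
  is_stieltjes a k n w (S + kc (- w) * Delta_log n w)%C.
Proof.
pose proof r_pos as r0.
destruct head_values as [Hv HHv].
destruct (head_stieltjes Hv HHv) as (U & HU & CU).
destruct tail_values as (Tv & Tw & HTv & HTw & CT).
exists (fun j => csum (fun m => c m * RtoC (fp_log n (j - m) r)) (S j) + Hv (S j) + Tv j)%C,
  (kc (- w) * fp_log_series n r w + (U - kc (- w) * log_stieltjes n r w) + Tw)%C.
split; [|split].
- intros j. apply is_fp_moment; [exact HHv|apply HTv].
- eapply Cconv_ext; [|exact (Cconv_plus _ _ _ _ (Cconv_plus _ _ _ _ head_singular CU) CT)].
  intros N. cbv beta. rewrite <- !csum_plus. apply csum_ext. intros j _. ring.
- rewrite <- (log_identity n r w r0 ltac:(lra) Hw).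
  replace (kc (- w) * fp_log_series n r w + (U - kc (- w) * log_stieltjes n r w) + Tw +
    kc (- w) * (log_stieltjes n r w - fp_log_series n r w))%C with (U + Tw)%C by ring.
  pose proof (left_end_proper a Ha) as PF.
  unfold is_stieltjes. apply (is_RInt_gen_Chasles (V := C_R_NormedModule) _ r).
  + now apply Int0_gen.
  + now apply Int_end_gen.
Qed.

End Expansion.

Lemma Rbar_lt_min x y z : Rbar_lt x (Rbar_min y z) -> Rbar_lt x y /\ Rbar_lt x z.
Proof.
intros H. split; eapply Rbar_lt_le_trans; [exact H|apply Rbar_min_l|exact H|apply Rbar_min_r].
Qed.

Lemma common_radius kc rho0 a (x : R) : Rbar_lt x (Rbar_min rho0 a) ->
  nearest_singularity_distance kc rho0 ->
  exists R0, x < R0 /\ (forall y : R, y < R0 -> Rbar_lt y a) /\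
    forall z, Cmod z < R0 -> analytic_at kc z.
Proof.
intros H Hs. destruct (Rbar_lt_min _ _ _ H) as [H1 H2]. clear H.
destruct rho0 as [p| |]; [destruct Hs as (_ & Hs & _)| |contradiction];
  (destruct a as [b| |]; [| |contradiction]); simpl in *.
- exists (Rmin p b). split; [now apply Rmin_glb_lt|]. pose proof (Rmin_l p b). pose proof (Rmin_r p b).
  split; intros; [lra|apply Hs; lra].
- exists p. auto.
- exists b. auto.
- exists (x + 1). repeat split; auto. lra.
Qed.

Lemma stieltjes_expansion a k kc rho0 n w : Rbar_lt 0 a -> class_K a k -> complex_extension a k kc ->
  nearest_singularity_distance kc rho0 -> slit_plane w -> Rbar_lt (Cmod w) (Rbar_min rho0 a) ->
  exists S : C, (forall j, ex_fp a (moment_integrand k n j)) /\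
    Cconv (csum (fun j => (- w) ^ j * fp a (moment_integrand k n j))%C) S /\
    is_stieltjes a k n w (S + kc (- w) * Delta_log n w)%C.
Proof.
intros Ha HK Hext Hs Hw Hlt.
destruct (common_radius _ _ _ _ Hlt Hs) as (R0 & H1 & H2 & H3).
pose proof (Cmod_ge_0 w) as W0.
destruct (taylor_disc kc R0 ((Cmod w + 2 * R0) / 3) H3 ltac:(lra)) as (c & K & Hc & Hk).
destruct (expansion a k kc n w ((2 * Cmod w + R0) / 3) ((Cmod w + 2 * R0) / 3) K c Ha HK Hext Hw
  ltac:(lra) (H2 ((2 * Cmod w + R0) / 3) ltac:(lra)) Hc Hk) as (M & S & E1 & E2 & E3).
exists S. split; [intros j; exists (M j); apply E1|split; [|exact E3]].
eapply Cconv_ext; [|exact E2]. intros N. apply csum_ext. intros j _.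
now rewrite (fp_eq _ _ _ (E1 j)).
Qed.

(** * Behaviour at the origin *)

Lemma csum_low_degree (d : nat -> C) n N : exists B, forall u, 1 <= Cmod u ->
  Cmod (csum (fun i => d i * u ^ (n - i))%C N) <= B * Cmod u ^ n.
Proof.
induction N as [|N [B IH]].
- exists 0. intros u _. simpl. rewrite Cmod_0. lra.
- exists (B + Cmod (d N)). intros u Hu. rewrite csum_S.
  refine (Rle_trans _ _ _ (Cmod_triangle _ _) _). rewrite Rmult_plus_distr_r.
  apply Rplus_le_compat; [now apply IH|]. rewrite Cmod_mult, Cmod_pow.
  apply Rmult_le_compat_l; [apply Cmod_ge_0|]. apply Rle_pow; [exact Hu|lia].
Qed.

(** The leading term dominates the others by a factor [|u|]. *)
Lemma delta_poly_growth n : exists B, forall u, 1 <= Cmod u -> B <= Cmod u ->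
  Cmod u - B <= INR (S n) * Cmod (delta_poly n u).
Proof.
set (b := fun i => (delta_coef i * i_pi ^ i)%C).
destruct (csum_low_degree (fun i => RtoC (Binomial.C (S n) (S i)) * b (S i))%C n (S n)) as [B HB].
exists B. intros u H1 H2.
assert (I0 : 0 < INR (S n)) by (apply lt_0_INR; lia).
unfold delta_poly. fold b. rewrite Cmod_mult, Cmod_opp, Cmod_inv, Cmod_R, Rabs_pos_eq by
  (try apply INR_S_neq0; lra).
rewrite <- Rmult_assoc, Rinv_r, Rmult_1_l by lra.
unfold appell_poly. rewrite csum_first, binom_0, Nat.sub_0_r.
replace (b O) with (RtoC 1) by (unfold b; rewrite delta_coef_0; simpl; ring).
rewrite (csum_ext _ (fun i => RtoC (Binomial.C (S n) (S i)) * b (S i) * u ^ (n - i))%C) by reflexivity.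
specialize (HB u H1).
set (X := csum (fun i => RtoC (Binomial.C (S n) (S i)) * b (S i) * u ^ (n - i))%C (S n)) in *.
pose proof (Cmod_triangle (1 * 1 * u ^ S n + X) (- X)) as T.
replace (1 * 1 * u ^ S n + X + - X)%C with (u ^ S n)%C in T by ring.
rewrite Cmod_opp, Cmod_pow in T. simpl (Cmod u ^ S n) in T.
pose proof (pow_R1_Rle (Cmod u) n H1). nra.
Qed.

Lemma Delta_log_large n B : exists d, 0 < d /\ forall w : C, w <> 0 -> Cmod w < d ->
  B <= Cmod (Delta_log n w).
Proof.
destruct (delta_poly_growth n) as [D HD].
assert (I0 : 0 < INR (S n)) by (apply lt_0_INR; lia).
set (T := Rmax 1 (Rmax D (D + INR (S n) * B))).
assert (T1 : 1 <= T) by apply Rmax_l.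
assert (T2 : D <= T) by (eapply Rle_trans; [apply Rmax_l|apply Rmax_r]).
assert (T3 : D + INR (S n) * B <= T) by (eapply Rle_trans; [apply (Rmax_r D)|apply Rmax_r]).
exists (exp (- T)). split; [apply exp_pos|]. intros w Hw0 Hw.
rewrite Delta_log_delta_poly.
assert (w0 : 0 < Cmod w) by now apply Cmod_gt_0.
assert (L : T <= Cmod (Log w)).
{ refine (Rle_trans _ _ _ _ (re_le_Cmod (Log w))). unfold Log; simpl.
  assert (Q := ln_increasing _ _ w0 Hw). rewrite ln_exp in Q.
  rewrite Rabs_left by lra. lra. }
specialize (HD (Log w) ltac:(lra) ltac:(lra)).
apply (Rmult_le_reg_l (INR (S n))); lra.
Qed.

Lemma slit_RtoC x : 0 < x -> slit_plane (RtoC x).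
Proof.
intros Hx. split; [apply RtoC_neq0; lra|]. unfold Arg.
change (Im (RtoC x)) with 0. destruct (Rle_dec 0 0) as [_|N]; [|exfalso; apply N; lra].
change (Re (RtoC x)) with x. rewrite Cmod_R, (Rabs_pos_eq x) by lra.
unfold Rdiv. rewrite Rinv_r, acos_1, Rabs_R0 by lra. apply PI_RGT_0.
Qed.

Lemma stieltjes_eq a k n w (v : C) : Rbar_lt 0 a -> is_stieltjes a k n w v -> stieltjes a k n w = v.
Proof.
intros Ha H. assert (PF := Proper_StrongProper _ (left_end_proper a Ha)).
exact (is_RInt_gen_unique (V := C_R_CompleteNormedModule) _ v H).
Qed.

(** The regular part stays bounded at the origin, as the sum of a power series
    that converges at some positive [x]. *)
Lemma regular_part_bounded a k kc rho0 n : Rbar_lt 0 a -> class_K a k -> complex_extension a k kc ->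
  nearest_singularity_distance kc rho0 ->
  exists x B, 0 < x /\ 0 <= B /\ forall w, slit_plane w -> Cmod w < x ->
    Cmod (stieltjes a k n w - kc (- w) * Delta_log n w)%C <= B.
Proof.
intros Ha HK Hext Hs.
assert (Hx : exists x : R, 0 < x /\ Rbar_lt x (Rbar_min rho0 a)).
{ destruct rho0 as [p| |]; [destruct Hs as (Hp & _)| |contradiction];
    (destruct a as [b| |]; [| |contradiction]); simpl in *.
  - exists (Rmin p b / 2). assert (0 < Rmin p b) by now apply Rmin_glb_lt. lra.
  - exists (p / 2). lra.
  - exists (b / 2). lra.
  - exists 1. split; [lra|exact Logic.I]. }
destruct Hx as (x & Hx & Hlt).
assert (xm : Cmod (RtoC x) = x) by (rewrite Cmod_R; apply Rabs_pos_eq; lra).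
destruct (stieltjes_expansion a k kc rho0 n (RtoC x) Ha HK Hext Hs (slit_RtoC x Hx)) as (S0 & _ & H0 & _).
{ now rewrite xm. }
set (M := fun j => fp a (moment_integrand k n j)).
change (Cconv (csum (fun j => (- RtoC x) ^ j * M j)%C) S0) in H0.
destruct (Cconv_bounded _ _ H0) as [B HB].
assert (HM : forall j, Cmod (M j) * x ^ j <= 2 * B).
{ intros j. replace (Cmod (M j) * x ^ j) with (Cmod ((- RtoC x) ^ j * M j)).
  2:{ rewrite Cmod_mult, Cmod_pow, Cmod_opp, xm. ring. }
  pose proof (HB j) as B1. pose proof (HB (S j)) as B2. rewrite csum_S in B2.
  set (u := csum (fun j => (- RtoC x) ^ j * M j)%C j) in *.
  pose proof (Cmod_triangle (u + (- RtoC x) ^ j * M j) (- u)) as T.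
  replace (u + (- RtoC x) ^ j * M j + - u)%C with ((- RtoC x) ^ j * M j)%C in T by ring.
  rewrite Cmod_opp in T. lra. }
assert (B0 : 0 <= 2 * B).
{ specialize (HM O). simpl in HM. pose proof (Cmod_ge_0 (M O)). lra. }
exists (x / 2), (2 * B / (1 - / 2)). split; [lra|split; [lra|]]. intros w Hw Hwx.
destruct (stieltjes_expansion a k kc rho0 n w Ha HK Hext Hs Hw) as (S & _ & HS & ES).
{ eapply Rbar_lt_trans; [|exact Hlt]. simpl. lra. }
rewrite (stieltjes_eq _ _ _ _ _ Ha ES).
replace (S + kc (- w) * Delta_log n w - kc (- w) * Delta_log n w)%C with S by ring.
change (Cconv (csum (fun j => (- w) ^ j * M j)%C) S) in HS.
apply (Cconv_le _ _ _ HS). intros N.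
replace (2 * B / (1 - / 2)) with (2 * B / (1 - / 2) * (/ 2) ^ 0) by (simpl; ring).
replace (csum (fun j => (- w) ^ j * M j)%C N) with
  (csum (fun j => (- w) ^ j * M j)%C (0 + N) - csum (fun j => (- w) ^ j * M j)%C 0)%C by (simpl; ring).
apply csum_geo_bound; [lra|]. intros j. rewrite Cmod_mult, Cmod_pow, Cmod_opp.
pose proof (Cmod_ge_0 w) as W0. pose proof (pow_lt x j Hx) as P.
assert (Q : Cmod w ^ j <= (x / 2) ^ j) by (apply pow_incr; lra).
refine (Rle_trans _ _ _ (Rmult_le_compat_r _ _ _ (Cmod_ge_0 _) Q) _).
unfold Rdiv. rewrite Rpow_mult_distr.
replace (x ^ j * (/ 2) ^ j * Cmod (M j)) with (Cmod (M j) * x ^ j * (/ 2) ^ j) by ring.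
apply Rmult_le_compat_r; [apply pow_le; lra|apply HM].
Qed.

Lemma Cmod_locally (z : C) (P : C -> Prop) d : 0 < d -> (forall z', Cmod (z' - z) < d -> P z') ->
  locally z P.
Proof.
intros Hd H. exists (mkposreal (d / 2) ltac:(lra)). intros z' Hz'. apply H.
assert (Q := C_NormedModule_mixin_compat2 z z' (mkposreal (d / 2) ltac:(lra)) Hz').
change (Cmod (z' - z) < sqrt 2 * (d / 2)) in Q.
assert (sqrt 2 < 2); [|nra].
rewrite <- (sqrt_square 2) at 2 by lra. apply sqrt_lt_1; lra.
Qed.

Theorem theorem7p2 (a : Rbar) (k : R -> C) (kc : C -> C) (rho0 : Rbar)
  (a_pos : Rbar_lt 0 a)
  (k_class : class_K a k)
  (k_ext : complex_extension a k kc)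
  (k_sing : nearest_singularity_distance kc rho0)
  (n : nat) :
  (forall w : C, slit_plane w -> Rbar_lt (Cmod w) (Rbar_min rho0 a) ->
     (a = p_infty -> ex_stieltjes a k n w) ->
     (forall j : nat, ex_fp a (moment_integrand k n j)) /\
     exists S : C,
       is_series (K := C_AbsRing) (V := C_NormedModule)
         (fun j => (-1) ^ j * w ^ j * fp a (moment_integrand k n j))%C S /\
       is_stieltjes a k n w (S + kc (- w) * Delta_log n w)%C) /\
  ((a = p_infty -> forall w : C, slit_plane w -> Rbar_lt (Cmod w) rho0 ->
      ex_stieltjes a k n w) ->
   is_equiv (K := C_AbsRing) (V := C_NormedModule)
     (within slit_plane (locally (RtoC 0)))
     (fun w => stieltjes a k n w)
     (fun w => k 0 * Delta_log n w)%C).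
Proof.
split.
- intros w Hw Hlt _.
  destruct (stieltjes_expansion a k kc rho0 n w a_pos k_class k_ext k_sing Hw Hlt) as (S & H1 & H2 & H3).
  split; [exact H1|]. exists S. split; [|exact H3]. apply is_series_csum.
  eapply Cconv_ext; [|exact H2]. intros N. apply csum_ext. intros j _.
  replace (- w)%C with (RtoC (-1) * w)%C by ring. now rewrite Cpow_mult_l.
- intros _ eps.
  destruct (regular_part_bounded a k kc rho0 n a_pos k_class k_ext k_sing) as (x & B & Hx & HB & Hreg).
  assert (k0 : 0 < Cmod (k 0)) by (apply Cmod_gt_0, k_class).
  destruct (k_ext 0 (Rle_refl 0) a_pos) as [An Ek].
  destruct (analytic_cdiff _ _ An) as (K & d1 & HK & Hd1 & Hdiff).
  set (D := cderiv kc (RtoC 0)) in *. pose proof (Cmod_ge_0 D) as D0.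
  pose proof (cond_pos eps) as He.
  destruct (Delta_log_large n (2 * B / (eps * Cmod (k 0)))) as (d2 & Hd2 & HL).
  set (e := eps / 2 * Cmod (k 0) / (K + Cmod D + 1)).
  assert (Hpos : 0 < e) by (unfold e; apply Rdiv_lt_0_compat; [apply Rmult_lt_0_compat|]; lra).
  set (d := Rmin (Rmin x (Rmin d1 1)) (Rmin d2 e)).
  assert (Hd : 0 < d) by (unfold d; repeat apply Rmin_glb_lt; lra).
  apply (Cmod_locally (RtoC 0) _ d Hd). intros w Hw Hs.
  replace (w - 0)%C with w in Hw by ring.
  apply Rlt_min in Hw. destruct Hw as [Hw1 Hw2]. apply Rlt_min in Hw1, Hw2.
  destruct Hw1 as [Hw0 Hw1]. apply Rlt_min in Hw1.
  set (Dl := Delta_log n w).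
  change (Cmod (k 0 * Dl - stieltjes a k n w) <= eps * Cmod (k 0 * Dl)).
  replace (k 0 * Dl - stieltjes a k n w)%C with
    ((k 0 - kc (- w)) * Dl + - (stieltjes a k n w - kc (- w) * Dl))%C by ring.
  refine (Rle_trans _ _ _ (Cmod_triangle _ _) _). rewrite Cmod_opp, !Cmod_mult.
  assert (R1 := Hreg w Hs ltac:(lra)). fold Dl in R1.
  assert (R2 := HL w (proj1 Hs) ltac:(lra)). fold Dl in R2.
  pose proof (Cmod_ge_0 w) as W0. pose proof (Cmod_ge_0 Dl) as Dl0.
  assert (R3 : Cmod (k 0 - kc (- w)%C) <= eps / 2 * Cmod (k 0)).
  { assert (Q := Hdiff (- w)%C).
    replace (- w - 0)%C with (- w)%C in Q by ring. rewrite Cmod_opp in Q. specialize (Q ltac:(lra)).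
    rewrite Ek in Q.
    replace (k 0 - kc (- w))%C with (- (kc (- w) - k 0 - - w * D) + w * D)%C by ring.
    refine (Rle_trans _ _ _ (Cmod_triangle _ _) _). rewrite Cmod_opp, Cmod_mult.
    assert (E : e * (K + Cmod D + 1) = eps / 2 * Cmod (k 0)) by (unfold e; field; lra).
    rewrite <- E.
    assert (K * Cmod w ^ 2 <= K * Cmod w) by (apply Rmult_le_compat_l; [exact HK|nra]).
    apply Rle_trans with (Cmod w * (K + Cmod D + 1)); [lra|]. apply Rmult_le_compat_r; lra. }
  assert (R4 : B <= eps / 2 * Cmod (k 0) * Cmod Dl).
  { apply (Rmult_le_compat_l (eps / 2 * Cmod (k 0))) in R2; [|apply Rmult_le_pos; lra].
    replace (eps / 2 * Cmod (k 0) * (2 * B / (eps * Cmod (k 0)))) with B in R2 by (field; lra). exact R2. }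
  assert (Cmod (k 0 - kc (- w)%C) * Cmod Dl <= eps / 2 * Cmod (k 0) * Cmod Dl)
    by (apply Rmult_le_compat_r; lra).
  lra.
Qed.
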